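(* Let $\mathscr{L}=\{\ell_n\}_{n\in\mathbb{N}_0}$ and $\mathscr{M}=\{m_n\}_{n\in\mathbb{N}_0}$ be weight sequences such that $\mathscr{M}\prec\mathscr{L}$, and for $\alpha\in\mathbb{C}$ let $P_\alpha=P_\alpha(D_1,D_2)=D_1-\alpha D_2$ on $\mathbb{T}^2$. 1. If $P_\alpha$ is globally $\mathscr{L}$-hypoelliptic, then it is also globally $\mathscr{M}$-hypoelliptic. 2. There exists $\beta\in\mathbb{R}\setminus\mathbb{Q}$ such that $P_\beta$ is globally $\mathscr{M}$-hypoelliptic but not globally $\mathscr{L}$-hypoelliptic.
   Context: $\mathbb{N}=\{1,2,\dots\}$, $\mathbb{N}_0=\mathbb{N}\cup\{0\}$, $\mathbb{T}^2=\mathbb{R}^2/2\pi\mathbb{Z}^2$. A weight sequence is a sequence $\mathscr{M}=\{m_n\}_{n\in\mathbb{N}_0}$ of positive reals with: $m_0=m_1=1$; $m_n^2\le m_{n-1}m_{n+1}$ for all $n\in\mathbb{N}$; and there is $H>1$ with $m_{j+k}\le H^{j+k}m_jm_k$ for all $j,k\in\mathbb{N}_0$. One writes $\mathscr{M}\prec\mathscr{L}$ if $\lim_{k\to+\infty}\left(\frac{m_k}{\ell_k}\right)^{1/k}=0$. For a weight sequence $\mathscr{M}$, $\mathcal{E}_{\mathscr{M}}(\mathbb{T}^2)$ is the space of $f\in C^\infty(\mathbb{T}^2)$ (complex-valued) for which there are $C,h>0$ with $|D^\gamma f(x)|\le C h^{|\gamma|}m_{|\gamma|}|\gamma|!$ for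 all $x\in\mathbb{T}^2$, $\gamma\in\mathbb{N}_0^2$, where $D_j=-i\partial_{x_j}$. For $h>0$, $\mathcal{E}_{\mathscr{M},h}(\mathbb{T}^2)$ is the Banach space of those $f$ with $\|f\|_{\mathscr{M},h}:=\sup_{x,\gamma}\frac{|D^\gamma f(x)|}{h^{|\gamma|}m_{|\gamma|}|\gamma|!}<\infty$. $\mathcal{E}_{\mathscr{M}}(\mathbb{T}^2)$ carries the locally convex inductive limit topology of the spaces $\mathcal{E}_{\mathscr{M},h_n}(\mathbb{T}^2)$ for any strictly increasing positive sequence $h_n\to+\infty$ (the topology does not depend on the choice). $\mathscr{D}'_{\mathscr{M}}(\mathbb{T}^2)$ is the topological dual of $\mathcal{E}_{\mathscr{M}}(\mathbb{T}^2)$; $\mathcal{E}_{\mathscr{M}}(\mathbb{T}^2)$ is regarded as a subspace of it via $\langle f,\varphi\rangle=\int_{\mathbb{T}^2}f\varphi\,dx$, and differential operators act by duality. An operator $P$ is globally $\mathscr{M}$-hypoelliptic if $u\in\mathscr{D}'_{\mathscr{M}}(\mathbb{T}^2)$ and $Pu\in\mathcal{E}_{\mathscr{M}}(\mathbb{T}^2)$ imply $u\in\mathcal{E}_{\mathscr{M}}(\mathbb{T}^2)$; similarly for $\mathscr{L}$. *)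

(* Defs.v *)
From Stdlib Require Import Reals Arith Factorial QArith Qreals Lra Lia.
From Coquelicot Require Import Coquelicot.

Open Scope R_scope.

(** * Weight sequences *)

Definition weight_sequence (m : nat -> R) : Prop :=
  (forall n, 0 < m n) /\
  m 0%nat = 1 /\ m 1%nat = 1 /\
  (forall n, (1 <= n)%nat -> m n ^ 2 <= m (n - 1)%nat * m (n + 1)%nat) /\
  (exists H : R, 1 < H /\
     forall j k : nat, m (j + k)%nat <= H ^ (j + k) * m j * m k).

(** The value of the root at [k = 0] is immaterial for the limit. *)
Definition seq_prec (m l : nat -> R) : Prop :=
  is_lim_seq (fun k => Rpower (m k / l k) (/ INR k)) 0.

(** * Smooth functions on the torus

    A function on [R^2 / 2 pi Z^2] is a function on [R^2] that is
    [2 pi]-periodic in each variable. *)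

Definition periodic (f : R * R -> C) : Prop :=
  forall x y : R, f (x + 2 * PI, y) = f (x, y) /\ f (x, y + 2 * PI) = f (x, y).

(** Coquelicot's [Derive] is real-valued, so curves [R -> C] are
    differentiated through their real and imaginary parts. *)
Definition ex_deriveC (g : R -> C) (t : R) : Prop :=
  ex_derive (fun s => Re (g s)) t /\ ex_derive (fun s => Im (g s)) t.

Definition DeriveC (g : R -> C) (t : R) : C :=
  (Derive (fun s => Re (g s)) t, Derive (fun s => Im (g s)) t).

Definition partial1 (f : R * R -> C) : R * R -> C :=
  fun p => DeriveC (fun t => f (t, snd p)) (fst p).

Definition partial2 (f : R * R -> C) : R * R -> C :=
  fun p => DeriveC (fun t => f (fst p, t)) (snd p).

Fixpoint class_Ck (k : nat) (f : R * R -> C) : Prop :=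
  (forall p : R * R, continuous f p) /\
  match k with
  | O => True
  | S k' =>
      (forall p : R * R,
         ex_deriveC (fun t => f (t, snd p)) (fst p) /\
         ex_deriveC (fun t => f (fst p, t)) (snd p)) /\
      class_Ck k' (partial1 f) /\ class_Ck k' (partial2 f)
  end.

Definition smooth_torus (f : R * R -> C) : Prop :=
  periodic f /\ forall k : nat, class_Ck k f.

Definition D1 (f : R * R -> C) : R * R -> C := fun p => (- Ci * partial1 f p)%C.
Definition D2 (f : R * R -> C) : R * R -> C := fun p => (- Ci * partial2 f p)%C.

Definition Dgamma (g : nat * nat) (f : R * R -> C) : R * R -> C :=
  Nat.iter (fst g) D1 (Nat.iter (snd g) D2 f).

Definition order (g : nat * nat) : nat := (fst g + snd g)%nat.

(** * Ultradifferentiable functions *)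

Definition EM (m : nat -> R) (f : R * R -> C) : Prop :=
  smooth_torus f /\
  exists A h : R, 0 < A /\ 0 < h /\
    forall (x : R * R) (g : nat * nat),
      Cmod (Dgamma g f x) <= A * h ^ order g * m (order g) * INR (fact (order g)).

Definition EMh_norm (m : nat -> R) (h : R) (f : R * R -> C) : Rbar :=
  Lub_Rbar (fun r => exists (x : R * R) (g : nat * nat),
    r = Cmod (Dgamma g f x) / (h ^ order g * m (order g) * INR (fact (order g)))).

Definition EMh (m : nat -> R) (h : R) (f : R * R -> C) : Prop :=
  smooth_torus f /\ Rbar_lt (EMh_norm m h f) p_infty.

(** * The inductive limit topology and its dual *)

Definition admissible_steps (h : nat -> R) : Prop :=
  (forall n, 0 < h n) /\ (forall n, h n < h (S n)) /\ is_lim_seq h p_infty.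

Definition absolutely_convex (U : (R * R -> C) -> Prop) : Prop :=
  forall (f g : R * R -> C) (a b : C), U f -> U g -> Cmod a + Cmod b <= 1 ->
    U (fun p => (a * f p + b * g p)%C).

(** The locally convex inductive limit topology on [EM m] has as a base of
    neighbourhoods of the origin the absolutely convex sets whose trace on every
    step [EMh m (h n)] is a neighbourhood of the origin of that normed space. *)
Definition ind_base0 (m : nat -> R) (h : nat -> R) (U : (R * R -> C) -> Prop) : Prop :=
  (forall f, U f -> EM m f) /\
  absolutely_convex U /\
  forall n : nat, exists eps : R, 0 < eps /\
    forall f, EMh m (h n) f -> Rbar_lt (EMh_norm m (h n) f) eps -> U f.

Definition ind_open (m : nat -> R) (h : nat -> R) (W : (R * R -> C) -> Prop) : Prop :=
  (forall f, W f -> EM m f) /\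
  forall f, W f -> exists U, ind_base0 m h U /\
    forall g, EM m g -> U (fun p => (g p - f p)%C) -> W g.

Lemma EMh_norm_mono (m : nat -> R) (h h' : R) (f : R * R -> C) :
  (forall n, 0 < m n) -> 0 < h -> h <= h' ->
  Rbar_le (EMh_norm m h' f) (EMh_norm m h f).
Proof.
intros Hm Hh Hhh.
unfold EMh_norm.
set (E' := fun r : R => _).
destruct (Lub_Rbar_correct E') as [_ Hlub].
apply Hlub; clear Hlub.
intros r [x [g ->]].
set (E := fun r : R => _).
destruct (Lub_Rbar_correct E) as [Hub _].
eapply Rbar_le_trans; [ | apply Hub; exists x, g; reflexivity ].
simpl. unfold Rdiv. apply Rmult_le_compat_l; [apply Cmod_ge_0|].
assert (0 < INR (fact (order g))) by apply INR_fact_lt_0.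
assert (0 < h ^ order g) by now apply pow_lt.
assert (h ^ order g <= h' ^ order g) by (apply pow_incr; lra).
specialize (Hm (order g)).
apply Rinv_le_contravar.
- repeat apply Rmult_lt_0_compat; assumption.
- repeat apply Rmult_le_compat_r; lra.
Qed.

Lemma ind_base0_sub (m h h' : nat -> R) (U : (R * R -> C) -> Prop) :
  (forall n, 0 < m n) -> admissible_steps h -> admissible_steps h' ->
  ind_base0 m h U -> ind_base0 m h' U.
Proof.
intros Hm [Hh [_ Hlim]] [Hh' _] [H1 [H2 H3]].
split; [exact H1 | split; [exact H2 | ]].
intros n.
apply is_lim_seq_spec in Hlim.
destruct (Hlim (h' n)) as [N HN].
specialize (HN N (le_n N)).
destruct (H3 N) as [eps [He HU]].
exists eps; split; [exact He|].
intros f [Hs Hf] Hn.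
assert (Hle : Rbar_le (EMh_norm m (h N) f) (EMh_norm m (h' n) f))
  by (apply EMh_norm_mono; auto; lra).
apply HU; [split; [exact Hs|]|]; eapply Rbar_le_lt_trans; eauto.
Qed.

Lemma ind_open_indep (m h h' : nat -> R) (W : (R * R -> C) -> Prop) :
  (forall n, 0 < m n) -> admissible_steps h -> admissible_steps h' ->
  ind_open m h W <-> ind_open m h' W.
Proof.
assert (aux : forall k k' : nat -> R, (forall n, 0 < m n) ->
  admissible_steps k -> admissible_steps k' -> ind_open m k W -> ind_open m k' W).
{ intros k k' Hm Hk Hk' [H1 H2]; split; [exact H1|].
  intros f Wf; destruct (H2 f Wf) as [U [HU HW]].
  exists U; split; [now apply (ind_base0_sub m k k')|exact HW]. }
intros; split; now apply aux.
Qed.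

Definition steps (n : nat) : R := INR (S n).

Lemma steps_admissible : admissible_steps steps.
Proof.
split; [|split].
- intros n; apply lt_0_INR; lia.
- intros n; apply lt_INR; lia.
- apply (is_lim_seq_incr_1 INR); apply is_lim_seq_INR.
Qed.

(** By [ind_open_indep], [steps] may be replaced by any admissible sequence. *)
Definition EM_open (m : nat -> R) : ((R * R -> C) -> Prop) -> Prop :=
  ind_open m steps.

(** Ultradistributions are total maps of which only the values on [EM m]
    are meaningful. *)
Definition functional : Type := (R * R -> C) -> C.

Definition dual_EM (m : nat -> R) (u : functional) : Prop :=
  (forall (f g : R * R -> C) (a b : C), EM m f -> EM m g ->
     u (fun p => (a * f p + b * g p)%C) = (a * u f + b * u g)%C) /\
  (forall O : C -> Prop, open O -> EM_open m (fun f => EM m f /\ O (u f))).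

Definition torus_int (f : R * R -> C) : C :=
  RInt (V := C_R_CompleteNormedModule)
    (fun x => RInt (V := C_R_CompleteNormedModule)
                (fun y => f (x, y)) 0 (2 * PI)) 0 (2 * PI).

Definition functional_in_EM (m : nat -> R) (u : functional) : Prop :=
  exists f, EM m f /\
    forall phi, EM m phi -> u phi = torus_int (fun p => (f p * phi p)%C).

(** * Differential operators on ultradistributions *)

Definition dual_D1 (u : functional) : functional := fun phi => (- u (D1 phi))%C.
Definition dual_D2 (u : functional) : functional := fun phi => (- u (D2 phi))%C.

Definition P_op (alpha : C) (u : functional) : functional :=
  fun phi => (dual_D1 u phi - alpha * dual_D2 u phi)%C.

Definition globally_hypoelliptic (m : nat -> R) (P : functional -> functional) : Prop :=
  forall u, dual_EM m u -> functional_in_EM m (P u) -> functional_in_EM m u.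

Definition irrational (x : R) : Prop := ~ exists q : Q, x = Q2R q.

(* Main.v *)
From Stdlib Require Import Reals Lra Lia FunctionalExtensionality ZArith Znumtheory Zpow_facts.
From Stdlib Require Import Cantor QArith Qreals Classical ClassicalEpsilon.
From Coquelicot Require Import Coquelicot.
Require Import Defs.
Open Scope R_scope.

(** Everything is read off Fourier coefficients. Write [e_k] for the character of
    frequency [k] in [Z * Z], [|k|] for the maximum norm of [k], and
    [p k = k_1 - alpha * k_2] for the symbol of the operator. Since
    [P_op alpha] multiplies the coefficient of frequency [k] by [p k], the theorem
    becomes a statement about the size of [p k].

    A function belongs to [EM m] if and only if, for some [A] and [h], its
    coefficients satisfy [|a_k| * |k| ^ j <= A * h ^ j * m j * j!] for all [k] and [j]
    ([EM_fourier], [decay_coefficient], [EM_fourier_inversion]). One direction is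
    termwise differentiation, where moderate growth of [m] pays for the summation over
    [k]; the other one is integration by parts. That a function is the sum of its
    Fourier series follows from the uniqueness of Fourier coefficients
    ([coefficients_zero_eq_zero]): a continuous periodic function orthogonal to
    all characters is orthogonal to all powers of a trigonometric polynomial that peaks
    at a given point, hence vanishes there. The series moreover converges in one
    of the Banach steps, so that a continuous functional may be applied
    termwise ([dual_fourier]).

    The operator is globally hypoelliptic for [m] if and only if, for every [h], only
    finitely many [k] satisfy [|p k| * |k| ^ j <= h ^ j * m j * j!] for all [j]
    ([hypoelliptic_iff_frequency_condition]). If the condition holds, the coefficients
    of a solution are those of the right-hand side divided by [p k], and moderate growth
    shows that the quotient still decays as required. If it fails for some [h], the
    distribution whose coefficients are 1 at the exceptional frequencies and 0 elsewhere
    is not in the class, while its image is.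

    The first claim follows since [seq_prec M L] gives [M k <= B ^ k * L k] for all
    [k]: a symbol that is small for [M] and [h] is small for [L] and [B * h].

    For the second claim, [beta] is a sum of reciprocals of powers of 2 whose partial sums
    [P n / Q n] satisfy [|Q n * beta - P n| ~ inf_j L j * j! / (Q n) ^ j]. The
    frequencies [(P n, Q n)] violate the condition for [L]. As in the theory of
    continued fractions, no frequency [k] does much worse: some [j] satisfies
    [|p k| * |k| ^ j >= c * L j * j!] unless [k = (0, 0)] ([approximation_symbol_lower_bound]). This makes
    [beta] irrational, and it gives the condition for [M], because [M j] is
    eventually smaller than [d ^ j * L j] for every positive [d]. *)

(** * Double integrals of continuous functions *)

Definition continuous_plane (g : R * R -> R) : Prop := forall p, continuous g p.

Lemma continuous_plane_2d (g : R * R -> R) (x y : R) :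
  continuous_plane g -> continuity_2d_pt (fun u v => g (u, v)) x y.
Proof.
intros Hg. apply continuity_2d_pt_filterlim.
apply filterlim_ext with g; [intros [u v]; reflexivity | apply Hg].
Qed.

Lemma continuous_section1 (g : R * R -> R) (y x : R) :
  continuous_plane g -> continuous (fun t => g (t, y)) x.
Proof.
intros Hg.
apply (continuous_comp_2 (fun t => t) (fun _ => y) (fun u v => g (u, v)) x).
- apply continuous_id.
- apply continuous_const.
- exact (proj1 (continuity_2d_pt_filterlim _ _ _) (continuous_plane_2d g _ _ Hg)).
Qed.

Lemma continuous_section2 (g : R * R -> R) (x y : R) :
  continuous_plane g -> continuous (fun t => g (x, t)) y.
Proof.
intros Hg.
apply (continuous_comp_2 (fun _ => x) (fun t => t) (fun u v => g (u, v)) y).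
- apply continuous_const.
- apply continuous_id.
- exact (proj1 (continuity_2d_pt_filterlim _ _ _) (continuous_plane_2d g _ _ Hg)).
Qed.

Lemma ex_RInt_section2 (g : R * R -> R) (x a b : R) :
  continuous_plane g -> ex_RInt (fun y => g (x, y)) a b.
Proof.
intros Hg; apply (ex_RInt_continuous (V := R_CompleteNormedModule)).
intros; now apply continuous_section2.
Qed.

(** Uniform continuity of the integrand on a compact rectangle makes the inner
    integral depend continuously on the outer variable. *)
Lemma continuous_RInt_section (g : R * R -> R) (a b x : R) :
  a < b -> continuous_plane g ->
  continuous (fun t => RInt (fun y => g (t, y)) a b) x.
Proof.
intros Hab Hg.
apply filterlim_locally; intros eps.
assert (He : 0 < eps / (2 * (b - a))).
{ apply Rdiv_lt_0_compat; [apply cond_pos | lra]. }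
destruct (uniform_continuity_2d (fun u v => g (u, v)) (x - 1) (x + 1) a b
  (fun u v _ _ => continuous_plane_2d g u v Hg) (mkposreal _ He)) as [d Hd].
assert (Hd1 : 0 < Rmin d 1) by (apply Rmin_pos; [apply cond_pos | lra]).
exists (mkposreal _ Hd1). intros t Ht.
change (Rabs (t - x) < Rmin d 1) in Ht.
assert (Ht1 := Rlt_le_trans _ _ _ Ht (Rmin_l _ _)).
assert (Ht2 := Rlt_le_trans _ _ _ Ht (Rmin_r _ _)).
apply Rabs_def2 in Ht2.
change (Rabs (RInt (fun y => g (t, y)) a b - RInt (fun y => g (x, y)) a b) < eps).
assert (E : RInt (fun y => g (t, y)) a b - RInt (fun y => g (x, y)) a b =
  RInt (fun y => g (t, y) - g (x, y)) a b).
{ symmetry; apply (RInt_minus (V := R_CompleteNormedModule)); now apply ex_RInt_section2. }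
rewrite E.
apply Rle_lt_trans with ((b - a) * (eps / (2 * (b - a)))).
- apply abs_RInt_le_const; [lra | |].
  + apply (ex_RInt_minus (V := R_NormedModule)); now apply ex_RInt_section2.
  + intros y Hy. left. apply Hd; try lra.
    rewrite Rminus_diag, Rabs_R0. apply cond_pos.
- assert (0 < eps) by apply cond_pos. field_simplify; lra.
Qed.

Definition int2 (g : R * R -> R) : R :=
  RInt (fun x => RInt (fun y => g (x, y)) 0 (2 * PI)) 0 (2 * PI).

Lemma two_PI_pos : 0 < 2 * PI.
Proof. generalize PI_RGT_0; lra. Qed.

Lemma ex_RInt_outer (g : R * R -> R) (c d : R) :
  continuous_plane g ->
  ex_RInt (fun x => RInt (fun y => g (x, y)) 0 (2 * PI)) c d.
Proof.
intros Hg; apply (ex_RInt_continuous (V := R_CompleteNormedModule)).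
intros; apply continuous_RInt_section; [apply two_PI_pos | exact Hg].
Qed.

Lemma int2_ext (f g : R * R -> R) : (forall p, f p = g p) -> int2 f = int2 g.
Proof. intros E; apply RInt_ext; intros; apply RInt_ext; intros; apply E. Qed.

Lemma continuous_plane_plus (f g : R * R -> R) :
  continuous_plane f -> continuous_plane g -> continuous_plane (fun p => f p + g p).
Proof.
intros Hf Hg p. apply (continuous_plus (V := R_NormedModule)); auto.
Qed.

Lemma continuous_plane_scal (c : R) (f : R * R -> R) :
  continuous_plane f -> continuous_plane (fun p => c * f p).
Proof.
intros Hf p. apply (continuous_scal_r (V := R_NormedModule)); auto.
Qed.

Lemma continuous_plane_mult (f g : R * R -> R) :
  continuous_plane f -> continuous_plane g -> continuous_plane (fun p => f p * g p).
Proof.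
intros Hf Hg p. apply (continuous_mult (K := R_AbsRing)); auto.
Qed.

Lemma int2_plus (f g : R * R -> R) :
  continuous_plane f -> continuous_plane g ->
  int2 (fun p => f p + g p) = int2 f + int2 g.
Proof.
intros Hf Hg. unfold int2.
rewrite <- (RInt_plus (V := R_CompleteNormedModule)); try now apply ex_RInt_outer.
apply RInt_ext; intros x _.
apply (RInt_plus (V := R_CompleteNormedModule)); now apply ex_RInt_section2.
Qed.

Lemma int2_scal (c : R) (f : R * R -> R) :
  continuous_plane f -> int2 (fun p => c * f p) = c * int2 f.
Proof.
intros Hf. unfold int2.
transitivity (RInt (fun x => c * RInt (fun y => f (x, y)) 0 (2 * PI)) 0 (2 * PI)).
- apply RInt_ext; intros x _.
  apply (RInt_scal (V := R_CompleteNormedModule)); now apply ex_RInt_section2.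
- apply (RInt_scal (V := R_CompleteNormedModule)); now apply ex_RInt_outer.
Qed.

Lemma int2_const (c : R) : int2 (fun _ => c) = 4 * PI ^ 2 * c.
Proof.
unfold int2. rewrite (RInt_ext _ (fun _ => 2 * PI * c)).
- rewrite RInt_const. unfold scal; simpl; unfold mult; simpl. ring.
- intros x _. rewrite RInt_const. unfold scal; simpl; unfold mult; simpl. ring.
Qed.

Lemma int2_le (f g : R * R -> R) :
  continuous_plane f -> continuous_plane g ->
  (forall x y, 0 < x < 2 * PI -> 0 < y < 2 * PI -> f (x, y) <= g (x, y)) ->
  int2 f <= int2 g.
Proof.
intros Hf Hg Hle. assert (H2 := two_PI_pos).
apply RInt_le; [lra | now apply ex_RInt_outer .. |]; intros x Hx.
apply RInt_le; [lra | now apply ex_RInt_section2 .. |]; intros y Hy.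
now apply Hle.
Qed.

Lemma int2_abs_le (f : R * R -> R) (B : R) :
  continuous_plane f -> (forall p, Rabs (f p) <= B) -> Rabs (int2 f) <= 4 * PI ^ 2 * B.
Proof.
intros Hf HB.
assert (Hc : forall c, continuous_plane (fun _ => c)) by (intros c p; apply continuous_const).
apply Rabs_le; split.
- replace (- (4 * PI ^ 2 * B)) with (4 * PI ^ 2 * - B) by ring.
  rewrite <- int2_const; apply int2_le; auto.
  intros x y _ _. specialize (HB (x, y)). apply Rabs_le_between in HB; lra.
- rewrite <- int2_const; apply int2_le; auto.
  intros x y _ _. specialize (HB (x, y)). apply Rabs_le_between in HB; lra.
Qed.

Lemma RInt_ge_subinterval (f : R -> R) (a b u v c : R) :
  a <= u -> u <= v -> v <= b -> (forall s t, ex_RInt f s t) ->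
  (forall x, a < x < b -> 0 <= f x) -> (forall x, u < x < v -> c <= f x) ->
  c * (v - u) <= RInt f a b.
Proof.
intros H1 H2 H3 Hf H0 Hc.
rewrite <- (RInt_Chasles f a u b) by auto.
rewrite <- (RInt_Chasles f u v b) by auto.
assert (0 <= RInt f a u) by (apply RInt_ge_0; auto; intros; apply H0; lra).
assert (0 <= RInt f v b) by (apply RInt_ge_0; auto; intros; apply H0; lra).
assert (c * (v - u) <= RInt f u v).
{ replace (c * (v - u)) with (RInt (fun _ => c) u v).
  - apply RInt_le; auto. apply ex_RInt_const.
  - rewrite RInt_const; unfold scal; simpl; unfold mult; simpl; ring. }
unfold plus; simpl; lra.
Qed.

(** Gives the growth of the integrals of powers of a kernel from its size near a
    single point. *)
Lemma int2_ge_box (g : R * R -> R) (a b r c : R) :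
  continuous_plane g -> 0 <= c ->
  0 <= r -> r <= a -> a + r <= 2 * PI -> r <= b -> b + r <= 2 * PI ->
  (forall p, 0 <= g p) ->
  (forall x y, Rabs (x - a) < r -> Rabs (y - b) < r -> c <= g (x, y)) ->
  c * (2 * r) * (2 * r) <= int2 g.
Proof.
intros Hg Hc Hr Ha Ha' Hb Hb' H0 Hbox.
replace (c * (2 * r) * (2 * r)) with (c * (2 * r) * ((a + r) - (a - r))) by ring.
apply RInt_ge_subinterval; try lra.
- intros; now apply ex_RInt_outer.
- intros x _. apply RInt_ge_0; [generalize two_PI_pos; lra | now apply ex_RInt_section2 | auto].
- intros x Hx.
  replace (c * (2 * r)) with (c * ((b + r) - (b - r))) by ring.
  apply RInt_ge_subinterval; try lra.
  + intros; now apply ex_RInt_section2.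
  + intros; apply H0.
  + intros y Hy. apply Hbox; apply Rabs_def1; lra.
Qed.

Lemma int2_derive2 (g dg : R * R -> R) :
  (forall x y, is_derive (fun t => g (x, t)) y (dg (x, y))) ->
  continuous_plane dg -> (forall x, g (x, 2 * PI) = g (x, 0)) -> int2 dg = 0.
Proof.
intros Hd Hc Hp. unfold int2.
rewrite (RInt_ext _ (fun _ => 0)).
- rewrite RInt_const. unfold scal; simpl; unfold mult; simpl; ring.
- intros x _. transitivity (g (x, 2 * PI) - g (x, 0)); [| rewrite Hp; apply Rminus_diag].
  apply is_RInt_unique.
  apply (is_RInt_derive (fun t => g (x, t)) (fun y => dg (x, y))).
  + intros; apply Hd.
  + intros; now apply continuous_section2.
Qed.

(** Differentiation under the integral sign reduces the outer variable to the
    fundamental theorem of calculus for the inner integral, so that the order of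
    integration never has to be exchanged. *)
Lemma int2_derive1 (g dg : R * R -> R) :
  continuous_plane g ->
  (forall x y, is_derive (fun t => g (t, y)) x (dg (x, y))) ->
  continuous_plane dg -> (forall y, g (2 * PI, y) = g (0, y)) -> int2 dg = 0.
Proof.
intros Hg Hd Hc Hp. unfold int2.
transitivity (RInt (fun y => g (2 * PI, y)) 0 (2 * PI) -
              RInt (fun y => g (0, y)) 0 (2 * PI)).
- apply is_RInt_unique.
  apply (is_RInt_derive (fun x => RInt (fun y => g (x, y)) 0 (2 * PI))
           (fun x => RInt (fun y => dg (x, y)) 0 (2 * PI))).
  + intros x _.
    replace (RInt (fun y => dg (x, y)) 0 (2 * PI))
      with (RInt (fun y => Derive (fun u => g (u, y)) x) 0 (2 * PI)).
    * apply (is_derive_RInt_param (fun x y => g (x, y)) 0 (2 * PI) x).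
      -- apply filter_forall; intros u t _. exists (dg (u, t)). apply Hd.
      -- intros t _. apply continuity_2d_pt_ext with (fun u v => dg (u, v)).
         ++ intros u v; symmetry; apply is_derive_unique, Hd.
         ++ now apply continuous_plane_2d.
      -- apply filter_forall; intros u. now apply ex_RInt_section2.
    * apply RInt_ext; intros y _. apply is_derive_unique, Hd.
  + intros x _. apply continuous_RInt_section; [apply two_PI_pos | exact Hc].
- rewrite (RInt_ext _ (fun y => g (0, y))); [ring | intros; apply Hp].
Qed.

(** * Complex-valued integrals over the torus *)

Definition continuousC (f : R * R -> C) : Prop := forall p, continuous f p.

Lemma C_eq (z w : C) : Re z = Re w -> Im z = Im w -> z = w.
Proof. destruct z, w; simpl; congruence. Qed.

Lemma continuousC_iff (f : R * R -> C) :
  continuousC f <->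
  continuous_plane (fun p => Re (f p)) /\ continuous_plane (fun p => Im (f p)).
Proof.
split.
- intros Hf; split; intros p.
  + apply (continuous_comp f (@fst R R)); [apply Hf |].
    destruct (f p) as [u v]; apply (continuous_fst u v).
  + apply (continuous_comp f (@snd R R)); [apply Hf |].
    destruct (f p) as [u v]; apply (continuous_snd u v).
- intros [H1 H2] p.
  apply filterlim_locally; intros eps.
  generalize (proj1 (filterlim_locally _ _) (H1 p) eps); intros L1.
  generalize (proj1 (filterlim_locally _ _) (H2 p) eps); intros L2.
  generalize (filter_and _ _ L1 L2). apply filter_imp. intros q [B1 B2]; now split.
Qed.

Lemma continuousC_const (c : C) : continuousC (fun _ => c).
Proof. intros p; apply continuous_const. Qed.

Lemma continuousC_plus (f g : R * R -> C) :
  continuousC f -> continuousC g -> continuousC (fun p => f p + g p)%C.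
Proof.
rewrite !continuousC_iff; intros [F1 F2] [G1 G2]; split; simpl.
- now apply continuous_plane_plus.
- now apply continuous_plane_plus.
Qed.

Lemma continuousC_mult (f g : R * R -> C) :
  continuousC f -> continuousC g -> continuousC (fun p => f p * g p)%C.
Proof.
rewrite !continuousC_iff; intros [F1 F2] [G1 G2]; split; simpl.
- intros p. apply (continuous_minus (V := R_NormedModule) (fun p => Re (f p) * Re (g p))
    (fun p => Im (f p) * Im (g p))); now apply continuous_plane_mult.
- apply (continuous_plane_plus (fun p => Re (f p) * Im (g p)) (fun p => Im (f p) * Re (g p)));
    now apply continuous_plane_mult.
Qed.

Lemma continuousC_scal (c : C) (f : R * R -> C) :
  continuousC f -> continuousC (fun p => c * f p)%C.
Proof. apply (continuousC_mult (fun _ => c) f), continuousC_const. Qed.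

Lemma torus_int_eq (f : R * R -> C) :
  continuousC f ->
  torus_int f = (int2 (fun p => Re (f p)), int2 (fun p => Im (f p))).
Proof.
rewrite continuousC_iff; intros [H1 H2].
unfold torus_int.
assert (E : forall x, RInt (V := C_R_CompleteNormedModule) (fun y => f (x, y)) 0 (2 * PI) =
  (RInt (fun y => Re (f (x, y))) 0 (2 * PI), RInt (fun y => Im (f (x, y))) 0 (2 * PI))).
{ intros x. apply (is_RInt_unique (V := C_R_CompleteNormedModule)).
  apply (is_RInt_fct_extend_pair (U := R_NormedModule) (V := R_NormedModule)).
  - apply (RInt_correct (V := R_CompleteNormedModule)).
    exact (ex_RInt_section2 (fun p => Re (f p)) x 0 (2 * PI) H1).
  - apply (RInt_correct (V := R_CompleteNormedModule)).
    exact (ex_RInt_section2 (fun p => Im (f p)) x 0 (2 * PI) H2). }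
apply (is_RInt_unique (V := C_R_CompleteNormedModule)).
apply (is_RInt_fct_extend_pair (U := R_NormedModule) (V := R_NormedModule)).
- apply is_RInt_ext with (fun x => RInt (fun y => Re (f (x, y))) 0 (2 * PI)).
  + intros x _. now rewrite E.
  + apply (RInt_correct (V := R_CompleteNormedModule)).
    exact (ex_RInt_outer (fun p => Re (f p)) 0 (2 * PI) H1).
- apply is_RInt_ext with (fun x => RInt (fun y => Im (f (x, y))) 0 (2 * PI)).
  + intros x _. now rewrite E.
  + apply (RInt_correct (V := R_CompleteNormedModule)).
    exact (ex_RInt_outer (fun p => Im (f p)) 0 (2 * PI) H2).
Qed.

Lemma torus_int_plus (f g : R * R -> C) :
  continuousC f -> continuousC g ->
  torus_int (fun p => f p + g p)%C = (torus_int f + torus_int g)%C.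
Proof.
intros Hf Hg. rewrite !torus_int_eq; auto using continuousC_plus.
apply continuousC_iff in Hf; apply continuousC_iff in Hg.
destruct Hf as [F1 F2], Hg as [G1 G2].
apply C_eq; simpl; now rewrite <- int2_plus.
Qed.

Lemma torus_int_scal (c : C) (f : R * R -> C) :
  continuousC f -> torus_int (fun p => c * f p)%C = (c * torus_int f)%C.
Proof.
intros Hf. rewrite !torus_int_eq; auto using continuousC_scal.
apply continuousC_iff in Hf. destruct Hf as [F1 F2].
apply C_eq; simpl.
- rewrite (int2_ext _ (fun p => Re c * Re (f p) + - Im c * Im (f p)))
    by (intros p; destruct c, (f p); simpl; ring).
  rewrite int2_plus, !int2_scal; auto using continuous_plane_scal.
  destruct c; simpl; ring.
- rewrite (int2_ext _ (fun p => Re c * Im (f p) + Im c * Re (f p)))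
    by (intros p; destruct c, (f p); simpl; ring).
  rewrite int2_plus, !int2_scal; auto using continuous_plane_scal.
Qed.

Lemma torus_int_const (c : C) : torus_int (fun _ => c) = (RtoC (4 * PI ^ 2) * c)%C.
Proof.
rewrite torus_int_eq by apply continuousC_const.
rewrite !int2_const. apply C_eq; unfold Re, Im; simpl; ring.
Qed.

Lemma torus_int_ext (f g : R * R -> C) :
  (forall p, f p = g p) -> torus_int f = torus_int g.
Proof. intros E; f_equal; now apply functional_extensionality. Qed.

Lemma im_le_Cmod (c : C) : Rabs (Im c) <= Cmod c.
Proof. eapply Rle_trans; [apply Rmax_r | apply (Rmax_Cmod c)]. Qed.

Lemma Cmod_le_Re_Im (c : C) : Cmod c <= Rabs (Re c) + Rabs (Im c).
Proof.
replace c with (RtoC (Re c) + Ci * RtoC (Im c))%C at 1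
  by (apply C_eq; simpl; ring).
eapply Rle_trans; [apply Cmod_triangle |].
rewrite Cmod_mult, Cmod_Ci, !Cmod_R; lra.
Qed.

Lemma ball_of_Cmod_lt (z w : C) (eps : R) : Cmod (w - z)%C < eps -> ball z eps w.
Proof.
intros H. split.
- change (Rabs (Re w - Re z) < eps). eapply Rle_lt_trans; [| exact H].
  eapply Rle_trans; [| apply re_le_Cmod]. right; reflexivity.
- change (Rabs (Im w - Im z) < eps). eapply Rle_lt_trans; [| exact H].
  eapply Rle_trans; [| apply im_le_Cmod]. right; reflexivity.
Qed.

(** The constant is twice the area of the torus because real and imaginary parts
    are bounded separately. *)
Lemma torus_int_bound (f : R * R -> C) (B : R) :
  continuousC f -> (forall p, Cmod (f p) <= B) ->
  Cmod (torus_int f) <= 8 * PI ^ 2 * B.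
Proof.
intros Hf HB. rewrite torus_int_eq by exact Hf.
apply continuousC_iff in Hf. destruct Hf as [F1 F2].
eapply Rle_trans; [apply Cmod_le_Re_Im |]; simpl.
assert (A1 := int2_abs_le _ B F1 (fun p => Rle_trans _ _ _ (re_le_Cmod _) (HB p))).
assert (A2 := int2_abs_le _ B F2 (fun p => Rle_trans _ _ _ (im_le_Cmod _) (HB p))).
simpl in *; lra.
Qed.

(** * Derivatives of complex-valued curves *)

Definition is_deriveC (g : R -> C) (t : R) (l : C) : Prop :=
  is_derive (fun s => Re (g s)) t (Re l) /\ is_derive (fun s => Im (g s)) t (Im l).

Lemma is_deriveC_ex (g : R -> C) (t : R) (l : C) : is_deriveC g t l -> ex_deriveC g t.
Proof. intros [H1 H2]; split; eexists; eassumption. Qed.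

Lemma is_deriveC_unique (g : R -> C) (t : R) (l : C) : is_deriveC g t l -> DeriveC g t = l.
Proof.
intros [H1 H2]; apply C_eq; simpl; now apply is_derive_unique.
Qed.

Lemma DeriveC_correct (g : R -> C) (t : R) : ex_deriveC g t -> is_deriveC g t (DeriveC g t).
Proof. intros [H1 H2]; split; now apply Derive_correct. Qed.

Lemma is_deriveC_const (c : C) (t : R) : is_deriveC (fun _ => c) t 0%C.
Proof. split; apply (is_derive_const (V := R_NormedModule)). Qed.

Lemma is_deriveC_mult (f g : R -> C) (t : R) (df dg : C) :
  is_deriveC f t df -> is_deriveC g t dg ->
  is_deriveC (fun s => f s * g s)%C t (df * g t + f t * dg)%C.
Proof.
intros [F1 F2] [G1 G2]; split; simpl.
- replace (_ - _ + _) with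
    ((Re df * Re (g t) + Re (f t) * Re dg) - (Im df * Im (g t) + Im (f t) * Im dg))
    by (simpl; unfold Re, Im; ring).
  apply (is_derive_minus (V := R_NormedModule) (fun s => Re (f s) * Re (g s))
    (fun s => Im (f s) * Im (g s))).
  + apply (is_derive_mult (fun s => Re (f s)) (fun s => Re (g s))); auto; intros; apply Rmult_comm.
  + apply (is_derive_mult (fun s => Im (f s)) (fun s => Im (g s))); auto; intros; apply Rmult_comm.
- replace (_ + _ + _) with
    ((Re df * Im (g t) + Re (f t) * Im dg) + (Im df * Re (g t) + Im (f t) * Re dg))
    by (simpl; unfold Re, Im; ring).
  apply (is_derive_plus (V := R_NormedModule) (fun s => Re (f s) * Im (g s))
    (fun s => Im (f s) * Re (g s))).
  + apply (is_derive_mult (fun s => Re (f s)) (fun s => Im (g s))); auto; intros; apply Rmult_comm.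
  + apply (is_derive_mult (fun s => Im (f s)) (fun s => Re (g s))); auto; intros; apply Rmult_comm.
Qed.

Lemma is_deriveC_scal (c : C) (g : R -> C) (t : R) (l : C) :
  is_deriveC g t l -> is_deriveC (fun s => c * g s)%C t (c * l)%C.
Proof.
intros Hg. generalize (is_deriveC_mult _ _ _ _ _ (is_deriveC_const c t) Hg).
now rewrite Cmult_0_l, Cplus_0_l.
Qed.

Lemma torus_int_derive1 (f df : R * R -> C) :
  continuousC f -> continuousC df -> periodic f ->
  (forall x y, is_deriveC (fun t => f (t, y)) x (df (x, y))) -> torus_int df = 0%C.
Proof.
intros Hf Hdf Hp Hd. rewrite torus_int_eq by exact Hdf.
apply continuousC_iff in Hf; apply continuousC_iff in Hdf.
assert (Hp' : forall y, f (2 * PI, y) = f (0, y)).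
{ intros y. rewrite <- (proj1 (Hp 0 y)). do 2 f_equal; ring. }
apply C_eq; simpl.
- apply (int2_derive1 (fun p => Re (f p))); [apply Hf | | apply Hdf |].
  + intros; apply (Hd x y).
  + intros y; now rewrite Hp'.
- apply (int2_derive1 (fun p => Im (f p))); [apply Hf | | apply Hdf |].
  + intros; apply (Hd x y).
  + intros y; now rewrite Hp'.
Qed.

Lemma torus_int_derive2 (f df : R * R -> C) :
  continuousC df -> periodic f ->
  (forall x y, is_deriveC (fun t => f (x, t)) y (df (x, y))) -> torus_int df = 0%C.
Proof.
intros Hdf Hp Hd. rewrite torus_int_eq by exact Hdf.
apply continuousC_iff in Hdf.
assert (Hp' : forall x, f (x, 2 * PI) = f (x, 0)).
{ intros x. rewrite <- (proj2 (Hp x 0)). do 2 f_equal; ring. }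
apply C_eq; simpl.
- apply (int2_derive2 (fun p => Re (f p))); [| apply Hdf |].
  + intros; apply (Hd x y).
  + intros x; now rewrite Hp'.
- apply (int2_derive2 (fun p => Im (f p))); [| apply Hdf |].
  + intros; apply (Hd x y).
  + intros x; now rewrite Hp'.
Qed.

(** * Smooth functions on the torus *)

Lemma class_Ck_continuous (k : nat) (f : R * R -> C) : class_Ck k f -> continuousC f.
Proof. destruct k; intros H; exact (proj1 H). Qed.

Lemma class_C1_partial1 (f : R * R -> C) (x y : R) :
  class_Ck 1 f -> is_deriveC (fun t => f (t, y)) x (partial1 f (x, y)).
Proof. intros [_ [H _]]. apply DeriveC_correct, (proj1 (H (x, y))). Qed.

Lemma class_C1_partial2 (f : R * R -> C) (x y : R) :
  class_Ck 1 f -> is_deriveC (fun t => f (x, t)) y (partial2 f (x, y)).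
Proof. intros [_ [H _]]. apply DeriveC_correct, (proj2 (H (x, y))). Qed.

Lemma partial1_scal (c : C) (f : R * R -> C) :
  class_Ck 1 f -> partial1 (fun p => c * f p)%C = (fun p => c * partial1 f p)%C.
Proof.
intros Hf. apply functional_extensionality; intros [x y].
now apply is_deriveC_unique, is_deriveC_scal, (class_C1_partial1 f).
Qed.

Lemma partial2_scal (c : C) (f : R * R -> C) :
  class_Ck 1 f -> partial2 (fun p => c * f p)%C = (fun p => c * partial2 f p)%C.
Proof.
intros Hf. apply functional_extensionality; intros [x y].
now apply is_deriveC_unique, is_deriveC_scal, (class_C1_partial2 f).
Qed.

Lemma class_Ck_S_C1 (k : nat) (f : R * R -> C) : class_Ck (S k) f -> class_Ck 1 f.
Proof.
intros [H0 [H1 [H2 H3]]]. repeat split; auto; try apply H1.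
- apply (class_Ck_continuous k _ H2).
- apply (class_Ck_continuous k _ H3).
Qed.

Lemma class_Ck_scal (c : C) (k : nat) : forall f : R * R -> C,
  class_Ck k f -> class_Ck k (fun p => c * f p)%C.
Proof.
induction k as [|k IH]; intros f Hf.
- split; [| trivial]. apply continuousC_scal, (class_Ck_continuous 0 _ Hf).
- assert (H1 := class_Ck_S_C1 k f Hf).
  split; [| split; [| split]].
  + apply continuousC_scal, (class_Ck_continuous _ _ Hf).
  + intros [x y]; split; simpl; eapply is_deriveC_ex, is_deriveC_scal.
    * apply (class_C1_partial1 f x y H1).
    * apply (class_C1_partial2 f x y H1).
  + rewrite partial1_scal by exact H1. apply IH, Hf.
  + rewrite partial2_scal by exact H1. apply IH, Hf.
Qed.

Lemma Derive_shift (g : R -> R) (c x : R) : Derive g (x + c) = Derive (fun t => g (t + c)) x.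
Proof.
unfold Derive. f_equal. apply Lim_ext. intros h. do 3 f_equal; ring.
Qed.

Lemma DeriveC_periodic (g : R -> C) (c x : R) :
  (forall t, g (t + c) = g t) -> DeriveC g (x + c) = DeriveC g x.
Proof.
intros H. unfold DeriveC. rewrite !Derive_shift.
f_equal; apply Derive_ext; intros t; now rewrite H.
Qed.

Lemma partial1_periodic (f : R * R -> C) : periodic f -> periodic (partial1 f).
Proof.
intros Hp x y; split; unfold partial1; simpl.
- apply DeriveC_periodic. intros t; apply Hp.
- f_equal. apply functional_extensionality; intros t; apply Hp.
Qed.

Lemma partial2_periodic (f : R * R -> C) : periodic f -> periodic (partial2 f).
Proof.
intros Hp x y; split; unfold partial2; simpl.
- f_equal. apply functional_extensionality; intros t; apply Hp.
- apply DeriveC_periodic. intros t; apply Hp.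
Qed.

Lemma periodic_scal (c : C) (f : R * R -> C) : periodic f -> periodic (fun p => c * f p)%C.
Proof. intros Hp x y; split; f_equal; apply Hp. Qed.

Lemma periodic_mult (f g : R * R -> C) :
  periodic f -> periodic g -> periodic (fun p => f p * g p)%C.
Proof. intros Hf Hg x y; split; f_equal; (apply Hf || apply Hg). Qed.

Lemma smooth_torus_D1 (f : R * R -> C) : smooth_torus f -> smooth_torus (D1 f).
Proof.
intros [Hp Hs]; split.
- now apply periodic_scal, partial1_periodic.
- intros k. apply class_Ck_scal. apply (Hs (S k)).
Qed.

Lemma smooth_torus_D2 (f : R * R -> C) : smooth_torus f -> smooth_torus (D2 f).
Proof.
intros [Hp Hs]; split.
- now apply periodic_scal, partial2_periodic.
- intros k. apply class_Ck_scal. apply (Hs (S k)).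
Qed.

Lemma smooth_torus_continuous (f : R * R -> C) : smooth_torus f -> continuousC f.
Proof. intros [_ Hs]. apply (class_Ck_continuous 0), Hs. Qed.

(** Integration by parts; the boundary terms cancel by periodicity. *)
Lemma torus_int_D1 (f g : R * R -> C) :
  smooth_torus f -> smooth_torus g ->
  torus_int (fun p => f p * D1 g p)%C = (- torus_int (fun p => D1 f p * g p))%C.
Proof.
intros Hf Hg.
assert (Cf := smooth_torus_continuous f Hf). assert (Cg := smooth_torus_continuous g Hg).
assert (Cdf := smooth_torus_continuous _ (smooth_torus_D1 f Hf)).
assert (Cdg := smooth_torus_continuous _ (smooth_torus_D1 g Hg)).
assert (E : torus_int (fun p => D1 f p * g p + f p * D1 g p)%C = 0%C).
{ apply (torus_int_derive1 (fun p => - Ci * (f p * g p))%C).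
  - now apply continuousC_scal, continuousC_mult.
  - apply continuousC_plus; now apply continuousC_mult.
  - apply periodic_scal, periodic_mult; [apply Hf | apply Hg].
  - intros x y. replace (D1 f (x, y) * g (x, y) + f (x, y) * D1 g (x, y))%C
      with (- Ci * (partial1 f (x, y) * g (x, y) + f (x, y) * partial1 g (x, y)))%C
      by (unfold D1; ring).
    apply is_deriveC_scal.
    apply (is_deriveC_mult (fun t => f (t, y)) (fun t => g (t, y)));
      apply class_C1_partial1; [apply Hf | apply Hg]. }
rewrite torus_int_plus in E by now apply continuousC_mult.
replace (torus_int (fun p => f p * D1 g p)%C) with
  (torus_int (fun p => D1 f p * g p) + torus_int (fun p => f p * D1 g p)
    - torus_int (fun p => D1 f p * g p))%C by ring.
rewrite E; ring.
Qed.

Lemma torus_int_D2 (f g : R * R -> C) :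
  smooth_torus f -> smooth_torus g ->
  torus_int (fun p => f p * D2 g p)%C = (- torus_int (fun p => D2 f p * g p))%C.
Proof.
intros Hf Hg.
assert (Cf := smooth_torus_continuous f Hf). assert (Cg := smooth_torus_continuous g Hg).
assert (Cdf := smooth_torus_continuous _ (smooth_torus_D2 f Hf)).
assert (Cdg := smooth_torus_continuous _ (smooth_torus_D2 g Hg)).
assert (E : torus_int (fun p => D2 f p * g p + f p * D2 g p)%C = 0%C).
{ apply (torus_int_derive2 (fun p => - Ci * (f p * g p))%C).
  - apply continuousC_plus; now apply continuousC_mult.
  - apply periodic_scal, periodic_mult; [apply Hf | apply Hg].
  - intros x y. replace (D2 f (x, y) * g (x, y) + f (x, y) * D2 g (x, y))%C
      with (- Ci * (partial2 f (x, y) * g (x, y) + f (x, y) * partial2 g (x, y)))%C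
      by (unfold D2; ring).
    apply is_deriveC_scal.
    apply (is_deriveC_mult (fun t => f (x, t)) (fun t => g (x, t)));
      apply class_C1_partial2; [apply Hf | apply Hg]. }
rewrite torus_int_plus in E by now apply continuousC_mult.
replace (torus_int (fun p => f p * D2 g p)%C) with
  (torus_int (fun p => D2 f p * g p) + torus_int (fun p => f p * D2 g p)
    - torus_int (fun p => D2 f p * g p))%C by ring.
rewrite E; ring.
Qed.

(** * Absolutely convergent complex series *)

Definition Cseries (z : nat -> C) : C :=
  (Series (fun n => Re (z n)), Series (fun n => Im (z n))).

Definition abs_summable (z : nat -> C) : Prop := ex_series (fun n => Cmod (z n)).

Lemma ex_series_le_R (a b : nat -> R) :
  (forall n, Rabs (a n) <= b n) -> ex_series b -> ex_series a.
Proof. apply (ex_series_le (V := R_CompleteNormedModule)). Qed.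

Lemma ex_series_scal_R (c : R) (a : nat -> R) :
  ex_series a -> ex_series (fun n => c * a n).
Proof. apply (ex_series_scal (V := R_NormedModule)). Qed.

Lemma ex_series_plus_R (a b : nat -> R) :
  ex_series a -> ex_series b -> ex_series (fun n => a n + b n).
Proof. apply (ex_series_plus (V := R_NormedModule)). Qed.

Lemma ex_series_single (a : nat -> R) (N : nat) :
  (forall n, n <> N -> a n = 0) -> ex_series a.
Proof.
intros Ha. apply (ex_series_incr_n (V := R_NormedModule) _ (S N)).
apply ex_series_ext with (fun k => 0 * 0 ^ k).
- intros n. rewrite Ha by lia. simpl; ring.
- apply ex_series_scal_R, ex_series_geom. rewrite Rabs_R0; lra.
Qed.

Lemma abs_summable_le (z : nat -> C) (b : nat -> R) :
  (forall n, Cmod (z n) <= b n) -> ex_series b -> abs_summable z.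
Proof.
intros H; apply ex_series_le_R; intros n.
now rewrite Rabs_pos_eq by apply Cmod_ge_0.
Qed.

Lemma abs_summable_scal (c : C) (z : nat -> C) :
  abs_summable z -> abs_summable (fun n => c * z n)%C.
Proof.
intros Hz; eapply abs_summable_le; [intros n; rewrite Cmod_mult; apply Rle_refl |].
now apply ex_series_scal_R.
Qed.

Lemma abs_summable_Re (z : nat -> C) : abs_summable z -> ex_series (fun n => Re (z n)).
Proof. apply ex_series_le_R; intros n; apply re_le_Cmod. Qed.

Lemma abs_summable_Im (z : nat -> C) : abs_summable z -> ex_series (fun n => Im (z n)).
Proof. apply ex_series_le_R; intros n; apply im_le_Cmod. Qed.

Lemma Cseries_ext (z w : nat -> C) : (forall n, z n = w n) -> Cseries z = Cseries w.
Proof. intros E; unfold Cseries; f_equal; apply Series_ext; intros n; now rewrite E. Qed.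

Lemma Cseries_plus (z w : nat -> C) :
  abs_summable z -> abs_summable w ->
  Cseries (fun n => z n + w n)%C = (Cseries z + Cseries w)%C.
Proof.
intros Hz Hw. apply C_eq; simpl; rewrite <- Series_plus;
  auto using abs_summable_Re, abs_summable_Im.
Qed.

Lemma Cseries_scal (c : C) (z : nat -> C) :
  abs_summable z -> Cseries (fun n => c * z n)%C = (c * Cseries z)%C.
Proof.
intros Hz.
assert (H1 := abs_summable_Re z Hz). assert (H2 := abs_summable_Im z Hz).
apply C_eq; simpl.
- rewrite <- !Series_scal_l. apply Series_minus; now apply ex_series_scal_R.
- rewrite <- !Series_scal_l. apply Series_plus; now apply ex_series_scal_R.
Qed.

Lemma Series_nonneg (b : nat -> R) : (forall n, 0 <= b n) -> ex_series b -> 0 <= Series b.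
Proof.
intros H Hb.
assert (E : Series (fun _ => 0) = 0).
{ rewrite (Series_ext _ (fun _ => 0 * 0)) by (intros; ring). rewrite Series_scal_l; ring. }
rewrite <- E at 1.
apply Series_le; [intros n; split; [lra | apply H] | exact Hb].
Qed.

Lemma Series_abs_le (a b : nat -> R) :
  (forall n, Rabs (a n) <= b n) -> ex_series b -> Rabs (Series a) <= Series b.
Proof.
intros H Hb.
eapply Rle_trans; [apply Series_Rabs | apply Series_le; auto].
- eapply ex_series_le_R; [| exact Hb]. intros n; now rewrite Rabs_Rabsolu.
- intros n; split; [apply Rabs_pos | apply H].
Qed.

Lemma Cseries_le (z : nat -> C) (b : nat -> R) :
  (forall n, Cmod (z n) <= b n) -> ex_series b -> Cmod (Cseries z) <= 2 * Series b.
Proof.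
intros H Hb. eapply Rle_trans; [apply Cmod_le_Re_Im |]; simpl.
assert (Rabs (Series (fun n => Re (z n))) <= Series b).
{ apply Series_abs_le; auto. intros n; eapply Rle_trans; [apply re_le_Cmod | apply H]. }
assert (Rabs (Series (fun n => Im (z n))) <= Series b).
{ apply Series_abs_le; auto. intros n; eapply Rle_trans; [apply im_le_Cmod | apply H]. }
lra.
Qed.

Fixpoint Csum (N : nat) (z : nat -> C) : C :=
  match N with
  | O => 0%C
  | S N' => (Csum N' z + z N')%C
  end.

Definition tail (N : nat) (z : nat -> C) (n : nat) : C :=
  if (n <? N)%nat then 0%C else z n.

Lemma Cmod_tail_le (N : nat) (z : nat -> C) (n : nat) : Cmod (tail N z n) <= Cmod (z n).
Proof.
unfold tail; destruct (n <? N)%nat; [rewrite Cmod_0; apply Cmod_ge_0 | apply Rle_refl].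
Qed.

Lemma abs_summable_tail (N : nat) (z : nat -> C) : abs_summable z -> abs_summable (tail N z).
Proof. apply abs_summable_le; intros n; apply Cmod_tail_le. Qed.

Lemma Cseries_single (z : nat -> C) (N : nat) :
  (forall n, n <> N -> z n = 0%C) -> Cseries z = z N.
Proof.
assert (R1 : forall a : nat -> R, (forall n, n <> N -> a n = 0) -> Series a = a N).
{ intros a Ha. rewrite (Series_incr_n_aux a N) by (intros; apply Ha; lia).
  assert (E : ex_series (fun k => a (N + k)%nat)).
  { apply (ex_series_incr_n (V := R_NormedModule)). now apply ex_series_single with N. }
  rewrite Series_incr_1 by exact E.
  rewrite (Series_ext _ (fun k => 0 * 0)) by (intros n; rewrite Ha by lia; ring).
  rewrite Series_scal_l, Nat.add_0_r. ring. }
intros Hz. apply C_eq; simpl; rewrite R1; auto; intros n Hn; now rewrite Hz.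
Qed.

Lemma Cseries_tail_S (N : nat) (z : nat -> C) :
  abs_summable z -> Cseries (tail N z) = (z N + Cseries (tail (S N) z))%C.
Proof.
intros Hz.
rewrite (Cseries_ext (tail N z) (fun n => (if (n =? N)%nat then z N else 0) + tail (S N) z n)%C).
- rewrite Cseries_plus.
  + f_equal. rewrite (Cseries_single _ N).
    * now rewrite Nat.eqb_refl.
    * intros n Hn. now apply Nat.eqb_neq in Hn; rewrite Hn.
  + apply abs_summable_le with (fun n => Cmod (z n)); [| exact Hz].
    intros n; destruct (Nat.eqb_spec n N); subst; [apply Rle_refl |].
    rewrite Cmod_0; apply Cmod_ge_0.
  + now apply abs_summable_tail.
- intros n; unfold tail.
  destruct (Nat.ltb_spec n N), (Nat.eqb_spec n N), (Nat.ltb_spec n (S N)); subst;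
    try lia; ring.
Qed.

Lemma Cseries_split (N : nat) (z : nat -> C) :
  abs_summable z -> Cseries z = (Csum N z + Cseries (tail N z))%C.
Proof.
intros Hz. induction N as [|N IH]; simpl.
- rewrite Cplus_0_l. now apply Cseries_ext.
- rewrite IH, Cseries_tail_S by exact Hz. ring.
Qed.

Definition Rtail (N : nat) (b : nat -> R) (n : nat) : R := if (n <? N)%nat then 0 else b n.

Lemma ex_series_Rtail (N : nat) (b : nat -> R) : ex_series b -> ex_series (Rtail N b).
Proof.
intros Hb. apply (ex_series_incr_n (V := R_NormedModule) _ N).
apply (ex_series_incr_n (V := R_NormedModule) _ N) in Hb.
revert Hb; apply ex_series_ext; intros n; unfold Rtail.
destruct (Nat.ltb_spec (N + n) N); [lia | reflexivity].
Qed.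

Lemma Cmod_tail_Rtail (N : nat) (z : nat -> C) (b : nat -> R) (n : nat) :
  (forall n, Cmod (z n) <= b n) -> Cmod (tail N z n) <= Rtail N b n.
Proof.
intros H. unfold tail, Rtail. destruct (n <? N)%nat; [rewrite Cmod_0; lra | apply H].
Qed.

Lemma Series_Rtail_small (b : nat -> R) (eps : R) :
  ex_series b -> 0 < eps ->
  exists N0, forall N, (N0 <= N)%nat -> Rabs (Series (Rtail N b)) < eps.
Proof.
intros Hb Heps.
assert (Hl := Series_correct b Hb).
destruct (proj1 (filterlim_locally _ _) Hl (mkposreal _ Heps)) as [N0 HN0].
exists (S N0). intros N HN.
specialize (HN0 (pred N) ltac:(lia)).
change (Rabs (sum_n b (pred N) - Series b) < eps) in HN0.
rewrite (Series_incr_n b N ltac:(lia) Hb) in HN0.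
rewrite sum_n_Reals in HN0.
rewrite (Series_incr_n_aux (Rtail N b) N).
- rewrite (Series_ext _ (fun k => b (N + k)%nat)).
  + rewrite <- Rabs_Ropp. eapply Rle_lt_trans; [| exact HN0]. right; f_equal; ring.
  + intros n; unfold Rtail. destruct (Nat.ltb_spec (N + n) N); [lia | reflexivity].
- intros k Hk. unfold Rtail. destruct (Nat.ltb_spec k N); [reflexivity | lia].
Qed.

Lemma Cmod_small_eq (z w : C) : (forall eps, 0 < eps -> Cmod (z - w) <= eps) -> z = w.
Proof.
intros H. destruct (Req_dec (Cmod (z - w)) 0) as [E | E].
- apply Cmod_eq_0 in E. replace z with ((z - w) + w)%C by ring. rewrite E; ring.
- exfalso. assert (0 <= Cmod (z - w)) by apply Cmod_ge_0.
  specialize (H (Cmod (z - w) / 2) ltac:(lra)). lra.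
Qed.

(** The form in which series are summed below: each application exhibits the
    remainder as an integral, or as a functional, of a tail. *)
Lemma Cseries_unique (z : nat -> C) (w : C) :
  abs_summable z ->
  (forall eps, 0 < eps -> exists N0, forall N, (N0 <= N)%nat -> Cmod (w - Csum N z) <= eps) ->
  w = Cseries z.
Proof.
intros Hz Hw. apply Cmod_small_eq; intros eps He.
destruct (Hw (eps / 2) ltac:(lra)) as [N1 H1].
destruct (Series_Rtail_small _ (eps / 4) Hz ltac:(lra)) as [N2 H2].
set (N := Nat.max N1 N2).
specialize (H1 N ltac:(lia)). specialize (H2 N ltac:(lia)).
rewrite (Cseries_split N z Hz).
replace (w - (Csum N z + Cseries (tail N z)))%C
  with ((w - Csum N z) + - Cseries (tail N z))%C by ring.
eapply Rle_trans; [apply Cmod_triangle |]. rewrite Cmod_opp.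
assert (Cmod (Cseries (tail N z)) <= 2 * Series (Rtail N (fun n => Cmod (z n)))).
{ apply Cseries_le; [| now apply ex_series_Rtail].
  intros n; apply Cmod_tail_Rtail; intros; apply Rle_refl. }
apply Rabs_def2 in H2. lra.
Qed.

(** A quadratic remainder with a summable constant makes the difference quotient
    of the sum differ from the sum of the derivatives by at most a multiple of the
    increment. *)
Lemma is_derive_Series (f : nat -> R -> R) (f' M : nat -> R) (x : R) :
  (forall n s, Rabs (f n (x + s) - f n x - s * f' n) <= M n * s ^ 2) ->
  ex_series M -> (forall t, ex_series (fun n => f n t)) -> ex_series f' ->
  is_derive (fun t => Series (fun n => f n t)) x (Series f').
Proof.
intros H HM Hf Hf'. apply is_derive_Reals. intros eps Heps.
assert (HM0 : 0 <= Series M).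
{ apply Series_nonneg; [| exact HM]. intros n. generalize (H n 1) (Rabs_pos (f n (x + 1) - f n x - 1 * f' n)).
  lra. }
assert (Hd : 0 < eps / (Series M + 1)) by (apply Rdiv_lt_0_compat; lra).
exists (mkposreal _ Hd). intros s Hs0 Hs; simpl in Hs.
rewrite <- Series_minus by auto.
replace (Series (fun n => f n (x + s) - f n x) / s - Series f')
  with (/ s * (Series (fun n => f n (x + s) - f n x) - s * Series f')) by (field; auto).
rewrite <- Series_scal_l, <- Series_minus.
- rewrite Rabs_mult, Rabs_inv.
  assert (Hs1 : 0 < Rabs s) by now apply Rabs_pos_lt.
  assert (L : Rabs (Series (fun n => f n (x + s) - f n x - s * f' n)) <= Series M * s ^ 2).
  { rewrite <- Series_scal_r. apply Series_abs_le; [intros n; apply H |].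
    now apply ex_series_scal_r. }
  apply Rle_lt_trans with (/ Rabs s * (Series M * s ^ 2)).
  + apply Rmult_le_compat_l; [left; now apply Rinv_0_lt_compat | exact L].
  + rewrite <- (pow2_abs s).
    replace (/ Rabs s * (Series M * Rabs s ^ 2)) with (Series M * Rabs s) by (field; lra).
    apply Rle_lt_trans with ((Series M + 1) * Rabs s); [nra |].
    apply (Rmult_lt_compat_l (Series M + 1)) in Hs; [| lra].
    eapply Rlt_le_trans; [exact Hs | right; field; lra].
- apply ex_series_ext with (fun n => f n (x + s) + - 1 * f n x); [intros; simpl; ring |].
  apply ex_series_plus_R; auto using ex_series_scal_R.
- now apply ex_series_scal_R.
Qed.

Lemma is_deriveC_Cseries (f : nat -> R -> C) (f' : nat -> C) (M : nat -> R) (x : R) :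
  (forall n (s : R), Cmod (f n (x + s)%R - f n x - RtoC s * f' n) <= M n * s ^ 2) ->
  ex_series M -> (forall t, abs_summable (fun n => f n t)) -> abs_summable f' ->
  is_deriveC (fun t => Cseries (fun n => f n t)) x (Cseries f').
Proof.
intros H HM Hf Hf'. split; simpl.
- apply (is_derive_Series (fun n t => Re (f n t)) (fun n => Re (f' n)) M); auto using abs_summable_Re.
  + intros n s. eapply Rle_trans; [| apply H]. eapply Rle_trans; [| apply re_le_Cmod].
    right; f_equal; unfold Re, Im; simpl; ring.
- apply (is_derive_Series (fun n t => Im (f n t)) (fun n => Im (f' n)) M); auto using abs_summable_Im.
  + intros n s. eapply Rle_trans; [| apply H]. eapply Rle_trans; [| apply im_le_Cmod].
    right; f_equal; unfold Re, Im; simpl; ring.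
Qed.

(** * Characters of the torus *)

Definition phase (k : Z * Z) (p : R * R) : R := IZR (fst k) * fst p + IZR (snd k) * snd p.

Definition chi (k : Z * Z) (p : R * R) : C := (cos (phase k p), sin (phase k p)).

Definition opp_freq (k : Z * Z) : Z * Z := (- fst k, - snd k)%Z.
Definition add_freq (k l : Z * Z) : Z * Z := (fst k + fst l, snd k + snd l)%Z.

(** The maximum norm: it is attained at one of the two components, so that
    derivatives in a single variable control the decay of a coefficient. *)
Definition freq_norm (k : Z * Z) : R := Rmax (Rabs (IZR (fst k))) (Rabs (IZR (snd k))).

Lemma freq_norm_pos (k : Z * Z) : 0 <= freq_norm k.
Proof. eapply Rle_trans; [apply Rabs_pos | apply Rmax_l]. Qed.

Lemma freq_norm_opp (k : Z * Z) : freq_norm (opp_freq k) = freq_norm k.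
Proof. unfold freq_norm; simpl. now rewrite !opp_IZR, !Rabs_Ropp. Qed.

Lemma Cmod_cis (th : R) : Cmod (cos th, sin th) = 1.
Proof.
unfold Cmod; simpl. rewrite !Rmult_1_r, <- sqrt_1; f_equal.
generalize (sin2_cos2 th); unfold Rsqr; lra.
Qed.

Lemma Cmod_chi (k : Z * Z) (p : R * R) : Cmod (chi k p) = 1.
Proof. apply Cmod_cis. Qed.

Lemma chi_add (k l : Z * Z) (p : R * R) : chi (add_freq k l) p = (chi k p * chi l p)%C.
Proof.
unfold chi.
replace (phase (add_freq k l) p) with (phase k p + phase l p)
  by (unfold phase; simpl; rewrite !plus_IZR; ring).
rewrite cos_plus, sin_plus. apply C_eq; simpl; ring.
Qed.

Lemma chi_zero (p : R * R) : chi (0, 0)%Z p = 1%C.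
Proof.
unfold chi. replace (phase (0, 0)%Z p) with 0 by (unfold phase; simpl; ring).
now rewrite cos_0, sin_0.
Qed.

Lemma cos_sin_2PI_Z (k : Z) (t : R) :
  cos (t + 2 * IZR k * PI) = cos t /\ sin (t + 2 * IZR k * PI) = sin t.
Proof.
destruct (Z_le_gt_dec 0 k).
- rewrite <- (Z2Nat.id k), <- INR_IZR_INZ by lia. split; [apply cos_period | apply sin_period].
- rewrite <- (cos_period (t + 2 * IZR k * PI) (Z.to_nat (- k))),
    <- (sin_period (t + 2 * IZR k * PI) (Z.to_nat (- k))).
  rewrite INR_IZR_INZ, Z2Nat.id, opp_IZR by lia.
  split; f_equal; ring.
Qed.

Lemma periodic_chi (k : Z * Z) : periodic (chi k).
Proof.
intros x y; unfold chi; split.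
- replace (phase k (x + 2 * PI, y)) with (phase k (x, y) + 2 * IZR (fst k) * PI)
    by (unfold phase; simpl; ring).
  now destruct (cos_sin_2PI_Z (fst k) (phase k (x, y))) as [-> ->].
- replace (phase k (x, y + 2 * PI)) with (phase k (x, y) + 2 * IZR (snd k) * PI)
    by (unfold phase; simpl; ring).
  now destruct (cos_sin_2PI_Z (snd k) (phase k (x, y))) as [-> ->].
Qed.

Lemma sin_abs_le (w : R) : Rabs (sin w) <= Rabs w.
Proof.
destruct (MVT_abs sin cos 0 w) as [c [E _]].
- intros c _; apply derivable_pt_lim_sin.
- rewrite sin_0, !Rminus_0_r in E. rewrite E.
  assert (Rabs (cos c) <= 1) by (apply Rabs_le; apply COS_bound).
  generalize (Rabs_pos w); nra.
Qed.

Lemma abs_between_0 (c w : R) : Rmin 0 w <= c <= Rmax 0 w -> Rabs c <= Rabs w.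
Proof.
unfold Rmin, Rmax; destruct (Rle_dec 0 w); intros H.
- rewrite !Rabs_pos_eq; lra.
- rewrite !Rabs_left1; lra.
Qed.

Lemma cos_minus_1_le (w : R) : Rabs (cos w - 1) <= w ^ 2.
Proof.
destruct (MVT_abs cos (fun t => - sin t) 0 w) as [c [E Hc]].
- intros c _; apply derivable_pt_lim_cos.
- rewrite cos_0, Rminus_0_r, Rabs_Ropp in E. rewrite E, <- pow2_abs.
  apply abs_between_0 in Hc. generalize (sin_abs_le c) (Rabs_pos (sin c)) (Rabs_pos w); nra.
Qed.

Lemma cos_minus_1_le_lin (w : R) : Rabs (cos w - 1) <= Rabs w.
Proof.
destruct (MVT_abs cos (fun t => - sin t) 0 w) as [c [E Hc]].
- intros c _; apply derivable_pt_lim_cos.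
- rewrite cos_0, Rminus_0_r, Rabs_Ropp in E. rewrite E.
  assert (Rabs (sin c) <= 1) by (apply Rabs_le; apply SIN_bound).
  generalize (Rabs_pos w); nra.
Qed.

Lemma sin_minus_id_le (w : R) : Rabs (sin w - w) <= w ^ 2.
Proof.
destruct (MVT_abs (fun t => sin t - t) (fun t => cos t - 1) 0 w) as [c [E Hc]].
- intros c _. apply derivable_pt_lim_minus; [apply derivable_pt_lim_sin | apply derivable_pt_lim_id].
- rewrite sin_0, !Rminus_0_r in E. rewrite E, <- pow2_abs.
  apply abs_between_0 in Hc.
  generalize (cos_minus_1_le_lin c) (Rabs_pos (cos c - 1)) (Rabs_pos w); nra.
Qed.

Lemma cis_shift (th w : R) :
  ((cos (th + w), sin (th + w)) : C) = ((cos th, sin th) * (cos w, sin w))%C.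
Proof. rewrite cos_plus, sin_plus. apply C_eq; simpl; ring. Qed.

Lemma cis_taylor1 (th w : R) :
  Cmod ((cos (th + w)%R, sin (th + w)%R) - (cos th, sin th))%C <= 2 * Rabs w.
Proof.
rewrite cis_shift.
replace ((cos th, sin th) * (cos w, sin w) - (cos th, sin th))%C
  with ((cos th, sin th) * ((cos w - 1)%R, sin w))%C by (apply C_eq; simpl; ring).
rewrite Cmod_mult, Cmod_cis, Rmult_1_l.
eapply Rle_trans; [apply Cmod_le_Re_Im |]; simpl.
generalize (cos_minus_1_le_lin w) (sin_abs_le w); lra.
Qed.

Lemma cis_taylor2 (th w : R) :
  Cmod ((cos (th + w)%R, sin (th + w)%R) - (cos th, sin th) - RtoC w * (Ci * (cos th, sin th)))%C
    <= 2 * w ^ 2.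
Proof.
rewrite cis_shift.
replace ((cos th, sin th) * (cos w, sin w) - (cos th, sin th) - RtoC w * (Ci * (cos th, sin th)))%C
  with ((cos th, sin th) * ((cos w - 1)%R, (sin w - w)%R))%C by (apply C_eq; simpl; ring).
rewrite Cmod_mult, Cmod_cis, Rmult_1_l.
eapply Rle_trans; [apply Cmod_le_Re_Im |]; simpl.
generalize (cos_minus_1_le w) (sin_minus_id_le w); simpl; lra.
Qed.

(** * Rapidly convergent Fourier series *)

Definition fourier (xi : nat -> Z * Z) (a : nat -> C) (p : R * R) : C :=
  Cseries (fun n => a n * chi (xi n) p)%C.

(** Decay faster than every power of the frequency, which permits termwise
    differentiation of every order. *)
Definition rapid (xi : nat -> Z * Z) (a : nat -> C) : Prop :=
  forall k : nat, ex_series (fun n => Cmod (a n) * freq_norm (xi n) ^ k).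

Lemma rapid_le (xi : nat -> Z * Z) (a b : nat -> C) (K : R) (j : nat) :
  (forall n, Cmod (b n) <= K * (Cmod (a n) * freq_norm (xi n) ^ j)) ->
  rapid xi a -> rapid xi b.
Proof.
intros H Ha k.
apply ex_series_le_R with (fun n => K * (Cmod (a n) * freq_norm (xi n) ^ (j + k))).
- intros n. assert (Hx := pow_le _ k (freq_norm_pos (xi n))).
  rewrite Rabs_mult, (Rabs_pos_eq (Cmod _)), (Rabs_pos_eq (_ ^ k)) by (auto; apply Cmod_ge_0).
  rewrite pow_add, <- !Rmult_assoc.
  apply Rmult_le_compat_r; [exact Hx |]. rewrite Rmult_assoc; apply H.
- apply ex_series_scal_R, Ha.
Qed.

Lemma rapid_abs_summable (xi : nat -> Z * Z) (a : nat -> C) : rapid xi a -> abs_summable a.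
Proof.
intros Ha. generalize (Ha 0%nat). apply ex_series_ext; intros n; simpl; ring.
Qed.

Lemma fourier_summable (xi : nat -> Z * Z) (a : nat -> C) (p : R * R) :
  abs_summable a -> abs_summable (fun n => a n * chi (xi n) p)%C.
Proof.
apply abs_summable_le; intros n. rewrite Cmod_mult, Cmod_chi; lra.
Qed.

Lemma fourier_le (xi : nat -> Z * Z) (a : nat -> C) (b : nat -> R) (p : R * R) :
  (forall n, Cmod (a n) <= b n) -> ex_series b -> Cmod (fourier xi a p) <= 2 * Series b.
Proof.
intros H; apply Cseries_le; intros n. rewrite Cmod_mult, Cmod_chi, Rmult_1_r. apply H.
Qed.

Lemma fourier_ext (xi : nat -> Z * Z) (a b : nat -> C) :
  (forall n, a n = b n) -> fourier xi a = fourier xi b.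
Proof. intros E; f_equal; now apply functional_extensionality. Qed.

Lemma fourier_plus (xi : nat -> Z * Z) (a b : nat -> C) (p : R * R) :
  abs_summable a -> abs_summable b ->
  fourier xi (fun n => a n + b n)%C p = (fourier xi a p + fourier xi b p)%C.
Proof.
intros Ha Hb. unfold fourier. rewrite <- Cseries_plus by now apply fourier_summable.
apply Cseries_ext; intros n; ring.
Qed.

Lemma fourier_scal (xi : nat -> Z * Z) (c : C) (a : nat -> C) (p : R * R) :
  abs_summable a -> fourier xi (fun n => c * a n)%C p = (c * fourier xi a p)%C.
Proof.
intros Ha. unfold fourier. rewrite <- Cseries_scal by now apply fourier_summable.
apply Cseries_ext; intros n; ring.
Qed.

Lemma periodic_fourier (xi : nat -> Z * Z) (a : nat -> C) : periodic (fourier xi a).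
Proof.
intros x y; split; apply Cseries_ext; intros n; f_equal; apply periodic_chi.
Qed.

Lemma phase_diff_le (k : Z * Z) (p q : R * R) :
  Rabs (phase k q - phase k p) <=
    freq_norm k * (Rabs (fst q - fst p) + Rabs (snd q - snd p)).
Proof.
unfold phase.
replace (_ - _) with (IZR (fst k) * (fst q - fst p) + IZR (snd k) * (snd q - snd p)) by ring.
eapply Rle_trans; [apply Rabs_triang |]. rewrite !Rabs_mult, Rmult_plus_distr_l.
apply Rplus_le_compat; (apply Rmult_le_compat_r; [apply Rabs_pos | apply Rmax_l || apply Rmax_r]).
Qed.

Lemma continuousC_of_Lipschitz (f : R * R -> C) (K : R) :
  (forall p q, Cmod (f q - f p)%C <= K * (Rabs (fst q - fst p) + Rabs (snd q - snd p))) ->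
  continuousC f.
Proof.
intros H p. apply filterlim_locally; intros eps.
assert (HK : 0 < 2 * (Rabs K + 1)) by (generalize (Rabs_pos K); lra).
assert (Hd : 0 < eps / (2 * (Rabs K + 1))) by (apply Rdiv_lt_0_compat; [apply cond_pos | lra]).
exists (mkposreal _ Hd). intros q [B1 B2]; simpl in B1, B2.
change (Rabs (fst q - fst p) < eps / (2 * (Rabs K + 1))) in B1.
change (Rabs (snd q - snd p) < eps / (2 * (Rabs K + 1))) in B2.
assert (L : Cmod (f q - f p)%C < eps).
{ eapply Rle_lt_trans; [apply H |].
  set (r := Rabs (fst q - fst p) + Rabs (snd q - snd p)).
  assert (0 <= r) by (apply Rplus_le_le_0_compat; apply Rabs_pos).
  apply Rle_lt_trans with ((Rabs K + 1) * r); [apply Rmult_le_compat_r; [assumption | generalize (Rle_abs K); lra] |].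
  apply Rlt_le_trans with ((Rabs K + 1) * (eps / (2 * (Rabs K + 1)) + eps / (2 * (Rabs K + 1)))).
  - apply Rmult_lt_compat_l; [generalize (Rabs_pos K); lra | unfold r; lra].
  - right; field. generalize (Rabs_pos K); lra. }
now apply ball_of_Cmod_lt.
Qed.

Lemma chi_Lipschitz (k : Z * Z) (p q : R * R) :
  Cmod (chi k q - chi k p)%C <=
    2 * freq_norm k * (Rabs (fst q - fst p) + Rabs (snd q - snd p)).
Proof.
unfold chi. replace (phase k q) with (phase k p + (phase k q - phase k p)) by ring.
eapply Rle_trans; [apply cis_taylor1 |].
generalize (phase_diff_le k p q); lra.
Qed.

Lemma continuousC_fourier (xi : nat -> Z * Z) (a : nat -> C) :
  rapid xi a -> continuousC (fourier xi a).
Proof.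
intros Ha.
set (S := Series (fun n => Cmod (a n) * freq_norm (xi n) ^ 1)).
apply continuousC_of_Lipschitz with (4 * S). intros p q.
set (r := Rabs (fst q - fst p) + Rabs (snd q - snd p)).
assert (Hs := rapid_abs_summable xi a Ha).
replace (fourier xi a q - fourier xi a p)%C
  with (Cseries (fun n => a n * chi (xi n) q + - (1) * (a n * chi (xi n) p)))%C.
- eapply Rle_trans.
  + apply (Cseries_le _ (fun n => 2 * r * (Cmod (a n) * freq_norm (xi n) ^ 1))).
    * intros n.
      replace (a n * chi (xi n) q + - (1) * (a n * chi (xi n) p))%C
        with (a n * (chi (xi n) q - chi (xi n) p))%C by ring.
      rewrite Cmod_mult.
      generalize (chi_Lipschitz (xi n) p q) (Cmod_ge_0 (a n)). fold r. simpl. nra.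
    * apply ex_series_scal_R, Ha.
  + rewrite Series_scal_l. fold S. lra.
- rewrite Cseries_plus, Cseries_scal.
  + unfold fourier; ring.
  + now apply fourier_summable.
  + now apply fourier_summable.
  + now apply abs_summable_scal, fourier_summable.
Qed.

(** Both partial derivatives at once: [p] is a coordinate line, along which the
    phase of the [n]-th character grows with slope [c n]. *)
Lemma is_deriveC_fourier_line (xi : nat -> Z * Z) (a : nat -> C) (c : nat -> R)
    (p : R -> R * R) (t : R) :
  rapid xi a -> (forall n, Rabs (c n) <= freq_norm (xi n)) ->
  (forall n s, phase (xi n) (p (t + s)) = phase (xi n) (p t) + c n * s) ->
  is_deriveC (fun s => fourier xi a (p s)) t (fourier xi (fun n => Ci * RtoC (c n) * a n)%C (p t)).
Proof.
intros Ha Hc Hp. unfold fourier.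
apply (is_deriveC_Cseries (fun n s => a n * chi (xi n) (p s))%C _
  (fun n => 2 * (Cmod (a n) * freq_norm (xi n) ^ 2))).
- intros n s. unfold chi. rewrite Hp.
  match goal with |- Cmod ?z <= _ => replace z with (a n *
   ((cos (phase (xi n) (p t) + c n * s)%R, sin (phase (xi n) (p t) + c n * s)%R) -
    (cos (phase (xi n) (p t)), sin (phase (xi n) (p t))) -
    RtoC (c n * s) * (Ci * (cos (phase (xi n) (p t)), sin (phase (xi n) (p t))))))%C
   by (rewrite RtoC_mult; ring) end.
  rewrite Cmod_mult.
  assert (Q : (c n * s) ^ 2 <= freq_norm (xi n) ^ 2 * s ^ 2).
  { rewrite Rpow_mult_distr. apply Rmult_le_compat_r; [apply pow2_ge_0 |].
    rewrite <- (pow2_abs (c n)). apply pow_incr; split; [apply Rabs_pos | apply Hc]. }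
  generalize (cis_taylor2 (phase (xi n) (p t)) (c n * s)) (Cmod_ge_0 (a n)).
  set (X := Cmod (_ - _ - _)%C). clearbody X. intros T Z.
  apply Rle_trans with (Cmod (a n) * (2 * (c n * s) ^ 2)); [now apply Rmult_le_compat_l |].
  assert (Cmod (a n) * (c n * s) ^ 2 <= Cmod (a n) * (freq_norm (xi n) ^ 2 * s ^ 2))
    by now apply Rmult_le_compat_l.
  lra.
- apply ex_series_scal_R, Ha.
- intros s. apply fourier_summable, (rapid_abs_summable xi a Ha).
- apply fourier_summable, (rapid_abs_summable xi).
  apply (rapid_le xi a _ 1 1); [| exact Ha].
  intros n. rewrite !Cmod_mult, Cmod_Ci, Cmod_R. generalize (Hc n) (Cmod_ge_0 (a n)). simpl; nra.
Qed.

Definition mult1 (xi : nat -> Z * Z) (a : nat -> C) (n : nat) : C := (RtoC (IZR (fst (xi n))) * a n)%C.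
Definition mult2 (xi : nat -> Z * Z) (a : nat -> C) (n : nat) : C := (RtoC (IZR (snd (xi n))) * a n)%C.

Lemma Cmod_mult1_le (xi : nat -> Z * Z) (a : nat -> C) (n : nat) :
  Cmod (mult1 xi a n) <= freq_norm (xi n) * Cmod (a n).
Proof.
unfold mult1. rewrite Cmod_mult, Cmod_R.
apply Rmult_le_compat_r; [apply Cmod_ge_0 | apply Rmax_l].
Qed.

Lemma Cmod_mult2_le (xi : nat -> Z * Z) (a : nat -> C) (n : nat) :
  Cmod (mult2 xi a n) <= freq_norm (xi n) * Cmod (a n).
Proof.
unfold mult2. rewrite Cmod_mult, Cmod_R.
apply Rmult_le_compat_r; [apply Cmod_ge_0 | apply Rmax_r].
Qed.

Lemma rapid_mult1 (xi : nat -> Z * Z) (a : nat -> C) : rapid xi a -> rapid xi (mult1 xi a).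
Proof. apply (rapid_le xi a _ 1 1); intros n. generalize (Cmod_mult1_le xi a n); simpl; lra. Qed.

Lemma rapid_mult2 (xi : nat -> Z * Z) (a : nat -> C) : rapid xi a -> rapid xi (mult2 xi a).
Proof. apply (rapid_le xi a _ 1 1); intros n. generalize (Cmod_mult2_le xi a n); simpl; lra. Qed.

Lemma rapid_scal (xi : nat -> Z * Z) (c : C) (a : nat -> C) :
  rapid xi a -> rapid xi (fun n => c * a n)%C.
Proof. apply (rapid_le xi a _ (Cmod c) 0); intros n; rewrite Cmod_mult; simpl; lra. Qed.

Lemma is_deriveC_fourier1 (xi : nat -> Z * Z) (a : nat -> C) (x y : R) :
  rapid xi a ->
  is_deriveC (fun t => fourier xi a (t, y)) x (fourier xi (fun n => Ci * mult1 xi a n)%C (x, y)).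
Proof.
intros Ha.
rewrite (fourier_ext xi (fun n => Ci * mult1 xi a n)%C
    (fun n => Ci * RtoC (IZR (fst (xi n))) * a n)%C)
  by (intros n; unfold mult1; apply Cmult_assoc).
apply (is_deriveC_fourier_line xi a (fun n => IZR (fst (xi n))) (fun t => (t, y))); auto.
- intros n; apply Rmax_l.
- intros n s; unfold phase; simpl; ring.
Qed.

Lemma is_deriveC_fourier2 (xi : nat -> Z * Z) (a : nat -> C) (x y : R) :
  rapid xi a ->
  is_deriveC (fun t => fourier xi a (x, t)) y (fourier xi (fun n => Ci * mult2 xi a n)%C (x, y)).
Proof.
intros Ha.
rewrite (fourier_ext xi (fun n => Ci * mult2 xi a n)%C
    (fun n => Ci * RtoC (IZR (snd (xi n))) * a n)%C)
  by (intros n; unfold mult2; apply Cmult_assoc).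
apply (is_deriveC_fourier_line xi a (fun n => IZR (snd (xi n))) (fun t => (x, t))); auto.
- intros n; apply Rmax_r.
- intros n s; unfold phase; simpl; ring.
Qed.

Lemma partial1_fourier (xi : nat -> Z * Z) (a : nat -> C) :
  rapid xi a -> partial1 (fourier xi a) = fourier xi (fun n => Ci * mult1 xi a n)%C.
Proof.
intros Ha. apply functional_extensionality; intros [x y].
now apply is_deriveC_unique, is_deriveC_fourier1.
Qed.

Lemma partial2_fourier (xi : nat -> Z * Z) (a : nat -> C) :
  rapid xi a -> partial2 (fourier xi a) = fourier xi (fun n => Ci * mult2 xi a n)%C.
Proof.
intros Ha. apply functional_extensionality; intros [x y].
now apply is_deriveC_unique, is_deriveC_fourier2.
Qed.

Lemma class_Ck_fourier (xi : nat -> Z * Z) (k : nat) : forall a : nat -> C,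
  rapid xi a -> class_Ck k (fourier xi a).
Proof.
induction k as [|k IH]; intros a Ha.
- split; [now apply continuousC_fourier | trivial].
- split; [now apply continuousC_fourier | split; [| split]].
  + intros [x y]; split; simpl; eapply is_deriveC_ex.
    * now apply is_deriveC_fourier1.
    * now apply is_deriveC_fourier2.
  + rewrite partial1_fourier by exact Ha. now apply IH, rapid_scal, rapid_mult1.
  + rewrite partial2_fourier by exact Ha. now apply IH, rapid_scal, rapid_mult2.
Qed.

Lemma smooth_torus_fourier (xi : nat -> Z * Z) (a : nat -> C) :
  rapid xi a -> smooth_torus (fourier xi a).
Proof. split; [apply periodic_fourier | intros k; now apply class_Ck_fourier]. Qed.

Lemma D1_fourier (xi : nat -> Z * Z) (a : nat -> C) :
  rapid xi a -> D1 (fourier xi a) = fourier xi (mult1 xi a).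
Proof.
intros Ha. apply functional_extensionality; intros p. unfold D1.
rewrite partial1_fourier by exact Ha.
rewrite fourier_scal by now apply (rapid_abs_summable xi), rapid_mult1.
transitivity (- (Ci * Ci) * fourier xi (mult1 xi a) p)%C; [ring |].
replace (Ci * Ci)%C with (- (1))%C by (apply C_eq; unfold Re, Im; simpl; ring). ring.
Qed.

Lemma D2_fourier (xi : nat -> Z * Z) (a : nat -> C) :
  rapid xi a -> D2 (fourier xi a) = fourier xi (mult2 xi a).
Proof.
intros Ha. apply functional_extensionality; intros p. unfold D2.
rewrite partial2_fourier by exact Ha.
rewrite fourier_scal by now apply (rapid_abs_summable xi), rapid_mult2.
transitivity (- (Ci * Ci) * fourier xi (mult2 xi a) p)%C; [ring |].
replace (Ci * Ci)%C with (- (1))%C by (apply C_eq; unfold Re, Im; simpl; ring). ring.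
Qed.

Definition multg (xi : nat -> Z * Z) (g : nat * nat) (a : nat -> C) : nat -> C :=
  Nat.iter (fst g) (mult1 xi) (Nat.iter (snd g) (mult2 xi) a).

Lemma Dgamma_fourier (xi : nat -> Z * Z) (g : nat * nat) (a : nat -> C) :
  rapid xi a -> Dgamma g (fourier xi a) = fourier xi (multg xi g a).
Proof.
intros Ha. destruct g as [i j]; unfold Dgamma, multg; simpl.
assert (H2 : rapid xi (Nat.iter j (mult2 xi) a) /\
  Nat.iter j D2 (fourier xi a) = fourier xi (Nat.iter j (mult2 xi) a)).
{ induction j as [|j [IH1 IH2]]; simpl; [now split |].
  split; [now apply rapid_mult2 |]. rewrite IH2. now apply D2_fourier. }
destruct H2 as [Hb ->].
set (b := Nat.iter j (mult2 xi) a) in *. clearbody b.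
assert (H1 : rapid xi (Nat.iter i (mult1 xi) b) /\
  Nat.iter i D1 (fourier xi b) = fourier xi (Nat.iter i (mult1 xi) b)).
{ induction i as [|i [IH1 IH2]]; simpl; [now split |].
  split; [now apply rapid_mult1 |]. rewrite IH2. now apply D1_fourier. }
apply H1.
Qed.

Lemma Cmod_multg_le (xi : nat -> Z * Z) (g : nat * nat) (a : nat -> C) (n : nat) :
  Cmod (multg xi g a n) <= Cmod (a n) * freq_norm (xi n) ^ order g.
Proof.
destruct g as [i j]; unfold multg, order; simpl.
assert (Hx := freq_norm_pos (xi n)).
induction i as [|i IH]; simpl.
- induction j as [|j IH]; simpl; [lra |].
  eapply Rle_trans; [apply Cmod_mult2_le |].
  apply Rle_trans with (freq_norm (xi n) * (Cmod (a n) * freq_norm (xi n) ^ j));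
    [now apply Rmult_le_compat_l | right; ring].
- eapply Rle_trans; [apply Cmod_mult1_le |].
  apply Rle_trans with (freq_norm (xi n) * (Cmod (a n) * freq_norm (xi n) ^ (i + j)));
    [now apply Rmult_le_compat_l | right; ring].
Qed.

(** * Fourier coefficients of smooth functions *)

Definition delta (N n : nat) : C := if (n =? N)%nat then 1%C else 0%C.

Lemma delta_neq (N n : nat) : n <> N -> delta N n = 0%C.
Proof. intros H; unfold delta. now apply Nat.eqb_neq in H; rewrite H. Qed.

Lemma rapid_delta (xi : nat -> Z * Z) (N : nat) : rapid xi (delta N).
Proof.
intros k. apply ex_series_single with N. intros n Hn.
rewrite delta_neq, Cmod_0 by exact Hn; ring.
Qed.

Lemma fourier_delta (xi : nat -> Z * Z) (N : nat) (c : C) :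
  fourier xi (fun n => c * delta N n)%C = (fun p => c * chi (xi N) p)%C.
Proof.
apply functional_extensionality; intros p. unfold fourier.
rewrite (Cseries_single _ N).
- unfold delta; rewrite Nat.eqb_refl; ring.
- intros n Hn. rewrite delta_neq by exact Hn; ring.
Qed.

(** Lets a character inherit smoothness and derivatives from Fourier series. *)
Lemma chi_fourier (k : Z * Z) : chi k = fourier (fun _ => k) (delta 0).
Proof.
transitivity (fun p => 1 * chi k p)%C.
- apply functional_extensionality; intros p; ring.
- rewrite <- (fourier_delta (fun _ => k) 0). apply fourier_ext; intros n; ring.
Qed.

Lemma smooth_torus_chi (k : Z * Z) : smooth_torus (chi k).
Proof. rewrite chi_fourier. apply smooth_torus_fourier, rapid_delta. Qed.

Lemma continuousC_chi (k : Z * Z) : continuousC (chi k).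
Proof. apply smooth_torus_continuous, smooth_torus_chi. Qed.

Lemma D1_chi (k : Z * Z) : D1 (chi k) = (fun p => RtoC (IZR (fst k)) * chi k p)%C.
Proof.
rewrite chi_fourier at 1. rewrite D1_fourier by apply rapid_delta.
exact (fourier_delta (fun _ => k) 0 _).
Qed.

Lemma D2_chi (k : Z * Z) : D2 (chi k) = (fun p => RtoC (IZR (snd k)) * chi k p)%C.
Proof.
rewrite chi_fourier at 1. rewrite D2_fourier by apply rapid_delta.
exact (fourier_delta (fun _ => k) 0 _).
Qed.

Lemma torus_int_chi_D1 (k : Z * Z) (f : R * R -> C) :
  smooth_torus f ->
  torus_int (fun p => chi k p * D1 f p)%C =
    (- RtoC (IZR (fst k)) * torus_int (fun p => chi k p * f p))%C.
Proof.
intros Hf. rewrite torus_int_D1 by auto using smooth_torus_chi. rewrite D1_chi.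
rewrite (torus_int_ext _ (fun p => RtoC (IZR (fst k)) * (chi k p * f p))%C) by (intros; ring).
rewrite torus_int_scal by (apply continuousC_mult;
  auto using continuousC_chi, smooth_torus_continuous).
ring.
Qed.

Lemma torus_int_chi_D2 (k : Z * Z) (f : R * R -> C) :
  smooth_torus f ->
  torus_int (fun p => chi k p * D2 f p)%C =
    (- RtoC (IZR (snd k)) * torus_int (fun p => chi k p * f p))%C.
Proof.
intros Hf. rewrite torus_int_D2 by auto using smooth_torus_chi. rewrite D2_chi.
rewrite (torus_int_ext _ (fun p => RtoC (IZR (snd k)) * (chi k p * f p))%C) by (intros; ring).
rewrite torus_int_scal by (apply continuousC_mult;
  auto using continuousC_chi, smooth_torus_continuous).
ring.
Qed.

Lemma torus_int_chi_iter_D1 (k : Z * Z) (j : nat) (f : R * R -> C) :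
  smooth_torus f ->
  smooth_torus (Nat.iter j D1 f) /\
  Cmod (torus_int (fun p => chi k p * Nat.iter j D1 f p)%C) =
    Rabs (IZR (fst k)) ^ j * Cmod (torus_int (fun p => chi k p * f p)%C).
Proof.
intros Hf. induction j as [|j [IH1 IH2]]; simpl.
- split; [exact Hf | ring].
- split; [now apply smooth_torus_D1 |].
  rewrite torus_int_chi_D1, Cmod_mult, Cmod_opp, Cmod_R, IH2 by exact IH1. ring.
Qed.

Lemma torus_int_chi_iter_D2 (k : Z * Z) (j : nat) (f : R * R -> C) :
  smooth_torus f ->
  smooth_torus (Nat.iter j D2 f) /\
  Cmod (torus_int (fun p => chi k p * Nat.iter j D2 f p)%C) =
    Rabs (IZR (snd k)) ^ j * Cmod (torus_int (fun p => chi k p * f p)%C).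
Proof.
intros Hf. induction j as [|j [IH1 IH2]]; simpl.
- split; [exact Hf | ring].
- split; [now apply smooth_torus_D2 |].
  rewrite torus_int_chi_D2, Cmod_mult, Cmod_opp, Cmod_R, IH2 by exact IH1. ring.
Qed.

(** Integrate by parts [j] times in the variable in which the frequency is
    larger. *)
Lemma fourier_coefficient_decay (k : Z * Z) (j : nat) (f : R * R -> C) (B : R) :
  smooth_torus f ->
  (forall g p, order g = j -> Cmod (Dgamma g f p) <= B) ->
  Cmod (torus_int (fun p => chi k p * f p)%C) * freq_norm k ^ j <= 8 * PI ^ 2 * B.
Proof.
intros Hf HB.
assert (Hc : forall h, smooth_torus h -> (forall p, Cmod (h p) <= B) ->
  Cmod (torus_int (fun p => chi k p * h p)%C) <= 8 * PI ^ 2 * B).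
{ intros h Hh Hhb. apply torus_int_bound.
  - apply continuousC_mult; auto using continuousC_chi, smooth_torus_continuous.
  - intros p. rewrite Cmod_mult, Cmod_chi, Rmult_1_l. apply Hhb. }
unfold freq_norm, Rmax. destruct (Rle_dec _ _).
- destruct (torus_int_chi_iter_D2 k j f Hf) as [S2 E2].
  rewrite Rmult_comm, <- E2. apply Hc; [exact S2 |].
  intros p. apply (HB (0, j)%nat); reflexivity.
- destruct (torus_int_chi_iter_D1 k j f Hf) as [S1 E1].
  rewrite Rmult_comm, <- E1. apply Hc; [exact S1 |].
  intros p. apply (HB (j, 0)%nat). unfold order; simpl; lia.
Qed.

Lemma torus_int_chi_zero : torus_int (chi (0, 0)%Z) = RtoC (4 * PI ^ 2).
Proof.
rewrite (torus_int_ext _ (fun _ => 1%C)) by apply chi_zero.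
rewrite torus_int_const; ring.
Qed.

(** Integrating by parts against the constant character multiplies the integral by
    each component of the frequency and gives zero. *)
Lemma torus_int_chi (k : Z * Z) : k <> (0, 0)%Z -> torus_int (chi k) = 0%C.
Proof.
intros Hk.
assert (S1 := smooth_torus_chi (0, 0)%Z). assert (S2 := smooth_torus_chi k).
assert (E : forall h, torus_int (fun p => chi (0, 0)%Z p * h p)%C = torus_int h).
{ intros h; apply torus_int_ext; intros p; rewrite chi_zero; ring. }
assert (E1 := torus_int_chi_D1 (0, 0)%Z (chi k) S2).
assert (E2 := torus_int_chi_D2 (0, 0)%Z (chi k) S2).
rewrite E, D1_chi, torus_int_scal in E1 by apply continuousC_chi.
rewrite E, D2_chi, torus_int_scal in E2 by apply continuousC_chi.
simpl in E1, E2.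
destruct k as [k1 k2]; simpl in *.
assert (Hz : forall z, z <> 0%Z -> RtoC (IZR z) <> 0%C).
{ intros z Hz0 H. apply RtoC_inj in H. now apply eq_IZR_R0 in H. }
assert (Hcancel : forall z T X, z <> 0%Z -> (RtoC (IZR z) * T = - RtoC 0 * X)%C -> T = 0%C).
{ intros z T X Hz0 H. replace T with (/ RtoC (IZR z) * (RtoC (IZR z) * T))%C
    by (field; now apply Hz). rewrite H; ring. }
destruct (Z.eq_dec k1 0) as [-> | H1].
- destruct (Z.eq_dec k2 0) as [-> | H2]; [now contradiction Hk |]. eapply Hcancel; eauto.
- eapply Hcancel; eauto.
Qed.

(** * Fourier series against bounded continuous functions *)

Lemma rapid_tail (xi : nat -> Z * Z) (N : nat) (a : nat -> C) :
  rapid xi a -> rapid xi (tail N a).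
Proof.
apply (rapid_le xi a _ 1 0); intros n. generalize (Cmod_tail_le N a n); simpl; lra.
Qed.

Lemma fourier_tail_S (xi : nat -> Z * Z) (N : nat) (a : nat -> C) (p : R * R) :
  rapid xi a ->
  fourier xi (tail N a) p = (a N * chi (xi N) p + fourier xi (tail (S N) a) p)%C.
Proof.
intros Ha. unfold fourier.
assert (E : forall M, Cseries (fun n => tail M a n * chi (xi n) p)%C =
  Cseries (tail M (fun n => a n * chi (xi n) p)%C)).
{ intros M; apply Cseries_ext; intros n; unfold tail. destruct (n <? M)%nat; ring. }
rewrite !E. rewrite Cseries_tail_S; [reflexivity |].
now apply fourier_summable, (rapid_abs_summable xi).
Qed.

(** Sum and integral are exchanged because the tails of the series are uniformly
    small and [f] is bounded. *)
Lemma torus_int_fourier (xi : nat -> Z * Z) (a : nat -> C) (f : R * R -> C) (B : R) :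
  rapid xi a -> continuousC f -> (forall p, Cmod (f p) <= B) ->
  torus_int (fun p => fourier xi a p * f p)%C =
    Cseries (fun n => a n * torus_int (fun p => chi (xi n) p * f p))%C.
Proof.
intros Ha Hf HB.
assert (Hs := rapid_abs_summable xi a Ha).
assert (HB0 : 0 <= B) by (eapply Rle_trans; [apply Cmod_ge_0 | apply (HB (0, 0))]).
assert (Hstep : forall N, (torus_int (fun p => fourier xi a p * f p) =
  Csum N (fun n => a n * torus_int (fun p => chi (xi n) p * f p)) +
  torus_int (fun p => fourier xi (tail N a) p * f p))%C).
{ induction N as [|N IH]; simpl; [now rewrite Cplus_0_l |].
  rewrite IH.
  rewrite (torus_int_ext _ (fun p => a N * (chi (xi N) p * f p) +
    fourier xi (tail (S N) a) p * f p)%C)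
    by (intros p; rewrite fourier_tail_S by exact Ha; ring).
  assert (H1 : continuousC (fun p => chi (xi N) p * f p)%C)
    by (apply continuousC_mult; [apply continuousC_chi | exact Hf]).
  assert (H2 : continuousC (fun p => fourier xi (tail (S N) a) p * f p)%C)
    by (apply continuousC_mult; [now apply continuousC_fourier, rapid_tail | exact Hf]).
  rewrite torus_int_plus, torus_int_scal; [| exact H1 | now apply continuousC_scal | exact H2].
  ring. }
apply Cseries_unique.
- apply abs_summable_le with (fun n => 8 * PI ^ 2 * B * Cmod (a n));
    [| now apply ex_series_scal_R].
  intros n. rewrite Cmod_mult, Rmult_comm.
  apply Rmult_le_compat_r; [apply Cmod_ge_0 |].
  apply torus_int_bound.
  + apply continuousC_mult; auto using continuousC_chi.
  + intros p; rewrite Cmod_mult, Cmod_chi, Rmult_1_l; apply HB.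
- intros eps Heps.
  assert (HK : 0 < 16 * PI ^ 2 * B + 1) by (generalize (pow2_ge_0 PI); nra).
  destruct (Series_Rtail_small _ (eps / (16 * PI ^ 2 * B + 1)) Hs) as [N0 HN0];
    [now apply Rdiv_lt_0_compat |].
  exists N0; intros N HN. rewrite (Hstep N).
  replace (Csum N _ + _ - Csum N _)%C with (torus_int (fun p => fourier xi (tail N a) p * f p)%C) by ring.
  set (T := Series (Rtail N (fun n => Cmod (a n)))).
  specialize (HN0 N HN). fold T in HN0. apply Rabs_def2 in HN0.
  assert (HT : forall p, Cmod (fourier xi (tail N a) p) <= 2 * T).
  { intros p. apply fourier_le; [| now apply ex_series_Rtail].
    intros n; apply Cmod_tail_Rtail; intros; apply Rle_refl. }
  apply Rle_trans with (8 * PI ^ 2 * (2 * T * B)).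
  + apply torus_int_bound.
    * apply continuousC_mult; auto using continuousC_fourier, rapid_tail.
    * intros p. rewrite Cmod_mult. apply Rmult_le_compat; auto using Cmod_ge_0.
  + assert (T0 : 0 <= T) by (generalize (HT (0, 0)) (Cmod_ge_0 (fourier xi (tail N a) (0, 0))); lra).
    apply Rle_trans with ((16 * PI ^ 2 * B + 1) * T); [nra |].
    apply Rle_trans with ((16 * PI ^ 2 * B + 1) * (eps / (16 * PI ^ 2 * B + 1))).
    * apply Rmult_le_compat_l; lra.
    * right; field; lra.
Qed.

Definition injective_freq (xi : nat -> Z * Z) : Prop :=
  forall n n', xi n = xi n' -> n = n'.

Lemma add_opp_freq (k l : Z * Z) : add_freq l (opp_freq k) = (0, 0)%Z <-> l = k.
Proof.
destruct k as [k1 k2], l as [l1 l2]; unfold add_freq, opp_freq; simpl.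
split; intros H; injection H; intros; [f_equal | f_equal]; lia.
Qed.

Lemma torus_int_chi_chi_eq (k : Z * Z) :
  torus_int (fun p => chi k p * chi (opp_freq k) p)%C = RtoC (4 * PI ^ 2).
Proof.
rewrite (torus_int_ext _ (chi (add_freq k (opp_freq k)))) by (intros; now rewrite chi_add).
rewrite (proj2 (add_opp_freq k k) eq_refl). apply torus_int_chi_zero.
Qed.

Lemma torus_int_chi_chi_neq (k l : Z * Z) :
  l <> k -> torus_int (fun p => chi l p * chi (opp_freq k) p)%C = 0%C.
Proof.
intros H.
rewrite (torus_int_ext _ (chi (add_freq l (opp_freq k)))) by (intros; now rewrite chi_add).
apply torus_int_chi. intros E; exact (H (proj1 (add_opp_freq k l) E)).
Qed.

Lemma torus_int_fourier_chi (xi : nat -> Z * Z) (a : nat -> C) (N : nat) :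
  rapid xi a -> injective_freq xi ->
  torus_int (fun p => fourier xi a p * chi (opp_freq (xi N)) p)%C = (RtoC (4 * PI ^ 2) * a N)%C.
Proof.
intros Ha Hinj.
rewrite (torus_int_fourier xi a _ 1); auto using continuousC_chi.
- rewrite (Cseries_single _ N).
  + rewrite torus_int_chi_chi_eq; ring.
  + intros n Hn. rewrite torus_int_chi_chi_neq; [ring |]. intros E; apply Hn, Hinj, E.
- intros p; rewrite Cmod_chi; lra.
Qed.

(** * Uniqueness of Fourier coefficients *)

(** A nonnegative trigonometric polynomial with its maximum at [(a, b)]. *)
Definition bump (a b : R) (p : R * R) : R := 2 + cos (fst p - a) + cos (snd p - b).

Lemma bump_nonneg (a b : R) (p : R * R) : 0 <= bump a b p.
Proof.
unfold bump. generalize (COS_bound (fst p - a)) (COS_bound (snd p - b)); lra.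
Qed.

Lemma cos_le_of_abs_ge (d t : R) :
  0 <= d <= PI -> d <= Rabs t <= 2 * PI - d -> cos t <= cos d.
Proof.
intros Hd Ht.
assert (E : cos t = cos (Rabs t)).
{ unfold Rabs; destruct (Rcase_abs t); [now rewrite cos_neg | reflexivity]. }
rewrite E. destruct (Rle_dec (Rabs t) PI).
- apply cos_decr_1; lra.
- rewrite <- (cos_neg d), <- (cos_period (- d) 1).
  apply cos_incr_1; simpl; lra.
Qed.

Lemma cos_ge_of_abs_le (d t : R) : 0 <= d <= PI -> Rabs t <= d -> cos d <= cos t.
Proof.
intros Hd Ht.
assert (E : cos t = cos (Rabs t)).
{ unfold Rabs; destruct (Rcase_abs t); [now rewrite cos_neg | reflexivity]. }
rewrite E. assert (0 <= Rabs t) by apply Rabs_pos.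
apply cos_decr_1; lra.
Qed.

Lemma pow_ratio_unbounded (q s K : R) : 0 < s < q -> exists N, K * s ^ N < q ^ N.
Proof.
intros [Hs Hq].
assert (H1 : 0 < q / s - 1).
{ apply Rmult_lt_reg_r with s; [lra |]. field_simplify; lra. }
destruct (INR_unbounded (K / (q / s - 1))) as [N HN].
exists N.
assert (E : q ^ N = (1 + (q / s - 1)) ^ N * s ^ N).
{ rewrite <- Rpow_mult_distr. f_equal. field; lra. }
rewrite E. apply Rmult_lt_compat_r; [now apply pow_lt |].
apply Rlt_le_trans with (1 + INR N * (q / s - 1)); [| now apply poly].
apply (Rmult_lt_compat_r (q / s - 1)) in HN; [| exact H1].
unfold Rdiv at 1 in HN. rewrite Rmult_assoc, Rinv_l, Rmult_1_r in HN by lra. lra.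
Qed.

(** The powers of [bump a b] concentrate at [(a, b)]: they are at least [q ^ N] on a
    box around the point and, on the rest of the square, at most [s ^ N] outside a
    larger box, with [s < q]. Were [g] positive at the point, the integrals would
    grow like [q ^ N]. *)
Lemma bump_moments_nonpos (g : R * R -> R) (B a b : R) :
  continuous_plane g -> (forall p, Rabs (g p) <= B) ->
  0 < a < 2 * PI -> 0 < b < 2 * PI ->
  (forall N, int2 (fun p => bump a b p ^ N * g p) = 0) -> g (a, b) <= 0.
Proof.
intros Hg HB Ha Hb Hint.
destruct (Rle_dec (g (a, b)) 0) as [H | H]; [exact H | exfalso].
assert (Heta : 0 < g (a, b) / 2) by lra. set (eta := g (a, b) / 2) in *.
destruct (proj1 (filterlim_locally _ _) (Hg (a, b)) (mkposreal _ Heta)) as [d0 Hd0].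
set (d := Rmin d0 (Rmin 1 (Rmin (Rmin a (2 * PI - a)) (Rmin b (2 * PI - b))))).
assert (Hd : 0 < d).
{ unfold d. repeat apply Rmin_pos; try lra. apply cond_pos. }
assert (Hdle : d <= d0 /\ d <= 1 /\ d <= a /\ d <= 2 * PI - a /\ d <= b /\ d <= 2 * PI - b).
{ unfold d, Rmin. repeat destruct (Rle_dec _ _); lra. }
clearbody d. destruct Hdle as [D0 [D1' [D2' [D3 [D4 D5]]]]].
assert (HPI : 1 < PI) by (generalize PI2_1; lra).
set (s := 3 + cos d). set (q := 2 + 2 * cos (d / 2)).
assert (Hc1 : cos (d / 2) < 1) by (rewrite <- cos_0; apply cos_decreasing_1; lra).
assert (Hc0 : 0 < cos (d / 2)) by (apply cos_gt_0; lra).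
assert (Hcd : cos d = 2 * cos (d / 2) * cos (d / 2) - 1).
{ rewrite <- cos_2a_cos. f_equal; field. }
assert (Hsq : 0 < s < q) by (unfold s, q; rewrite Hcd; split; nra).
assert (HB0 : 0 <= B) by (eapply Rle_trans; [apply Rabs_pos | apply (HB (a, b))]).
assert (Hnear : forall x y, Rabs (x - a) < d -> Rabs (y - b) < d -> eta <= g (x, y)).
{ intros x y Hx Hy.
  assert (Hball : ball (a, b) d0 (x, y)).
  { split; [change (Rabs (x - a) < d0) | change (Rabs (y - b) < d0)]; lra. }
  specialize (Hd0 _ Hball). change (Rabs (g (x, y) - g (a, b)) < eta) in Hd0.
  apply Rabs_def2 in Hd0. unfold eta in *; lra. }
assert (Hfar : forall x y, 0 < x < 2 * PI -> 0 < y < 2 * PI ->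
  ~ (Rabs (x - a) < d /\ Rabs (y - b) < d) -> bump a b (x, y) <= s).
{ intros x y Hx Hy Hn. unfold bump, s; simpl.
  destruct (Rlt_dec (Rabs (x - a)) d) as [L1 | L1].
  - destruct (Rlt_dec (Rabs (y - b)) d) as [L2 | L2]; [tauto |].
    assert (cos (y - b) <= cos d).
    { apply cos_le_of_abs_ge; [lra |]. split; [lra | apply Rabs_le; lra]. }
    generalize (COS_bound (x - a)); lra.
  - assert (cos (x - a) <= cos d).
    { apply cos_le_of_abs_ge; [lra |]. split; [lra | apply Rabs_le; lra]. }
    generalize (COS_bound (y - b)); lra. }
assert (Cb : forall N, continuous_plane (fun p => bump a b p ^ N)).
{ assert (C1 : continuous_plane (bump a b)).
  { intros p. unfold bump.
    apply (continuous_plus (V := R_NormedModule) (fun p => 2 + cos (fst p - a)) (fun p => cos (snd p - b))).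
    - apply (continuous_plus (V := R_NormedModule) (fun p => 2) (fun p => cos (fst p - a))).
      + apply continuous_const.
      + apply (continuous_comp (fun p : R * R => fst p - a) cos); [| apply continuous_cos].
        apply (continuous_minus (V := R_NormedModule) (fun p : R * R => fst p) (fun _ => a)).
        * destruct p; apply continuous_fst.
        * apply continuous_const.
    - apply (continuous_comp (fun p : R * R => snd p - b) cos); [| apply continuous_cos].
      apply (continuous_minus (V := R_NormedModule) (fun p : R * R => snd p) (fun _ => b)).
      * destruct p; apply continuous_snd.
      * apply continuous_const. }
  induction N as [|N IH]; simpl.
  - intros p; apply continuous_const.
  - now apply continuous_plane_mult. }
assert (Cc : forall c : R, continuous_plane (fun _ => c)) by (intros c p; apply continuous_const).
assert (Main : forall N, eta * (d * d) * q ^ N <= 4 * PI ^ 2 * (B + eta) * s ^ N).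
{ intros N.
  assert (L1 : q ^ N * (2 * (d / 2)) * (2 * (d / 2)) <= int2 (fun p => bump a b p ^ N)).
  { apply int2_ge_box with a b; auto; try lra.
    - apply pow_le; lra.
    - intros p; apply pow_le, bump_nonneg.
    - intros x y Hx Hy. apply pow_incr. split; [lra |].
      unfold q, bump; simpl.
      assert (cos (d / 2) <= cos (x - a)) by (apply cos_ge_of_abs_le; lra).
      assert (cos (d / 2) <= cos (y - b)) by (apply cos_ge_of_abs_le; lra).
      lra. }
  assert (L2 : int2 (fun p => eta * bump a b p ^ N + - ((B + eta) * s ^ N)) <=
               int2 (fun p => bump a b p ^ N * g p)).
  { apply int2_le.
    - apply continuous_plane_plus; auto. now apply continuous_plane_scal.
    - now apply continuous_plane_mult.
    - intros x y Hx Hy.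
      assert (P0 : 0 <= bump a b (x, y) ^ N) by apply pow_le, bump_nonneg.
      assert (S0 : 0 <= s ^ N) by (apply pow_le; lra).
      destruct (Rlt_dec (Rabs (x - a)) d) as [L | L];
      [destruct (Rlt_dec (Rabs (y - b)) d) as [L' | L'] |].
      + specialize (Hnear x y L L'). nra.
      + assert (P1 : bump a b (x, y) ^ N <= s ^ N).
        { apply pow_incr; split; [apply bump_nonneg |]. apply Hfar; tauto. }
        generalize (HB (x, y)); intros HBx. apply Rabs_le_between in HBx. nra.
      + assert (P1 : bump a b (x, y) ^ N <= s ^ N).
        { apply pow_incr; split; [apply bump_nonneg |]. apply Hfar; tauto. }
        generalize (HB (x, y)); intros HBx. apply Rabs_le_between in HBx. nra. }
  rewrite Hint, int2_plus, int2_scal, int2_const in L2; auto using continuous_plane_scal.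
  assert (q ^ N * (d * d) <= int2 (fun p => bump a b p ^ N)).
  { eapply Rle_trans; [| exact L1]. right; field. }
  nra. }
destruct (pow_ratio_unbounded q s (4 * PI ^ 2 * (B + eta) / (eta * (d * d))) Hsq) as [N HN].
specialize (Main N).
assert (He : 0 < eta * (d * d)) by (apply Rmult_lt_0_compat; nra).
apply (Rmult_lt_compat_l _ _ _ He) in HN.
replace (eta * (d * d) * (4 * PI ^ 2 * (B + eta) / (eta * (d * d)) * s ^ N))
  with (4 * PI ^ 2 * (B + eta) * s ^ N) in HN by (field; lra).
lra.
Qed.

Definition all_coefficients_zero (f : R * R -> C) : Prop :=
  continuousC f /\ forall k, torus_int (fun p => chi k p * f p)%C = 0%C.

Lemma all_coefficients_zero_scal (c : C) (f : R * R -> C) :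
  all_coefficients_zero f -> all_coefficients_zero (fun p => c * f p)%C.
Proof.
intros [Hf H0]; split; [now apply continuousC_scal |]. intros k.
rewrite (torus_int_ext _ (fun p => c * (chi k p * f p))%C) by (intros; ring).
rewrite torus_int_scal, H0 by (apply continuousC_mult; auto using continuousC_chi).
ring.
Qed.

Lemma all_coefficients_zero_plus (f g : R * R -> C) :
  all_coefficients_zero f -> all_coefficients_zero g ->
  all_coefficients_zero (fun p => f p + g p)%C.
Proof.
intros [Hf F0] [Hg G0]; split; [now apply continuousC_plus |]. intros k.
rewrite (torus_int_ext _ (fun p => chi k p * f p + chi k p * g p)%C) by (intros; ring).
rewrite torus_int_plus, F0, G0 by (apply continuousC_mult; auto using continuousC_chi).
ring.
Qed.

Lemma all_coefficients_zero_chi (l : Z * Z) (f : R * R -> C) :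
  all_coefficients_zero f -> all_coefficients_zero (fun p => chi l p * f p)%C.
Proof.
intros [Hf F0]; split; [apply continuousC_mult; auto using continuousC_chi |]. intros k.
rewrite (torus_int_ext _ (fun p => chi (add_freq k l) p * f p)%C)
  by (intros; rewrite chi_add; ring).
apply F0.
Qed.

Lemma bump_chi (a b : R) (p : R * R) :
  RtoC (bump a b p) =
  (2 * chi (0, 0)%Z p +
   (/ 2 * (cos a, (- sin a)%R) * chi (1, 0)%Z p + / 2 * (cos a, sin a) * chi (-1, 0)%Z p) +
   (/ 2 * (cos b, (- sin b)%R) * chi (0, 1)%Z p + / 2 * (cos b, sin b) * chi (0, -1)%Z p))%C.
Proof.
assert (E : forall u v, (/ 2 * (cos u, (- sin u)%R) * (cos v, sin v) +
   / 2 * (cos u, sin u) * (cos (- v), sin (- v)))%C = RtoC (cos (v - u))).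
{ intros u v. rewrite cos_minus, cos_neg, sin_neg.
  apply C_eq; simpl; field. }
rewrite chi_zero. unfold chi.
replace (phase (1, 0)%Z p) with (fst p) by (unfold phase; simpl; ring).
replace (phase (-1, 0)%Z p) with (- fst p) by (unfold phase; simpl; ring).
replace (phase (0, 1)%Z p) with (snd p) by (unfold phase; simpl; ring).
replace (phase (0, -1)%Z p) with (- snd p) by (unfold phase; simpl; ring).
rewrite !E. unfold bump. rewrite !RtoC_plus. ring.
Qed.

(** Multiplication by a character only permutes the Fourier coefficients, and
    [bump a b] is a combination of five characters. *)
Lemma all_coefficients_zero_bump (a b : R) (f : R * R -> C) :
  all_coefficients_zero f -> all_coefficients_zero (fun p => RtoC (bump a b p) * f p)%C.
Proof.
intros Hf.
assert (H : forall c l, all_coefficients_zero (fun p => c * (chi l p * f p))%C).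
{ intros; now apply all_coefficients_zero_scal, all_coefficients_zero_chi. }
eassert (H' : all_coefficients_zero _).
{ exact (all_coefficients_zero_plus _ _ (H 2%C (0, 0)%Z) (all_coefficients_zero_plus _ _
   (all_coefficients_zero_plus _ _ (H (/ 2 * (cos a, (- sin a)%R))%C (1, 0)%Z)
      (H (/ 2 * (cos a, sin a))%C (-1, 0)%Z))
   (all_coefficients_zero_plus _ _ (H (/ 2 * (cos b, (- sin b)%R))%C (0, 1)%Z)
      (H (/ 2 * (cos b, sin b))%C (0, -1)%Z)))). }
replace (fun p => RtoC (bump a b p) * f p)%C with
  (fun p => 2 * (chi (0, 0)%Z p * f p) +
   ((/ 2 * (cos a, (- sin a)%R) * (chi (1, 0)%Z p * f p) +
     / 2 * (cos a, sin a) * (chi (-1, 0)%Z p * f p)) +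
    (/ 2 * (cos b, (- sin b)%R) * (chi (0, 1)%Z p * f p) +
     / 2 * (cos b, sin b) * (chi (0, -1)%Z p * f p))))%C; [exact H' |].
apply functional_extensionality; intros p. rewrite bump_chi. ring.
Qed.

Lemma coefficients_zero_Re_nonpos (f : R * R -> C) (B a b : R) :
  all_coefficients_zero f -> (forall p, Cmod (f p) <= B) ->
  0 < a < 2 * PI -> 0 < b < 2 * PI -> Re (f (a, b)) <= 0.
Proof.
intros Hf HB Ha Hb.
assert (HN : forall N, all_coefficients_zero (fun p => RtoC (bump a b p ^ N) * f p)%C).
{ induction N as [|N IH].
  - replace (fun p => RtoC (bump a b p ^ 0) * f p)%C with f; [exact Hf |].
    apply functional_extensionality; intros p; simpl; ring.
  - apply (all_coefficients_zero_bump a b) in IH.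
    replace (fun p => RtoC (bump a b p ^ S N) * f p)%C with
      (fun p => RtoC (bump a b p) * (RtoC (bump a b p ^ N) * f p))%C; [exact IH |].
    apply functional_extensionality; intros p; simpl; rewrite RtoC_mult; ring. }
apply (bump_moments_nonpos (fun p => Re (f p)) B a b); auto.
- apply continuousC_iff, Hf.
- intros p; eapply Rle_trans; [apply re_le_Cmod | apply HB].
- intros N. destruct (HN N) as [HC H0]. specialize (H0 (0, 0)%Z).
  rewrite (torus_int_ext _ (fun p => RtoC (bump a b p ^ N) * f p)%C) in H0
    by (intros; rewrite chi_zero; ring).
  rewrite torus_int_eq in H0 by exact HC. injection H0 as H1 _.
  rewrite <- H1 at 1. apply int2_ext; intros p; unfold Re, Im; simpl; ring.
Qed.

Lemma periodic_line_zero (h : R -> C) :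
  (forall x, continuous (fun t => Re (h t)) x) -> (forall x, continuous (fun t => Im (h t)) x) ->
  (forall x, h (x + 2 * PI) = h x) ->
  (forall x, 0 < x < 2 * PI -> h x = 0%C) -> forall x, h x = 0%C.
Proof.
intros Hr Hi Hp H0.
assert (H2 := two_PI_pos).
assert (Hn : forall n x, h (x + 2 * PI * INR n) = h x).
{ induction n as [|n IH]; intros x.
  - simpl; f_equal; ring.
  - rewrite S_INR. replace (x + 2 * PI * (INR n + 1)) with (x + 2 * PI * INR n + 2 * PI) by ring.
    now rewrite Hp. }
assert (Hz : forall k x, h (x + 2 * PI * IZR k) = h x).
{ intros k x. destruct (Z_le_gt_dec 0 k).
  - rewrite <- (Z2Nat.id k), <- INR_IZR_INZ by lia. apply Hn.
  - rewrite <- (Hn (Z.to_nat (- k)) (x + 2 * PI * IZR k)).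
    rewrite INR_IZR_INZ, Z2Nat.id, opp_IZR by lia. f_equal; ring. }
assert (R0 : forall g : R -> R, continuous g 0 -> (forall x, 0 < x < 2 * PI -> g x = 0) -> g 0 = 0).
{ intros g Hg Hg0. destruct (Req_dec (g 0) 0) as [E | E]; [exact E | exfalso].
  assert (He : 0 < Rabs (g 0)) by now apply Rabs_pos_lt.
  destruct (proj1 (filterlim_locally _ _) Hg (mkposreal _ He)) as [d Hd].
  assert (Hd0 := cond_pos d).
  set (t := Rmin (d / 2) PI).
  assert (Ht : 0 < t) by (apply Rmin_pos; lra).
  assert (t <= d / 2) by apply Rmin_l. assert (t <= PI) by apply Rmin_r.
  assert (Hb : ball 0 d t).
  { change (Rabs (t - 0) < d). rewrite Rminus_0_r, Rabs_pos_eq; lra. }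
  specialize (Hd _ Hb). change (Rabs (g t - g 0) < Rabs (g 0)) in Hd.
  rewrite (Hg0 t) in Hd by lra. rewrite Rminus_0_l, Rabs_Ropp in Hd. lra. }
assert (H00 : h 0 = 0%C).
{ apply C_eq; simpl.
  - apply (R0 (fun t => Re (h t))); auto. intros x Hx; now rewrite H0.
  - apply (R0 (fun t => Im (h t))); auto. intros x Hx; now rewrite H0. }
intros x.
destruct (base_Int_part (x / (2 * PI))) as [I1 I2].
set (k := Int_part (x / (2 * PI))) in *.
rewrite <- (Hz (- k)%Z x), opp_IZR.
set (y := x + 2 * PI * - IZR k).
assert (Ey : y = 2 * PI * (x / (2 * PI) - IZR k)) by (unfold y; field; lra).
assert (Hy : 0 <= y < 2 * PI).
{ rewrite Ey; split; [apply Rmult_le_pos; lra |].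
  apply Rlt_le_trans with (2 * PI * 1); [apply Rmult_lt_compat_l |]; lra. }
destruct (Req_dec y 0) as [-> | Hy0]; [exact H00 |]. apply H0; lra.
Qed.

(** On the open square, apply the sign lemma to [f], [- f], [i f] and [- i f];
    continuity and periodicity do the rest. *)
Theorem coefficients_zero_eq_zero (f : R * R -> C) (B : R) :
  all_coefficients_zero f -> periodic f -> (forall p, Cmod (f p) <= B) ->
  forall p, f p = 0%C.
Proof.
intros Hf Hp HB.
assert (Hin : forall a b, 0 < a < 2 * PI -> 0 < b < 2 * PI -> f (a, b) = 0%C).
{ intros a b Ha Hb.
  assert (H : forall c, Cmod c = 1 -> Re (c * f (a, b))%C <= 0).
  { intros c Hc.
    assert (HcB : forall p, Cmod (c * f p)%C <= B)
      by (intros p; rewrite Cmod_mult, Hc, Rmult_1_l; apply HB).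
    exact (coefficients_zero_Re_nonpos _ B a b (all_coefficients_zero_scal c f Hf) HcB Ha Hb). }
  assert (K1 := H 1%C Cmod_1). assert (K2 := H (- (1))%C Cmod_m1).
  assert (K3 := H Ci Cmod_Ci).
  assert (K4 := H (- Ci)%C ltac:(now rewrite Cmod_opp, Cmod_Ci)).
  unfold Re in *; simpl in *. apply C_eq; unfold Re, Im; simpl; lra. }
destruct Hf as [Hc _]. apply continuousC_iff in Hc. destruct Hc as [C1 C2].
assert (Hy : forall a, 0 < a < 2 * PI -> forall y, f (a, y) = 0%C).
{ intros a Ha. apply (periodic_line_zero (fun y => f (a, y))); auto.
  - intros y; apply (continuous_section2 (fun p => Re (f p))), C1.
  - intros y; apply (continuous_section2 (fun p => Im (f p))), C2.
  - intros y; apply Hp. }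
intros [x y]. apply (periodic_line_zero (fun t => f (t, y))); auto.
- intros t; apply (continuous_section1 (fun p => Re (f p))), C1.
- intros t; apply (continuous_section1 (fun p => Im (f p))), C2.
- intros t; apply Hp.
Qed.

(** * Fourier inversion *)

Definition coefficient (xi : nat -> Z * Z) (f : R * R -> C) (n : nat) : C :=
  (/ RtoC (4 * PI ^ 2) * torus_int (fun p => chi (opp_freq (xi n)) p * f p))%C.

Lemma four_PI2_neq_0 : RtoC (4 * PI ^ 2) <> 0%C.
Proof.
intros H. apply RtoC_inj in H. generalize PI_RGT_0; intros. nra.
Qed.

Lemma opp_freq_involutive (k : Z * Z) : opp_freq (opp_freq k) = k.
Proof. destruct k; unfold opp_freq; simpl; now rewrite !Z.opp_involutive. Qed.

(** The function and the sum of its Fourier series have the same coefficients. *)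
Theorem fourier_inversion (xi : nat -> Z * Z) (f : R * R -> C) (B : R) :
  injective_freq xi -> (forall k, exists n, xi n = k) ->
  smooth_torus f -> (forall p, Cmod (f p) <= B) -> rapid xi (coefficient xi f) ->
  f = fourier xi (coefficient xi f).
Proof.
intros Hinj Hsurj Hf HB Hr.
set (a := coefficient xi f) in *.
assert (Cf := smooth_torus_continuous f Hf).
assert (CF := continuousC_fourier xi a Hr).
assert (H0 : forall p, (f p + - (1) * fourier xi a p)%C = 0%C).
{ apply (coefficients_zero_eq_zero _ (B + 2 * Series (fun n => Cmod (a n)))).
  - split; [apply continuousC_plus; [exact Cf | now apply continuousC_scal] |].
    intros k. destruct (Hsurj (opp_freq k)) as [n Hn].
    rewrite (torus_int_ext _ (fun p => chi k p * f p + - (1) * (fourier xi a p * chi k p))%C)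
      by (intros; ring).
    assert (H1 : continuousC (fun p => chi k p * f p)%C)
      by (apply continuousC_mult; [apply continuousC_chi | exact Cf]).
    assert (H2 : continuousC (fun p => fourier xi a p * chi k p)%C)
      by (apply continuousC_mult; [exact CF | apply continuousC_chi]).
    rewrite torus_int_plus, torus_int_scal; [| exact H2 | exact H1 | now apply continuousC_scal].
    rewrite <- (opp_freq_involutive k), <- Hn.
    rewrite torus_int_fourier_chi by assumption.
    unfold a, coefficient. field. apply four_PI2_neq_0.
  - intros x y. destruct (proj1 Hf x y) as [-> ->].
    destruct (periodic_fourier xi a x y) as [-> ->]. now split.
  - intros p. eapply Rle_trans; [apply Cmod_triangle |].
    rewrite Cmod_mult, Cmod_m1, Rmult_1_l. apply Rplus_le_compat; [apply HB |].
    apply fourier_le; [intros; apply Rle_refl | now apply (rapid_abs_summable xi)]. }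
apply functional_extensionality; intros p.
transitivity ((f p + - (1) * fourier xi a p) + fourier xi a p)%C; [ring |].
rewrite H0; ring.
Qed.

(** * Enumeration of the frequencies *)

(** The growth bound says that the [n]-th frequency has size at least about
    [sqrt n], so that four powers of the frequency pay for the summable weight
    [1 / (n + 1) ^ 2]. Keeping the enumeration a variable allows one to expand along
    the opposite frequencies. *)
Definition enumerates (xi : nat -> Z * Z) : Prop :=
  injective_freq xi /\ (forall k, exists n, xi n = k) /\
  exists K, 0 < K /\ forall n, (INR n + 1) ^ 2 <= K * (1 + freq_norm (xi n) ^ 4).

Definition zigzag (n : nat) : Z :=
  if Nat.even n then Z.of_nat (Nat.div2 n) else (- Z.of_nat (Nat.div2 n) - 1)%Z.

Definition unzigzag (k : Z) : nat :=
  if (0 <=? k)%Z then (2 * Z.to_nat k)%nat else (2 * Z.to_nat (- k - 1) + 1)%nat.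

Lemma unzigzag_zigzag (n : nat) : unzigzag (zigzag n) = n.
Proof.
unfold unzigzag, zigzag.
assert (E := Nat.div2_odd n). rewrite <- Nat.negb_even in E.
destruct (Nat.even n); simpl in E.
- destruct (Z.leb_spec 0 (Z.of_nat (Nat.div2 n))); lia.
- destruct (Z.leb_spec 0 (- Z.of_nat (Nat.div2 n) - 1)); lia.
Qed.

Lemma zigzag_unzigzag (k : Z) : zigzag (unzigzag k) = k.
Proof.
unfold unzigzag, zigzag. destruct (Z.leb_spec 0 k).
- replace (2 * Z.to_nat k)%nat with (0 + 2 * Z.to_nat k)%nat by lia.
  rewrite Nat.even_add_mul_2. simpl Nat.even. cbv iota.
  rewrite Nat.add_0_l, Nat.div2_double. lia.
- rewrite Nat.add_comm, Nat.even_add_mul_2. simpl Nat.even. cbv iota.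
  rewrite Nat.add_comm, Nat.add_1_r, Nat.div2_succ_double. lia.
Qed.

Lemma unzigzag_le (k : Z) : INR (unzigzag k) <= 2 * Rabs (IZR k).
Proof.
rewrite INR_IZR_INZ, <- abs_IZR, <- mult_IZR. apply IZR_le.
unfold unzigzag. destruct (Z.leb_spec 0 k); lia.
Qed.

Definition freq (n : nat) : Z * Z :=
  (zigzag (fst (of_nat n)), zigzag (snd (of_nat n))).

Lemma freq_index (n : nat) : to_nat (unzigzag (fst (freq n)), unzigzag (snd (freq n))) = n.
Proof.
unfold freq; cbn [fst snd]. rewrite !unzigzag_zigzag.
transitivity (to_nat (of_nat n)); [f_equal; now destruct (of_nat n) | apply cancel_to_of].
Qed.

(** Cantor's pairing of [x] and [y] is at most [(x + y + 1) ^ 2]. *)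
Lemma enumerates_freq : enumerates freq.
Proof.
split; [| split].
- intros n n' E. rewrite <- (freq_index n), <- (freq_index n'), E. reflexivity.
- intros [k l]. exists (to_nat (unzigzag k, unzigzag l)).
  unfold freq. rewrite cancel_of_to; simpl. now rewrite !zigzag_unzigzag.
- exists 2048; split; [lra |]. intros n.
  assert (Hn := freq_index n).
  set (t := freq_norm (freq n)).
  assert (Ht : 0 <= t) by apply freq_norm_pos.
  assert (H1 : INR (unzigzag (fst (freq n))) <= 2 * t).
  { eapply Rle_trans; [apply unzigzag_le |]. apply Rmult_le_compat_l; [lra | apply Rmax_l]. }
  assert (H2 : INR (unzigzag (snd (freq n))) <= 2 * t).
  { eapply Rle_trans; [apply unzigzag_le |]. apply Rmult_le_compat_l; [lra | apply Rmax_r]. }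
  set (x := unzigzag (fst (freq n))) in *. set (y := unzigzag (snd (freq n))) in *.
  assert (Hxy : (n <= (x + y + 1) * (x + y + 1))%nat).
  { generalize (to_nat_spec x y); rewrite Hn; nia. }
  apply le_INR in Hxy. rewrite mult_INR, !plus_INR in Hxy. simpl in Hxy.
  assert (Hx0 := pos_INR x). assert (Hy0 := pos_INR y). assert (Hn0 := pos_INR n).
  assert (Hsq : (INR x + INR y + 1) * (INR x + INR y + 1) <= (4 * t + 1) * (4 * t + 1))
    by (apply Rmult_le_compat; lra).
  assert (B1 : INR n + 1 <= 32 * (t ^ 2 + 1)) by nra.
  assert (B2 : (INR n + 1) ^ 2 <= (32 * (t ^ 2 + 1)) ^ 2) by (apply pow_incr; lra).
  assert (0 <= (t ^ 2 - 1) ^ 2) by apply pow2_ge_0.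
  nra.
Qed.

Lemma enumerates_opp (xi : nat -> Z * Z) :
  enumerates xi -> enumerates (fun n => opp_freq (xi n)).
Proof.
intros [H1 [H2 [K [HK H3]]]]. split; [| split].
- intros n n' E. apply H1. rewrite <- (opp_freq_involutive (xi n)), E.
  apply opp_freq_involutive.
- intros k. destruct (H2 (opp_freq k)) as [n Hn]. exists n.
  rewrite Hn; apply opp_freq_involutive.
- exists K; split; [exact HK |]. intros n; rewrite freq_norm_opp; apply H3.
Qed.

Lemma ex_series_inv_sq : ex_series (fun n => / (INR n + 1) ^ 2).
Proof.
apply ex_series_le_R with (fun n => 2 * (/ (INR n + 1) - / (INR n + 2))).
- intros n. assert (H := pos_INR n).
  rewrite Rabs_pos_eq by (left; apply Rinv_0_lt_compat, pow_lt; lra).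
  replace (2 * (/ (INR n + 1) - / (INR n + 2))) with (/ ((INR n + 1) * (INR n + 2) / 2))
    by (field; lra).
  apply Rinv_le_contravar; [apply Rdiv_lt_0_compat; nra | simpl; nra].
- apply ex_series_scal_R. exists 1.
  assert (E : forall n, sum_n (fun n => / (INR n + 1) - / (INR n + 2)) n = 1 - / (INR n + 2)).
  { induction n as [|n IH].
    - rewrite sum_O; simpl; field.
    - rewrite sum_Sn, IH, S_INR. unfold plus; simpl. assert (H := pos_INR n). field. lra. }
  change (is_lim_seq (sum_n (fun n => / (INR n + 1) - / (INR n + 2))) 1).
  apply is_lim_seq_ext with (fun n => 1 - / (INR n + 2)); [intros; now rewrite E |].
  assert (L : is_lim_seq (fun n => / (INR n + 2)) 0).
  { replace (Finite 0) with (Rbar_inv p_infty) by reflexivity.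
    apply is_lim_seq_inv; [| discriminate].
    eapply is_lim_seq_plus; [apply is_lim_seq_INR | apply is_lim_seq_const | reflexivity]. }
  generalize (is_lim_seq_minus' _ _ _ _ (is_lim_seq_const 1) L). now rewrite Rminus_0_r.
Qed.

(** * Weights *)

Definition weight (m : nat -> R) (h : R) (k : nat) : R := h ^ k * m k * INR (fact k).

Lemma weight_pos (m : nat -> R) (h : R) (k : nat) :
  weight_sequence m -> 0 < h -> 0 < weight m h k.
Proof.
intros [Hm _] Hh. unfold weight.
repeat apply Rmult_lt_0_compat; auto using pow_lt, INR_fact_lt_0.
Qed.

Lemma weight_le (m : nat -> R) (h h' : R) (k : nat) :
  weight_sequence m -> 0 < h -> h <= h' -> weight m h k <= weight m h' k.
Proof.
intros [Hm _] Hh Hle. unfold weight.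
repeat apply Rmult_le_compat_r; [apply pos_INR | left; apply Hm |].
apply pow_incr; lra.
Qed.

(** By logarithmic convexity the ratios of consecutive terms increase, and the first
    of them is 1. *)
Lemma weight_sequence_ge_1 (m : nat -> R) : weight_sequence m -> forall n, 1 <= m n.
Proof.
intros [Hpos [H0 [H1 [Hc _]]]].
assert (Hmono : forall n, 1 <= m n /\ m n <= m (S n)).
{ induction n as [|n [IH1 IH2]]; [lra |].
  split; [lra |]. specialize (Hc (S n) ltac:(lia)).
  replace (S n - 1)%nat with n in Hc by lia. replace (S n + 1)%nat with (S (S n)) in Hc by lia.
  assert (P := Hpos n). assert (P2 := Hpos (S (S n))).
  apply Rmult_le_reg_l with (m n); [exact P |]. nra. }
intros n; apply Hmono.
Qed.

Lemma fact_plus_le (n : nat) : forall j k, (j + k = n)%nat ->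
  INR (fact n) <= 2 ^ n * (INR (fact j) * INR (fact k)).
Proof.
induction n as [|n IH]; intros j k E.
- assert (j = 0%nat) by lia. assert (k = 0%nat) by lia. subst; simpl; lra.
- assert (P2 : 1 <= 2 ^ S n) by (apply pow_R1_Rle; lra).
  assert (F := INR_fact_lt_0 (S n)).
  destruct j as [|j]; [| destruct k as [|k]].
  + assert (k = S n) by lia; subst k. change (INR (fact 0)) with 1. nra.
  + assert (j = n) by lia; subst j. change (INR (fact 0)) with 1. nra.
  + assert (I1 := IH j (S k) ltac:(lia)). assert (I2 := IH (S j) k ltac:(lia)).
    assert (En : INR (S n) = INR (S j) + INR (S k)) by (rewrite <- plus_INR; f_equal; lia).
    assert (Fs : forall i, INR (fact (S i)) = INR (S i) * INR (fact i))
      by (intros; rewrite fact_simpl, mult_INR; reflexivity).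
    rewrite (Fs n), En, Rmult_plus_distr_r.
    apply (Rmult_le_compat_l (INR (S j))) in I1; [| apply pos_INR].
    apply (Rmult_le_compat_l (INR (S k))) in I2; [| apply pos_INR].
    apply Rle_trans with (INR (S j) * (2 ^ n * (INR (fact j) * INR (fact (S k)))) +
       INR (S k) * (2 ^ n * (INR (fact (S j)) * INR (fact k)))); [lra |].
    right. rewrite !Fs. simpl pow. ring.
Qed.

(** The factor [2] comes from the binomial coefficient of [j + k] and [j], which is at
    most [2 ^ (j + k)]. *)
Lemma weight_plus_le (m : nat -> R) (H h : R) (j k : nat) :
  weight_sequence m -> 0 < H -> 0 < h ->
  (forall j k : nat, m (j + k)%nat <= H ^ (j + k) * m j * m k) ->
  weight m h (j + k) <= weight m (2 * H * h) j * weight m (2 * H * h) k.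
Proof.
intros [Hm _] HH Hh HG. unfold weight.
assert (G := HG j k). assert (F := fact_plus_le (j + k) j k eq_refl).
assert (Mj := Hm j). assert (Mk := Hm k). assert (Mjk := Hm (j + k)%nat).
assert (Ph : 0 < h ^ (j + k)) by now apply pow_lt.
apply Rle_trans with (h ^ (j + k) * (H ^ (j + k) * m j * m k) *
  (2 ^ (j + k) * (INR (fact j) * INR (fact k)))).
- apply Rmult_le_compat; [nra | left; apply INR_fact_lt_0 | | exact F].
  apply Rmult_le_compat_l; lra.
- right. rewrite !Rpow_mult_distr, !pow_add. ring.
Qed.

Lemma weight_moderate (m : nat -> R) :
  weight_sequence m -> exists G, 1 <= G /\
    forall h j k, 0 < h -> weight m h (j + k) <= weight m (G * h) j * weight m (G * h) k.
Proof.
intros Hw. destruct Hw as [Hm [H0 [H1 [Hc [H [HH HG]]]]]].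
exists (2 * H); split; [lra |]. intros h j k Hh.
apply weight_plus_le; try lra; [| exact HG].
repeat split; auto. exists H; auto.
Qed.

(** Four additional derivatives buy summability over the frequencies, and moderate
    growth of the weights absorbs them into a larger [h]. The constants do not depend
    on the sequence that is estimated, so that the lemma also bounds norms. *)
Lemma weight_gain (m : nat -> R) (xi : nat -> Z * Z) :
  weight_sequence m -> enumerates xi -> forall h, 0 < h ->
  exists K h', 0 < K /\ h <= h' /\
    forall (A c : R) (n : nat), 0 <= c ->
      (forall k, c * freq_norm (xi n) ^ k <= A * weight m h k) ->
      forall k, c * freq_norm (xi n) ^ k <= K * A * weight m h' k * / (INR n + 1) ^ 2.
Proof.
intros Hm [_ [_ [K [HK Hxi]]]] h Hh.
destruct (weight_moderate m Hm) as [G [HG Hmod]].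
assert (HhG : h <= G * h) by nra.
assert (W4 := weight_pos m (G * h) 4 Hm ltac:(lra)).
exists (K * (1 + weight m (G * h) 4)), (G * h). split; [| split; [exact HhG |]].
- apply Rmult_lt_0_compat; lra.
- intros A c n Hc Hdec k.
  assert (Hn : 0 < (INR n + 1) ^ 2) by (apply pow_lt; generalize (pos_INR n); lra).
  apply Rmult_le_reg_r with ((INR n + 1) ^ 2); [exact Hn |].
  rewrite (Rmult_assoc _ (/ _)), Rinv_l, Rmult_1_r by lra.
  assert (HA : 0 <= A).
  { generalize (Hdec 0%nat) (weight_pos m h 0 Hm Hh). simpl. intros. nra. }
  assert (Hx := pow_le _ k (freq_norm_pos (xi n))).
  apply Rle_trans with (c * freq_norm (xi n) ^ k * (K * (1 + freq_norm (xi n) ^ 4))).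
  { apply Rmult_le_compat_l; [now apply Rmult_le_pos | apply Hxi]. }
  apply Rle_trans with (K * (A * weight m (G * h) k + A * (weight m (G * h) k * weight m (G * h) 4)));
    [| right; ring].
  replace (c * freq_norm (xi n) ^ k * (K * (1 + freq_norm (xi n) ^ 4)))
    with (K * (c * freq_norm (xi n) ^ k + c * freq_norm (xi n) ^ (k + 4)))
    by (rewrite pow_add; ring).
  apply Rmult_le_compat_l; [lra |]. apply Rplus_le_compat.
  + eapply Rle_trans; [apply Hdec |]. apply Rmult_le_compat_l; [exact HA |].
    now apply weight_le.
  + eapply Rle_trans; [apply Hdec |]. apply Rmult_le_compat_l; [exact HA |].
    now apply Hmod.
Qed.

(** * Ultradifferentiable functions through their Fourier coefficients *)

Definition decay (m : nat -> R) (xi : nat -> Z * Z) (a : nat -> C) : Prop :=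
  exists A h, 0 < A /\ 0 < h /\
    forall n k, Cmod (a n) * freq_norm (xi n) ^ k <= A * weight m h k.

Definition strong_decay (m : nat -> R) (xi : nat -> Z * Z) (a : nat -> C) (A h : R) : Prop :=
  forall n k, Cmod (a n) * freq_norm (xi n) ^ k <= A * weight m h k * / (INR n + 1) ^ 2.

Lemma decay_strong (m : nat -> R) (xi : nat -> Z * Z) (a : nat -> C) :
  weight_sequence m -> enumerates xi -> decay m xi a ->
  exists A h, 0 < A /\ 0 < h /\ strong_decay m xi a A h.
Proof.
intros Hm Hxi [A [h [HA [Hh Hd]]]].
destruct (weight_gain m xi Hm Hxi h Hh) as [K [h' [HK [Hh' G]]]].
exists (K * A), h'. split; [nra | split; [lra |]].
intros n k. apply G; [apply Cmod_ge_0 | intros; apply Hd].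
Qed.

Lemma strong_decay_rapid (m : nat -> R) (xi : nat -> Z * Z) (a : nat -> C) (A h : R) :
  strong_decay m xi a A h -> rapid xi a.
Proof.
intros Hd k. apply ex_series_le_R with (fun n => A * weight m h k * / (INR n + 1) ^ 2).
- intros n. rewrite Rabs_pos_eq; [apply Hd |].
  apply Rmult_le_pos; [apply Cmod_ge_0 | apply pow_le, freq_norm_pos].
- apply ex_series_scal_R, ex_series_inv_sq.
Qed.

Lemma decay_rapid (m : nat -> R) (xi : nat -> Z * Z) (a : nat -> C) :
  weight_sequence m -> enumerates xi -> decay m xi a -> rapid xi a.
Proof.
intros Hm Hxi Hd. destruct (decay_strong m xi a Hm Hxi Hd) as [A [h [_ [_ H]]]].
now apply (strong_decay_rapid m xi a A h).
Qed.

Lemma Dgamma_fourier_tail_le (m : nat -> R) (xi : nat -> Z * Z) (a : nat -> C) (A h : R)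
    (N : nat) (g : nat * nat) (p : R * R) :
  strong_decay m xi a A h ->
  Cmod (Dgamma g (fourier xi (tail N a)) p) <=
    2 * A * weight m h (order g) * Series (Rtail N (fun n => / (INR n + 1) ^ 2)).
Proof.
intros Hd.
rewrite Dgamma_fourier by (eapply rapid_tail, strong_decay_rapid, Hd).
eapply Rle_trans.
- apply (fourier_le _ _ (fun n => A * weight m h (order g) * Rtail N (fun n => / (INR n + 1) ^ 2) n)).
  + intros n. eapply Rle_trans; [apply Cmod_multg_le |].
    unfold tail, Rtail. destruct (n <? N)%nat.
    * rewrite Cmod_0; lra.
    * apply Hd.
  + apply ex_series_scal_R, ex_series_Rtail, ex_series_inv_sq.
- rewrite Series_scal_l; lra.
Qed.

Lemma fourier_tail_0 (xi : nat -> Z * Z) (a : nat -> C) :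
  fourier xi (tail 0 a) = fourier xi a.
Proof. apply fourier_ext; intros n; reflexivity. Qed.

Lemma EM_fourier (m : nat -> R) (xi : nat -> Z * Z) (a : nat -> C) :
  weight_sequence m -> enumerates xi -> decay m xi a -> EM m (fourier xi a).
Proof.
intros Hm Hxi Hd. destruct (decay_strong m xi a Hm Hxi Hd) as [A [h [HA [Hh H]]]].
split; [apply smooth_torus_fourier; eapply strong_decay_rapid, H |].
set (S := Series (Rtail 0 (fun n => / (INR n + 1) ^ 2))).
assert (HS : 0 <= S).
{ apply Series_nonneg; [| apply ex_series_Rtail, ex_series_inv_sq].
  intros n; unfold Rtail; simpl. left. apply Rinv_0_lt_compat.
  change (0 < (INR n + 1) ^ 2). apply pow_lt; generalize (pos_INR n); lra. }
exists (2 * A * S + 1), h. split; [nra | split; [exact Hh |]].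
intros p g. rewrite <- fourier_tail_0.
eapply Rle_trans; [apply (Dgamma_fourier_tail_le m xi a A h 0 g p H) |]. fold S.
assert (W := weight_pos m h (order g) Hm Hh).
apply Rle_trans with ((2 * A * S + 1) * weight m h (order g)); [nra |].
unfold weight; right; ring.
Qed.

Lemma EM_bounded (m : nat -> R) (f : R * R -> C) :
  EM m f -> exists B, forall p, Cmod (f p) <= B.
Proof.
intros [_ [A [h [_ [_ H]]]]]. eexists. intros p. apply (H p (0, 0)%nat).
Qed.

Lemma EM_coefficient_decay (m : nat -> R) (f : R * R -> C) :
  EM m f -> exists A h, 0 < A /\ 0 < h /\ forall k j,
    Cmod (torus_int (fun p => chi k p * f p)%C) * freq_norm k ^ j <= A * weight m h j.
Proof.
intros [Hf [A [h [HA [Hh H]]]]].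
exists (8 * PI ^ 2 * A), h. split; [| split; [exact Hh |]].
- apply Rmult_lt_0_compat; [| exact HA].
  apply Rmult_lt_0_compat; [lra | apply pow_lt, PI_RGT_0].
- intros k j. rewrite Rmult_assoc. apply fourier_coefficient_decay; [exact Hf |].
  intros g p Hg. specialize (H p g). rewrite Hg in H. unfold weight. lra.
Qed.

Lemma decay_coefficient (m : nat -> R) (xi : nat -> Z * Z) (f : R * R -> C) :
  EM m f -> decay m xi (coefficient xi f).
Proof.
intros Hf. destruct (EM_coefficient_decay m f Hf) as [A [h [HA [Hh H]]]].
assert (Hc : 0 < Cmod (/ RtoC (4 * PI ^ 2))) by (rewrite Cmod_inv; [apply Rinv_0_lt_compat, Cmod_gt_0 |]; apply four_PI2_neq_0).
exists (Cmod (/ RtoC (4 * PI ^ 2)) * A), h. split; [nra | split; [exact Hh |]].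
intros n k. unfold coefficient. rewrite Cmod_mult, <- (freq_norm_opp (xi n)), !Rmult_assoc.
apply Rmult_le_compat_l; [lra | apply H].
Qed.

(** Together with [EM_fourier] and [decay_coefficient], this identifies [EM m] with the
    space of sequences satisfying [decay m]. *)
Theorem EM_fourier_inversion (m : nat -> R) (xi : nat -> Z * Z) (f : R * R -> C) :
  weight_sequence m -> enumerates xi -> EM m f -> f = fourier xi (coefficient xi f).
Proof.
intros Hm Hxi Hf. destruct (EM_bounded m f Hf) as [B HB].
apply (fourier_inversion xi f B); auto; try apply Hxi.
- apply Hf.
- apply (decay_rapid m); auto. now apply decay_coefficient.
Qed.

Lemma decay_lin (m : nat -> R) (xi : nat -> Z * Z) (c d : C) (a b : nat -> C) :
  weight_sequence m -> decay m xi a -> decay m xi b ->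
  decay m xi (fun n => c * a n + d * b n)%C.
Proof.
intros Hm [A [h [HA [Hh H]]]] [A' [h' [HA' [Hh' H']]]].
assert (Hc := Cmod_ge_0 c). assert (Hd := Cmod_ge_0 d).
exists (Cmod c * A + Cmod d * A' + 1), (Rmax h h').
assert (L1 := Rmax_l h h'). assert (L2 := Rmax_r h h').
split; [nra | split; [lra |]].
intros n k. assert (Hx := pow_le _ k (freq_norm_pos (xi n))).
assert (W1 := weight_le m h (Rmax h h') k Hm Hh L1).
assert (W2 := weight_le m h' (Rmax h h') k Hm Hh' L2).
assert (W0 := weight_pos m h k Hm Hh).
set (W := weight m (Rmax h h') k) in *.
apply Rle_trans with ((Cmod c * Cmod (a n) + Cmod d * Cmod (b n)) * freq_norm (xi n) ^ k).
- apply Rmult_le_compat_r; [exact Hx |].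
  eapply Rle_trans; [apply Cmod_triangle | rewrite !Cmod_mult; lra].
- assert (T1 : Cmod (a n) * freq_norm (xi n) ^ k <= A * W).
  { eapply Rle_trans; [apply H | apply Rmult_le_compat_l; lra]. }
  assert (T2 : Cmod (b n) * freq_norm (xi n) ^ k <= A' * W).
  { eapply Rle_trans; [apply H' | apply Rmult_le_compat_l; lra]. }
  apply (Rmult_le_compat_l (Cmod c)) in T1; [| exact Hc].
  apply (Rmult_le_compat_l (Cmod d)) in T2; [| exact Hd].
  nra.
Qed.

Lemma EM_lin (m : nat -> R) (c d : C) (f g : R * R -> C) :
  weight_sequence m -> EM m f -> EM m g -> EM m (fun p => c * f p + d * g p)%C.
Proof.
intros Hm Hf Hg. assert (Hxi := enumerates_freq).
assert (Da := decay_coefficient m freq f Hf). assert (Db := decay_coefficient m freq g Hg).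
assert (Ef := EM_fourier_inversion m freq f Hm Hxi Hf).
assert (Eg := EM_fourier_inversion m freq g Hm Hxi Hg).
set (a := coefficient freq f) in *. set (b := coefficient freq g) in *.
replace (fun p => c * f p + d * g p)%C with (fourier freq (fun n => c * a n + d * b n)%C).
- apply EM_fourier; auto. now apply decay_lin.
- assert (Sa := rapid_abs_summable _ _ (decay_rapid m freq a Hm Hxi Da)).
  assert (Sb := rapid_abs_summable _ _ (decay_rapid m freq b Hm Hxi Db)).
  apply functional_extensionality; intros p.
  rewrite fourier_plus by now apply abs_summable_scal.
  rewrite !fourier_scal by assumption. now rewrite Ef, Eg.
Qed.

Lemma EM_chi (m : nat -> R) (k : Z * Z) : weight_sequence m -> EM m (chi k).
Proof.
intros Hm. destruct enumerates_freq as [_ [Hsurj _]]. destruct (Hsurj k) as [N HN].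
replace (chi k) with (fourier freq (delta N)).
- apply EM_fourier; auto using enumerates_freq.
  assert (Hk := freq_norm_pos k).
  exists 1, (freq_norm k + 1). split; [lra | split; [lra |]].
  intros n j. unfold delta. destruct (Nat.eqb_spec n N) as [-> | _].
  + rewrite Cmod_1, HN. unfold weight.
    assert (F1 : 1 <= INR (fact j)).
    { change 1 with (INR 1). apply le_INR, lt_O_fact. }
    assert (M1 := weight_sequence_ge_1 m Hm j).
    assert (P1 : freq_norm k ^ j <= (freq_norm k + 1) ^ j) by (apply pow_incr; lra).
    assert (P0 := pow_le _ j Hk).
    assert (1 <= m j * INR (fact j)) by nra. nra.
  + rewrite Cmod_0. generalize (weight_pos m (freq_norm k + 1) j Hm ltac:(lra)); lra.
- rewrite (fourier_ext freq (delta N) (fun n => 1 * delta N n)%C) by (intros; ring).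
  rewrite fourier_delta, HN. apply functional_extensionality; intros p; ring.
Qed.

(** * Continuous functionals and Fourier series *)

Lemma Cmod_lt_of_ball (z w : C) (eps : R) : ball z eps w -> Cmod w < Cmod z + 2 * eps.
Proof.
intros [B1 B2].
change (Rabs (Re w - Re z) < eps) in B1. change (Rabs (Im w - Im z) < eps) in B2.
replace w with (z + (w - z))%C by ring.
eapply Rle_lt_trans; [apply Cmod_triangle |]. apply Rplus_lt_compat_l.
eapply Rle_lt_trans; [apply Cmod_le_Re_Im |].
unfold Re, Im in *; simpl in *; unfold Rminus in *; lra.
Qed.

Lemma open_Cmod_lt (eps : R) : open (fun z : C => Cmod z < eps).
Proof.
intros z Hz. assert (Hd : 0 < (eps - Cmod z) / 2) by lra.
exists (mkposreal _ Hd). intros w Hw. apply Cmod_lt_of_ball in Hw. simpl in Hw. lra.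
Qed.

Lemma dual_scal (m : nat -> R) (u : functional) (c : C) (f : R * R -> C) :
  dual_EM m u -> EM m f -> u (fun p => c * f p)%C = (c * u f)%C.
Proof.
intros [Hl _] Hf.
transitivity (u (fun p => c * f p + 0 * f p)%C).
- f_equal. apply functional_extensionality; intros p; ring.
- rewrite Hl by assumption; ring.
Qed.

Lemma EMh_norm_le (m : nat -> R) (h B : R) (f : R * R -> C) :
  weight_sequence m -> 0 < h ->
  (forall p g, Cmod (Dgamma g f p) <= B * weight m h (order g)) -> Rbar_le (EMh_norm m h f) B.
Proof.
intros Hm Hh H. unfold EMh_norm. set (E := fun r : R => _).
apply (proj2 (Lub_Rbar_correct E)). intros r [p [g ->]]. simpl.
assert (W := weight_pos m h (order g) Hm Hh). change (_ * _ * _) with (weight m h (order g)).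
apply Rmult_le_reg_r with (weight m h (order g)); [exact W |].
unfold Rdiv. rewrite Rmult_assoc, Rinv_l, Rmult_1_r by lra. apply H.
Qed.

Lemma EMh_norm_lt (m : nat -> R) (h B : R) (f : R * R -> C) :
  weight_sequence m -> 0 < h -> Rbar_lt (EMh_norm m h f) B ->
  forall p g, Cmod (Dgamma g f p) <= B * weight m h (order g).
Proof.
intros Hm Hh Hlt p g. unfold EMh_norm in Hlt. set (E := fun r : R => _) in Hlt.
assert (W := weight_pos m h (order g) Hm Hh).
assert (HE : Rbar_le (Cmod (Dgamma g f p) / weight m h (order g)) B).
{ apply Rbar_lt_le. eapply Rbar_le_lt_trans; [| exact Hlt].
  apply (proj1 (Lub_Rbar_correct E)). now exists p, g. }
simpl in HE. apply (Rmult_le_compat_r (weight m h (order g))) in HE; [| lra].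
unfold Rdiv in HE. rewrite Rmult_assoc, Rinv_l, Rmult_1_r in HE by lra. exact HE.
Qed.

Lemma EMh_EM (m : nat -> R) (h : R) (f : R * R -> C) :
  weight_sequence m -> 0 < h -> EMh m h f -> EM m f.
Proof.
intros Hm Hh [Hf Hlt]. split; [exact Hf |].
assert (HB : exists B, 0 < B /\ Rbar_lt (EMh_norm m h f) B).
{ destruct (EMh_norm m h f) as [r | |].
  - exists (Rabs r + 1). generalize (Rle_abs r) (Rabs_pos r); simpl; split; lra.
  - contradiction.
  - exists 1; simpl; split; [lra | trivial]. }
destruct HB as [B [HB Hn]]. exists B, h. split; [exact HB | split; [exact Hh |]].
intros p g. eapply Rle_trans; [apply (EMh_norm_lt m h B f Hm Hh Hn p g) |].
unfold weight; right; ring.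
Qed.

Lemma steps_unbounded (h : R) : exists n, h <= steps n.
Proof.
destruct (INR_unbounded h) as [n Hn]. exists n. unfold steps. rewrite S_INR. lra.
Qed.

(** The remainders of the Fourier series tend to zero in the norm of one of the Banach
    steps, hence in the inductive limit. *)
Lemma dual_fourier_tail (m : nat -> R) (u : functional) (xi : nat -> Z * Z) (b : nat -> C)
    (eps : R) :
  weight_sequence m -> dual_EM m u -> 0 < eps ->
  (exists A h, 0 < A /\ 0 < h /\ strong_decay m xi b A h) ->
  exists N0, forall N, (N0 <= N)%nat -> Cmod (u (fourier xi (tail N b))) < eps.
Proof.
intros Hm [Hl Hc] Heps [A [h [HA [Hh Hd]]]].
set (z := fun _ : R * R => 0%C).
assert (Ez : forall k : Z * Z, (fun p => 0 * chi k p + 0 * chi k p)%C = z)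
  by (intros k; apply functional_extensionality; intros p; unfold z; ring).
assert (EMz : EM m z).
{ rewrite <- (Ez (0, 0)%Z). apply EM_lin; auto using EM_chi. }
assert (uz : u z = 0%C).
{ rewrite <- (Ez (0, 0)%Z), Hl by now apply EM_chi. ring. }
destruct (Hc _ (open_Cmod_lt eps)) as [_ HO].
destruct (HO z) as [U [[_ [_ HU]] HUO]].
{ split; [exact EMz |]. rewrite uz, Cmod_0; exact Heps. }
destruct (steps_unbounded h) as [n Hn].
destruct (HU n) as [e [He Hball]].
destruct (Series_Rtail_small _ (e / (4 * A)) ex_series_inv_sq) as [N0 HN0];
  [apply Rdiv_lt_0_compat; lra |].
exists N0. intros N HN. specialize (HN0 N HN).
set (S := Series (Rtail N (fun n => / (INR n + 1) ^ 2))) in *.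
apply Rabs_def2 in HN0.
assert (HS : 2 * A * S <= e / 2).
{ apply Rle_trans with (2 * A * (e / (4 * A))); [apply Rmult_le_compat_l; lra |].
  right; field; lra. }
set (F := fourier xi (tail N b)).
assert (Hnorm : Rbar_le (EMh_norm m (steps n) F) (e / 2)).
{ apply EMh_norm_le; [exact Hm | lra |]. intros p g.
  eapply Rle_trans; [apply (Dgamma_fourier_tail_le m xi b A h N g p Hd) |]. fold S.
  assert (W := weight_le m h (steps n) (order g) Hm Hh Hn).
  assert (W0 := weight_pos m h (order g) Hm Hh).
  nra. }
assert (HF : EMh m (steps n) F).
{ split; [apply smooth_torus_fourier, rapid_tail; eapply strong_decay_rapid, Hd |].
  eapply Rbar_le_lt_trans; [exact Hnorm | exact I]. }
assert (HEM : EM m F) by (apply (EMh_EM m (steps n)); [exact Hm | lra | exact HF]).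
apply (HUO F HEM).
replace (fun p => F p - z p)%C with F
  by (apply functional_extensionality; intros p; unfold z; ring).
apply Hball; [exact HF |]. eapply Rbar_le_lt_trans; [exact Hnorm | simpl; lra].
Qed.

Lemma decay_tail (m : nat -> R) (xi : nat -> Z * Z) (N : nat) (b : nat -> C) :
  decay m xi b -> decay m xi (tail N b).
Proof.
intros [A [h [HA [Hh Hd]]]]. exists A, h. split; [exact HA | split; [exact Hh |]].
intros n k. eapply Rle_trans; [| apply Hd].
apply Rmult_le_compat_r; [apply pow_le, freq_norm_pos | apply Cmod_tail_le].
Qed.

Lemma dual_fourier (m : nat -> R) (u : functional) (xi : nat -> Z * Z) (b : nat -> C) :
  weight_sequence m -> enumerates xi -> dual_EM m u -> decay m xi b ->
  abs_summable (fun n => b n * u (chi (xi n)))%C ->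
  u (fourier xi b) = Cseries (fun n => b n * u (chi (xi n)))%C.
Proof.
intros Hm Hxi Hu Hb Hs. assert (Hr := decay_rapid m xi b Hm Hxi Hb).
assert (Hstep : forall N, (u (fourier xi b) =
  Csum N (fun n => b n * u (chi (xi n))) + u (fourier xi (tail N b)))%C).
{ induction N as [|N IH]; simpl; [now rewrite Cplus_0_l |].
  rewrite IH.
  replace (fourier xi (tail N b)) with
    (fun p => b N * chi (xi N) p + 1 * fourier xi (tail (S N) b) p)%C.
  - rewrite (proj1 Hu).
    + ring.
    + now apply EM_chi.
    + apply EM_fourier; auto using decay_tail.
  - apply functional_extensionality; intros p. rewrite (fourier_tail_S xi N) by exact Hr. ring. }
apply Cseries_unique; [exact Hs |]. intros eps Heps.
destruct (dual_fourier_tail m u xi b eps Hm Hu Heps (decay_strong m xi b Hm Hxi Hb)) as [N0 HN0].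
exists N0; intros N HN. rewrite (Hstep N).
replace (Csum N _ + _ - Csum N _)%C with (u (fourier xi (tail N b))) by ring.
left; now apply HN0.
Qed.

(** * Sufficiency of the frequency condition *)

Definition symbol (alpha : C) (k : Z * Z) : C :=
  (RtoC (IZR (fst k)) - alpha * RtoC (IZR (snd k)))%C.

(** The symbol is at most the infimum over [j] of [weight m h j / freq_norm k ^ j],
    that is, the exponential of minus the associated function of the weights. Stating
    it for every [j] dispenses with that infimum. *)
Definition symbol_small (m : nat -> R) (alpha : C) (h : R) (k : Z * Z) : Prop :=
  forall j, Cmod (symbol alpha k) * freq_norm k ^ j <= weight m h j.

Definition frequency_condition (m : nat -> R) (alpha : C) : Prop :=
  forall h, 0 < h -> exists N, forall n, (N <= n)%nat -> ~ symbol_small m alpha h (freq n).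

(** Finitely many coefficients are absorbed by enlarging the constants, since the
    weights are at least the powers of [h]. *)
Lemma decay_eventually (m : nat -> R) (xi : nat -> Z * Z) (a : nat -> C) (N : nat) :
  weight_sequence m -> forall A h, 0 < A -> 0 < h ->
  (forall n k, (N <= n)%nat -> Cmod (a n) * freq_norm (xi n) ^ k <= A * weight m h k) ->
  decay m xi a.
Proof.
intros Hm. induction N as [|N IH]; intros A h HA Hh H.
- exists A, h. split; [exact HA | split; [exact Hh |]]. intros n k; apply H; lia.
- assert (Ha := Cmod_ge_0 (a N)). assert (Hx := freq_norm_pos (xi N)).
  apply (IH (A + Cmod (a N)) (h + freq_norm (xi N))); try lra.
  intros n k Hn.
  assert (W1 := weight_pos m (h + freq_norm (xi N)) k Hm ltac:(lra)).
  destruct (Nat.eq_dec n N) as [-> | Hne].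
  + apply Rle_trans with (Cmod (a N) * weight m (h + freq_norm (xi N)) k); [| nra].
    apply Rmult_le_compat_l; [exact Ha |].
    assert (F1 : 1 <= INR (fact k)) by (change 1 with (INR 1); apply le_INR, lt_O_fact).
    assert (M1 := weight_sequence_ge_1 m Hm k).
    assert (P1 : freq_norm (xi N) ^ k <= (h + freq_norm (xi N)) ^ k) by (apply pow_incr; lra).
    assert (P0 := pow_le _ k Hx).
    unfold weight. assert (1 <= m k * INR (fact k)) by nra. nra.
  + eapply Rle_trans; [apply H; lia |].
    assert (W := weight_le m h (h + freq_norm (xi N)) k Hm Hh ltac:(lra)). nra.
Qed.

Lemma P_op_chi (m : nat -> R) (alpha : C) (u : functional) (k : Z * Z) :
  weight_sequence m -> dual_EM m u ->
  P_op alpha u (chi (opp_freq k)) = (symbol alpha k * u (chi (opp_freq k)))%C.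
Proof.
intros Hm Hu. unfold P_op, dual_D1, dual_D2, symbol.
rewrite D1_chi, D2_chi, !(dual_scal m) by auto using EM_chi.
simpl. rewrite !opp_IZR, !RtoC_opp. ring.
Qed.

(** If [P u = g], the Fourier coefficients [v] of [u] are those of [g] divided by the
    symbol. At a high frequency the symbol exceeds some [weight m (G * h) k] divided
    by the [k]-th power of the frequency; moderate growth splits the bound of order
    [j + k] on the coefficients of [g] into this loss and the bound of order [j]
    on [v]. *)
Lemma hypoelliptic_of_frequency_condition (m : nat -> R) (alpha : C) :
  weight_sequence m -> frequency_condition m alpha -> globally_hypoelliptic m (P_op alpha).
Proof.
intros Hm Hcond u Hu [g [Hg HP]].
set (v := fun n => (/ RtoC (4 * PI ^ 2) * u (chi (opp_freq (freq n))))%C).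
assert (Hv : forall n, (symbol alpha (freq n) * v n)%C = coefficient freq g n).
{ intros n. unfold v, coefficient.
  rewrite (torus_int_ext _ (fun p => g p * chi (opp_freq (freq n)) p)%C) by (intros; ring).
  rewrite <- HP by now apply EM_chi. rewrite (P_op_chi m) by assumption. ring. }
assert (Dv : decay m freq v).
{ destruct (decay_coefficient m freq g Hg) as [A [h [HA [Hh Hd]]]].
  destruct (weight_moderate m Hm) as [G [HG Hmod]].
  assert (HGh : 0 < G * h) by nra.
  destruct (Hcond (G * h) HGh) as [N HN].
  apply (decay_eventually m freq v N Hm A (G * h) HA HGh).
  intros n j Hn. specialize (HN n Hn).
  apply not_all_ex_not in HN. destruct HN as [k Hk]. apply Rnot_le_lt in Hk.
  assert (Wk := weight_pos m (G * h) k Hm HGh). assert (Wj := weight_pos m (G * h) j Hm HGh).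
  specialize (Hd n (j + k)%nat). rewrite <- Hv, Cmod_mult, pow_add in Hd.
  specialize (Hmod h j k Hh).
  assert (Hx := pow_le _ j (freq_norm_pos (freq n))). assert (V0 := Cmod_ge_0 (v n)).
  apply Rmult_le_reg_r with (weight m (G * h) k); [exact Wk |].
  apply Rle_trans with (Cmod (v n) * freq_norm (freq n) ^ j *
    (Cmod (symbol alpha (freq n)) * freq_norm (freq n) ^ k)).
  - apply Rmult_le_compat_l; [now apply Rmult_le_pos | lra].
  - apply Rle_trans with (A * weight m h (j + k)); [lra |].
    rewrite Rmult_assoc. apply Rmult_le_compat_l; lra. }
assert (Rv := decay_rapid m freq v Hm enumerates_freq Dv).
exists (fourier freq v). split; [apply EM_fourier; auto using enumerates_freq |].
intros phi Hphi.
destruct (EM_bounded m phi Hphi) as [B HB].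
assert (Cphi := smooth_torus_continuous phi (proj1 Hphi)).
rewrite (torus_int_fourier freq v phi B) by assumption.
set (xi := fun n => opp_freq (freq n)).
assert (Hxi : enumerates xi) by apply enumerates_opp, enumerates_freq.
assert (Eterm : forall n, (v n * torus_int (fun p => chi (freq n) p * phi p) =
  coefficient xi phi n * u (chi (xi n)))%C).
{ intros n. unfold coefficient, v, xi. rewrite opp_freq_involutive. ring. }
assert (Ephi := EM_fourier_inversion m xi phi Hm Hxi Hphi).
rewrite Ephi at 1. rewrite (dual_fourier m); auto using decay_coefficient.
- apply Cseries_ext. intros n; now rewrite Eterm.
- apply abs_summable_le with (fun n => 8 * PI ^ 2 * B * Cmod (v n)).
  + intros n. rewrite <- Eterm, Cmod_mult, Rmult_comm.
    apply Rmult_le_compat_r; [apply Cmod_ge_0 |]. apply torus_int_bound.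
    * apply continuousC_mult; auto using continuousC_chi.
    * intros p; rewrite Cmod_mult, Cmod_chi, Rmult_1_l; apply HB.
  + apply ex_series_scal_R. apply (rapid_abs_summable freq v Rv).
Qed.

(** * Necessity of the frequency condition *)

(** The distribution whose Fourier series has the coefficients [s]. *)
Definition coefficient_sum (s : nat -> C) : functional :=
  fun phi => Cseries (fun n => s n * torus_int (fun p => chi (freq n) p * phi p))%C.

Lemma torus_int_chi_summable (m : nat -> R) (h : R) :
  weight_sequence m -> 0 < h -> exists K, 0 < K /\ forall (B : R) (f : R * R -> C),
    smooth_torus f -> (forall g p, Cmod (Dgamma g f p) <= B * weight m h (order g)) ->
    forall n, Cmod (torus_int (fun p => chi (freq n) p * f p)%C) <= K * B * / (INR n + 1) ^ 2.
Proof.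
intros Hm Hh.
destruct (weight_gain m freq Hm enumerates_freq h Hh) as [K [h' [HK [Hh' G]]]].
assert (W0 := weight_pos m h' 0 Hm ltac:(lra)).
assert (HP : 0 < 8 * PI ^ 2) by (generalize PI_RGT_0; intros; nra).
exists (K * (8 * PI ^ 2) * weight m h' 0). split; [apply Rmult_lt_0_compat; [apply Rmult_lt_0_compat |]; assumption |].
intros B f Hf HB n.
assert (Hdec : forall k, Cmod (torus_int (fun p => chi (freq n) p * f p)%C) *
  freq_norm (freq n) ^ k <= 8 * PI ^ 2 * B * weight m h k).
{ intros k. rewrite (Rmult_assoc _ B). apply fourier_coefficient_decay; [exact Hf |].
  intros g p Hg. rewrite <- Hg. apply HB. }
assert (H := G _ _ n (Cmod_ge_0 _) Hdec 0%nat). rewrite pow_O, Rmult_1_r in H.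
eapply Rle_trans; [exact H | right; ring].
Qed.

Lemma EM_weight_bound (m : nat -> R) (f : R * R -> C) :
  EM m f -> exists B h, 0 < h /\ forall g p, Cmod (Dgamma g f p) <= B * weight m h (order g).
Proof.
intros [_ [A [h [_ [Hh H]]]]]. exists A, h. split; [exact Hh |].
intros g p. eapply Rle_trans; [apply H |]. unfold weight; right; ring.
Qed.

Lemma coefficient_sum_summable (m : nat -> R) (s : nat -> C) (f : R * R -> C) :
  weight_sequence m -> (forall n, Cmod (s n) <= 1) -> EM m f ->
  abs_summable (fun n => s n * torus_int (fun p => chi (freq n) p * f p))%C.
Proof.
intros Hm Hs Hf. destruct (EM_weight_bound m f Hf) as [B [h [Hh HB]]].
destruct (torus_int_chi_summable m h Hm Hh) as [K [HK HKb]].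
apply abs_summable_le with (fun n => K * B * / (INR n + 1) ^ 2);
  [| apply ex_series_scal_R, ex_series_inv_sq].
intros n. rewrite Cmod_mult.
eapply Rle_trans; [| apply (HKb B f (proj1 Hf) HB n)].
specialize (Hs n).
generalize (Cmod_ge_0 (torus_int (fun p => chi (freq n) p * f p)%C)); nra.
Qed.

Lemma coefficient_sum_lin (m : nat -> R) (s : nat -> C) (f g : R * R -> C) (a b : C) :
  weight_sequence m -> (forall n, Cmod (s n) <= 1) -> EM m f -> EM m g ->
  coefficient_sum s (fun p => a * f p + b * g p)%C =
    (a * coefficient_sum s f + b * coefficient_sum s g)%C.
Proof.
intros Hm Hs Hf Hg. unfold coefficient_sum.
assert (Sf := coefficient_sum_summable m s f Hm Hs Hf).
assert (Sg := coefficient_sum_summable m s g Hm Hs Hg).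
rewrite <- !Cseries_scal, <- Cseries_plus by auto using abs_summable_scal.
apply Cseries_ext; intros n.
assert (Cf := smooth_torus_continuous f (proj1 Hf)).
assert (Cg := smooth_torus_continuous g (proj1 Hg)).
assert (H1 : continuousC (fun p => chi (freq n) p * f p)%C)
  by (apply continuousC_mult; [apply continuousC_chi | exact Cf]).
assert (H2 : continuousC (fun p => chi (freq n) p * g p)%C)
  by (apply continuousC_mult; [apply continuousC_chi | exact Cg]).
rewrite (torus_int_ext _ (fun p => a * (chi (freq n) p * f p) + b * (chi (freq n) p * g p))%C)
  by (intros; ring).
rewrite torus_int_plus, !torus_int_scal; auto using continuousC_scal.
ring.
Qed.

Lemma dual_coefficient_sum (m : nat -> R) (s : nat -> C) :
  weight_sequence m -> (forall n, Cmod (s n) <= 1) -> dual_EM m (coefficient_sum s).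
Proof.
intros Hm Hs. split.
{ intros f g a b Hf Hg. now apply (coefficient_sum_lin m). }
intros O HO. split; [now intros f [Hf _] |].
intros f [Hf HOf]. destruct (HO _ HOf) as [d Hd].
assert (Hd0 := cond_pos d).
exists (fun g => EM m g /\ Cmod (coefficient_sum s g) <= d / 2).
split; [split; [| split] |].
- now intros g [Hg _].
- intros g1 g2 a b [H1 B1] [H2 B2] Hab.
  split; [now apply EM_lin |].
  rewrite (coefficient_sum_lin m) by assumption.
  eapply Rle_trans; [apply Cmod_triangle |]. rewrite !Cmod_mult.
  generalize (Cmod_ge_0 a) (Cmod_ge_0 b). nra.
- intros n. assert (Hst : 0 < steps n) by apply steps_admissible.
  destruct (torus_int_chi_summable m (steps n) Hm Hst) as [K [HK HKb]].
  set (T := Series (fun n => / (INR n + 1) ^ 2)).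
  assert (HT : 0 <= T).
  { apply Series_nonneg; [| apply ex_series_inv_sq].
    intros j. left. apply Rinv_0_lt_compat, pow_lt. generalize (pos_INR j); lra. }
  exists (d / (4 * K * (T + 1))). split; [apply Rdiv_lt_0_compat; [lra | nra] |].
  intros g Hg Hlt. split; [now apply (EMh_EM m (steps n)) |].
  assert (Hb := EMh_norm_lt m (steps n) _ g Hm Hst Hlt).
  set (e := d / (4 * K * (T + 1))) in *.
  assert (Hterm := HKb e g (proj1 Hg) (fun g p => Hb p g)).
  eapply Rle_trans.
  + apply (Cseries_le _ (fun n => K * e * / (INR n + 1) ^ 2)).
    * intros j. rewrite Cmod_mult. eapply Rle_trans; [| apply Hterm].
      specialize (Hs j).
      generalize (Cmod_ge_0 (torus_int (fun p => chi (freq j) p * g p)%C)); nra.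
    * apply ex_series_scal_R, ex_series_inv_sq.
  + rewrite Series_scal_l. fold T.
    assert (He : K * e * (T + 1) = d / 4) by (unfold e; field; lra).
    assert (0 < e) by (apply Rdiv_lt_0_compat; [lra | nra]).
    assert (K * e * T <= K * e * (T + 1)) by (apply Rmult_le_compat_l; nra).
    lra.
- intros g Hg [_ Hlt]. split; [exact Hg |]. apply Hd, ball_of_Cmod_lt.
  replace (fun p => g p - f p)%C with (fun p => 1 * g p + - (1) * f p)%C in Hlt
    by (apply functional_extensionality; intros p; ring).
  rewrite (coefficient_sum_lin m) in Hlt by assumption.
  replace (coefficient_sum s g - coefficient_sum s f)%C
    with (1 * coefficient_sum s g + - (1) * coefficient_sum s f)%C by ring.
  lra.
Qed.

(** Let [s] be the indicator of the frequencies with a small symbol. The distribution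
    with coefficients [s] is mapped by [P] into the class, whereas its own
    coefficients equal 1 at arbitrarily high frequencies. *)
Lemma not_hypoelliptic (m : nat -> R) (alpha : C) (h : R) :
  weight_sequence m -> 0 < h ->
  (forall N, exists n, (N <= n)%nat /\ symbol_small m alpha h (freq n)) ->
  ~ globally_hypoelliptic m (P_op alpha).
Proof.
intros Hm Hh Hinf Hyp.
set (s := fun n => if excluded_middle_informative (symbol_small m alpha h (freq n))
  then 1%C else 0%C).
assert (Hs : forall n, Cmod (s n) <= 1).
{ intros n; unfold s. destruct (excluded_middle_informative _);
    [rewrite Cmod_1 | rewrite Cmod_0]; lra. }
set (a := fun n => (s n * symbol alpha (freq n))%C).
assert (Da : decay m freq a).
{ exists 1, h. split; [lra | split; [exact Hh |]]. intros n k. unfold a, s.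
  destruct (excluded_middle_informative _) as [Hn | _].
  - rewrite Cmult_1_l, Rmult_1_l. apply Hn.
  - rewrite Cmult_0_l, Cmod_0. generalize (weight_pos m h k Hm Hh); lra. }
assert (Ra := decay_rapid m freq a Hm enumerates_freq Da).
destruct (Hyp (coefficient_sum s)) as [f [Hf Huf]].
- now apply dual_coefficient_sum.
- exists (fourier freq a). split; [apply EM_fourier; auto using enumerates_freq |].
  intros phi Hphi. destruct (EM_bounded m phi Hphi) as [B HB].
  rewrite (torus_int_fourier freq a phi B); auto using smooth_torus_continuous.
  2: { apply smooth_torus_continuous, Hphi. }
  unfold P_op, dual_D1, dual_D2, coefficient_sum.
  set (c := fun n => torus_int (fun p => chi (freq n) p * phi p)%C).
  rewrite (Cseries_ext _ (fun n => - (1) * (RtoC (IZR (fst (freq n))) * (s n * c n)))%C)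
    by (intros n; rewrite torus_int_chi_D1 by apply Hphi; unfold c; ring).
  rewrite (Cseries_ext (fun n => s n * torus_int (fun p => chi (freq n) p * D2 phi p))%C
     (fun n => - (1) * (RtoC (IZR (snd (freq n))) * (s n * c n)))%C)
    by (intros n; rewrite torus_int_chi_D2 by apply Hphi; unfold c; ring).
  assert (Rc : rapid freq (fun n => s n * c n)%C).
  { assert (Dc : decay m freq (fun n => s n * c n)%C).
    { destruct (EM_coefficient_decay m phi Hphi) as [A' [h' [HA' [Hh' Hd]]]].
      exists A', h'. split; [exact HA' | split; [exact Hh' |]]. intros n k.
      eapply Rle_trans; [| apply (Hd (freq n) k)].
      apply Rmult_le_compat_r; [apply pow_le, freq_norm_pos |].
      rewrite Cmod_mult. fold (c n). specialize (Hs n). generalize (Cmod_ge_0 (c n)); nra. }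
    apply (decay_rapid m); auto using enumerates_freq. }
  assert (S1 := rapid_abs_summable _ _ (rapid_mult1 freq _ Rc)).
  assert (S2 := rapid_abs_summable _ _ (rapid_mult2 freq _ Rc)).
  unfold mult1 in S1; unfold mult2 in S2.
  rewrite !Cseries_scal by assumption.
  transitivity (Cseries (fun n => RtoC (IZR (fst (freq n))) * (s n * c n))%C +
    - alpha * Cseries (fun n => RtoC (IZR (snd (freq n))) * (s n * c n))%C)%C; [ring |].
  rewrite <- Cseries_scal, <- Cseries_plus by auto using abs_summable_scal.
  apply Cseries_ext; intros n. unfold a, symbol, c. ring.
- assert (Df := decay_coefficient m freq f Hf).
  destruct (decay_strong m freq _ Hm enumerates_freq Df) as [A' [h' [HA' [Hh' Hd]]]].
  assert (W := weight_pos m h' 0 Hm Hh').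
  destruct (INR_unbounded (A' * weight m h' 0)) as [N HN].
  destruct (Hinf N) as [n [Hn Hsmall]].
  assert (Hone : coefficient freq f n = 1%C).
  { unfold coefficient.
    rewrite (torus_int_ext _ (fun p => f p * chi (opp_freq (freq n)) p)%C) by (intros; ring).
    rewrite <- Huf by now apply EM_chi.
    unfold coefficient_sum. rewrite (Cseries_single _ n).
    - unfold s. destruct (excluded_middle_informative _); [| contradiction].
      rewrite torus_int_chi_chi_eq. field. apply four_PI2_neq_0.
    - intros j Hj. rewrite torus_int_chi_chi_neq; [ring |].
      intros E; apply Hj, enumerates_freq, E. }
  specialize (Hd n 0%nat). rewrite Hone, Cmod_1, Rmult_1_l in Hd.
  apply le_INR in Hn. assert (H0 := pos_INR N).
  assert (Hp : 0 < (INR n + 1) ^ 2) by (apply pow_lt; lra).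
  apply (Rmult_le_compat_r ((INR n + 1) ^ 2)) in Hd; [| lra].
  rewrite (Rmult_assoc _ (/ _)), Rinv_l in Hd by lra.
  rewrite pow_O in Hd. nra.
Qed.

Theorem hypoelliptic_iff_frequency_condition (m : nat -> R) (alpha : C) :
  weight_sequence m ->
  (globally_hypoelliptic m (P_op alpha) <-> frequency_condition m alpha).
Proof.
intros Hm. split; [| now apply hypoelliptic_of_frequency_condition].
intros Hyp h Hh. apply NNPP; intros Hn.
apply (not_hypoelliptic m alpha h Hm Hh); [| exact Hyp].
intros N. apply NNPP; intros HN. apply Hn. exists N. intros n Hle Hs.
apply HN. now exists n.
Qed.

(** * Comparison of weight sequences *)

Lemma seq_prec_eventually (m l : nat -> R) (d : R) :
  weight_sequence m -> weight_sequence l -> seq_prec m l -> 0 < d ->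
  exists K, forall k, (K <= k)%nat -> m k <= d ^ k * l k.
Proof.
intros [Hm _] [Hl _] Hp Hd.
apply is_lim_seq_spec in Hp. destruct (Hp (mkposreal d Hd)) as [K HK]; simpl in HK.
exists (S K). intros k Hk. specialize (HK k ltac:(lia)).
assert (Hr : 0 < m k / l k) by now apply Rdiv_lt_0_compat.
assert (Hk0 : 0 < INR k) by (apply lt_0_INR; lia).
assert (E : Rpower (m k / l k) (/ INR k) ^ k = m k / l k).
{ rewrite <- Rpower_pow by apply exp_pos. rewrite Rpower_mult, Rinv_l by lra. now apply Rpower_1. }
assert (P0 : 0 < Rpower (m k / l k) (/ INR k)) by apply exp_pos.
rewrite Rminus_0_r, Rabs_pos_eq in HK by lra.
assert (L : m k / l k <= d ^ k) by (rewrite <- E; apply pow_incr; lra).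
apply (Rmult_le_compat_r (l k)) in L; [| left; apply Hl].
unfold Rdiv in L. rewrite Rmult_assoc, Rinv_l, Rmult_1_r in L by (apply Rgt_not_eq, Hl).
exact L.
Qed.

(** The base [B] has to be enlarged to cover the finitely many terms that the limit
    does not control; at [k = 0] both sequences equal 1. *)
Lemma seq_prec_le_geometric (m l : nat -> R) :
  weight_sequence m -> weight_sequence l -> seq_prec m l ->
  exists B, 1 <= B /\ forall k, m k <= B ^ k * l k.
Proof.
intros Hm Hl Hp.
destruct (seq_prec_eventually m l 1 Hm Hl Hp ltac:(lra)) as [K HK].
destruct Hm as [Hm [Hm0 _]], Hl as [Hl [Hl0 _]].
assert (Hfin : forall K B, 1 <= B -> (forall k, (K <= k)%nat -> m k <= B ^ k * l k) ->
  exists B, 1 <= B /\ forall k, m k <= B ^ k * l k).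
{ clear K HK. induction K as [|K IH]; intros B HB HK.
  - exists B; split; [exact HB |]. intros k; apply HK; lia.
  - assert (Hr : 0 < m K / l K) by now apply Rdiv_lt_0_compat.
    apply (IH (B + m K / l K)); [lra |]. intros k Hk.
    destruct (Nat.eq_dec k K) as [-> | Hne].
    + destruct K as [|K]; [simpl; lra |].
      replace (m (S K)) with (m (S K) / l (S K) * l (S K)) at 1
        by (field; apply Rgt_not_eq, Hl).
      apply Rmult_le_compat_r; [left; apply Hl |].
      rewrite <- tech_pow_Rmult.
      assert (1 <= (B + m (S K) / l (S K)) ^ K) by (apply pow_R1_Rle; lra). nra.
    + eapply Rle_trans; [apply HK; lia |].
      apply Rmult_le_compat_r; [left; apply Hl |]. apply pow_incr; lra. }
apply (Hfin K 1); [lra |]. exact HK.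
Qed.

Lemma frequency_condition_prec (m l : nat -> R) (alpha : C) :
  weight_sequence m -> weight_sequence l -> seq_prec m l ->
  frequency_condition l alpha -> frequency_condition m alpha.
Proof.
intros Hm Hl Hp Hcond h Hh.
destruct (seq_prec_le_geometric m l Hm Hl Hp) as [B [HB HBk]].
destruct (Hcond (B * h) ltac:(nra)) as [N HN].
exists N. intros n Hn Hs. apply (HN n Hn). intros j.
eapply Rle_trans; [apply Hs |]. unfold weight.
rewrite Rpow_mult_distr. apply Rmult_le_compat_r; [apply pos_INR |].
assert (P := pow_lt h j Hh). specialize (HBk j). nra.
Qed.

(** * A number with prescribed rational approximations *)

Lemma freq_norm_large (R0 : R) : exists N, forall n, (N <= n)%nat -> R0 < freq_norm (freq n).
Proof.
destruct enumerates_freq as [_ [_ [K [HK Hg]]]].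
set (r := Rabs R0).
destruct (INR_unbounded (K * (1 + r ^ 4))) as [N HN]. exists N. intros n Hn.
apply Rnot_le_lt; intros Hle. apply le_INR in Hn. assert (H0 := pos_INR n).
assert (Hr : freq_norm (freq n) ^ 4 <= r ^ 4).
{ apply pow_incr. split; [apply freq_norm_pos |]. generalize (Rle_abs R0); unfold r; lra. }
specialize (Hg n). nra.
Qed.

Lemma freq_norm_bounded_below_index (N : nat) :
  exists R0, forall n, (n < N)%nat -> freq_norm (freq n) <= R0.
Proof.
induction N as [|N [R0 IH]].
- exists 0; intros; lia.
- exists (Rmax R0 (freq_norm (freq N))). intros n Hn.
  destruct (Nat.eq_dec n N) as [-> | Hne]; [apply Rmax_r |].
  eapply Rle_trans; [apply IH; lia | apply Rmax_l].
Qed.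

Lemma exists_least (P : nat -> Prop) :
  (exists n, P n) -> exists n, P n /\ forall k, (k < n)%nat -> ~ P k.
Proof.
intros [n Hn]. revert Hn. induction n as [n IH] using lt_wf_ind. intros Hn.
destruct (classic (exists k, (k < n)%nat /\ P k)) as [[k [Hk Pk]] | H].
- now apply (IH k).
- exists n; split; [exact Hn |]. intros k Hk Pk. apply H; now exists k.
Qed.

Lemma pow_le_pow_fact (T k : nat) : (1 <= T)%nat -> (T ^ k <= T ^ T * fact k)%nat.
Proof.
intros HT. induction k as [|k IH].
- simpl. assert (0 < T ^ T)%nat by (apply Nat.neq_0_lt_0, Nat.pow_nonzero; lia). lia.
- destruct (Nat.le_gt_cases (S k) T) as [H | H].
  + assert (T ^ S k <= T ^ T)%nat by (apply Nat.pow_le_mono_r; lia).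
    assert (1 <= fact (S k))%nat by apply lt_O_fact. nia.
  + rewrite Nat.pow_succ_r', fact_simpl. nia.
Qed.

(** The power [2 ^ e] agrees up to a factor [4] with the supremum over [k] of
    [(2 ^ t) ^ k / (l k * k!)]. *)
Definition matching_exponent (l : nat -> R) (t e : nat) : Prop :=
  (forall k, 2 * (2 ^ t) ^ k <= 2 ^ e * (l k * INR (fact k))) /\
  (exists k, 2 ^ e * (l k * INR (fact k)) <= 4 * (2 ^ t) ^ k).

(** The least exponent satisfying the first half satisfies the second one. Such
    exponents exist because [T ^ k / k!] is bounded by [T ^ T] and [l k >= 1]. *)
Lemma exists_matching_exponent (l : nat -> R) (t : nat) :
  weight_sequence l -> exists e, matching_exponent l t e.
Proof.
intros Hl.
destruct (exists_least (fun e => forall k, 2 * (2 ^ t) ^ k <= 2 ^ e * (l k * INR (fact k))))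
  as [e [He Hmin]].
- exists (S (t * 2 ^ t)). intros k.
  assert (H := pow_le_pow_fact (2 ^ t) k ltac:(apply Nat.neq_0_lt_0, Nat.pow_nonzero; lia)).
  rewrite <- (Nat.pow_mul_r 2 t (2 ^ t)) in H.
  apply le_INR in H. rewrite mult_INR, !pow_INR in H. change (INR 2) with 2 in H.
  assert (L := weight_sequence_ge_1 l Hl k). assert (F := INR_fact_lt_0 k).
  assert (P : 0 < 2 ^ (t * 2 ^ t)) by (apply pow_lt; lra).
  rewrite <- tech_pow_Rmult.
  assert (INR (fact k) <= l k * INR (fact k)) by nra. nra.
- exists e. split; [exact He |].
  destruct e as [|e].
  + exfalso. specialize (He 0%nat). destruct Hl as [_ [L0 _]].
    rewrite L0 in He. simpl in He. lra.
  + specialize (Hmin e ltac:(lia)). apply not_all_ex_not in Hmin.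
    destruct Hmin as [k Hk]. exists k. apply Rnot_le_lt in Hk. rewrite <- tech_pow_Rmult. lra.
Qed.

(** [beta] is the sum of the numbers [/ 2 ^ s n], and [P n / 2 ^ s n] its [n]-th partial
    sum. The remainder is at most twice its first term, and [P n] is odd because every
    term but the last contributes an even number. *)
Lemma dyadic_limit (s : nat -> nat) :
  (1 <= s 0)%nat -> (forall n, (s n < s (S n))%nat) ->
  exists (beta : R) (P : nat -> Z), forall n,
    (P n mod 2 = 1)%Z /\ (0 <= P n <= 2 ^ Z.of_nat (s n))%Z /\
    / 2 ^ s (S n) <= beta - IZR (P n) / 2 ^ s n <= 2 * / 2 ^ s (S n).
Proof.
intros Hs0 Hs.
set (P := nat_rect (fun _ => Z) 1%Z (fun n p => (2 ^ Z.of_nat (s (S n) - s n) * p + 1)%Z)).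
set (x := fun n => IZR (P n) / 2 ^ s n).
assert (P2 : forall n, 0 < 2 ^ n) by (intros; apply pow_lt; lra).
assert (Ex : forall n, x (S n) = x n + / 2 ^ s (S n)).
{ intros n. unfold x. change (P (S n)) with (2 ^ Z.of_nat (s (S n) - s n) * P n + 1)%Z.
  rewrite plus_IZR, mult_IZR, <- pow_IZR.
  replace (2 ^ s (S n)) with (2 ^ (s (S n) - s n) * 2 ^ s n)
    by (rewrite <- pow_add; f_equal; generalize (Hs n); lia).
  field. split; apply Rgt_not_eq, P2. }
assert (Hr : forall n, 2 * / 2 ^ s (S n) <= / 2 ^ s n).
{ intros n. assert (H : 2 ^ S (s n) <= 2 ^ s (S n)) by (apply Rle_pow; [lra | apply Hs]).
  rewrite <- tech_pow_Rmult in H. apply Rmult_le_reg_r with (2 ^ s (S n)); [apply P2 |].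
  rewrite Rmult_assoc, Rinv_l, Rmult_1_r by apply Rgt_not_eq, P2.
  apply Rmult_le_reg_l with (2 ^ s n); [apply P2 |].
  rewrite <- Rmult_assoc, Rinv_r by apply Rgt_not_eq, P2. lra. }
assert (Hy : forall n d, x (n + d)%nat + 2 * / 2 ^ s (S (n + d)) <= x n + 2 * / 2 ^ s (S n)).
{ intros n d. induction d as [|d IH]; [rewrite Nat.add_0_r; lra |].
  rewrite Nat.add_succ_r, Ex. generalize (Hr (S (n + d))); lra. }
assert (Hx : forall n d, x n <= x (n + d)%nat).
{ intros n d. induction d as [|d IH]; [rewrite Nat.add_0_r; lra |].
  rewrite Nat.add_succ_r, Ex. generalize (Rinv_0_lt_compat _ (P2 (s (S (n + d))))); lra. }
assert (Hxy : forall n k, x k <= x n + 2 * / 2 ^ s (S n)).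
{ intros n k. destruct (Nat.le_gt_cases n k) as [H | H].
  - replace k with (n + (k - n))%nat by lia.
    generalize (Hy n (k - n)%nat) (Rinv_0_lt_compat _ (P2 (s (S (n + (k - n)))))); lra.
  - generalize (Hx k (n - k)%nat) (Rinv_0_lt_compat _ (P2 (s (S n)))).
    replace (k + (n - k))%nat with n by lia. lra. }
destruct (completeness (fun r => exists n, r = x n)) as [beta [Hub Hlub]].
- exists (x 0%nat + 2 * / 2 ^ s 1%nat). intros r [n ->]. apply Hxy.
- exists (x 0%nat). now exists 0%nat.
- exists beta, P. intros n. split; [| split].
  + destruct n as [|n]; [reflexivity |].
    change (P (S n)) with (2 ^ Z.of_nat (s (S n) - s n) * P n + 1)%Z.
    replace (Z.of_nat (s (S n) - s n)) with (Z.succ (Z.of_nat (s (S n) - s n - 1)))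
      by (generalize (Hs n); lia).
    rewrite Z.pow_succ_r, Z.add_comm, <- Z.mul_assoc, Z.mul_comm, Z.mod_add by lia. reflexivity.
  + split.
    * induction n as [|n IH]; [simpl; lia |].
      change (P (S n)) with (2 ^ Z.of_nat (s (S n) - s n) * P n + 1)%Z. nia.
    * apply le_IZR. rewrite <- pow_IZR.
      assert (H1 : x n <= 1).
      { eapply Rle_trans; [apply (Hxy 0%nat n) |]. unfold x. change (P 0%nat) with 1%Z.
        assert (H2 : / 2 ^ s 0%nat <= / 2).
        { apply Rinv_le_contravar; [lra |]. rewrite <- (pow_1 2) at 1. apply Rle_pow; [lra | exact Hs0]. }
        generalize (Hr 0%nat). unfold Rdiv; lra. }
      unfold x in H1. apply (Rmult_le_compat_r (2 ^ s n)) in H1; [| left; apply P2].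
      unfold Rdiv in H1. rewrite Rmult_assoc, Rinv_l, Rmult_1_r in H1 by apply Rgt_not_eq, P2. lra.
  + fold (x n). split.
    * assert (H : x (S n) <= beta) by (apply Hub; now exists (S n)). rewrite Ex in H. lra.
    * assert (H : beta <= x n + 2 * / 2 ^ s (S n)).
      { apply Hlub. intros r [k ->]. apply Hxy. }
      lra.
Qed.

(** The error of the [n]-th approximation is tuned to the weights: the distance from
    [2 ^ s n * beta] to the integer [P n] lies between [1 / 2 ^ e] and [2 / 2 ^ e], where
    [2 ^ e] matches the weights at the denominator [2 ^ s n]. *)
Definition approximation_sequence (l : nat -> R) (beta : R) (s : nat -> nat) (P : nat -> Z) : Prop :=
  (forall n, matching_exponent l (s n) (s (S n) - s n)) /\
  (forall n, (1 <= s n)%nat /\ (2 * s n <= s (S n))%nat) /\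
  forall n, (P n mod 2 = 1)%Z /\ (0 <= P n <= 2 ^ Z.of_nat (s n))%Z /\
    / 2 ^ (s (S n) - s n) <= 2 ^ s n * beta - IZR (P n) <= 2 * / 2 ^ (s (S n) - s n).

(** The condition [2 * s n <= s (S n)] holds once [2 ^ s n] exceeds [l 2], because the
    inequality at [k = 2] then makes the matching exponent at least [s n]; hence the start
    at a large [S t0]. *)
Lemma exists_approximation_sequence (l : nat -> R) :
  weight_sequence l -> exists beta s P, approximation_sequence l beta s P.
Proof.
intros Hl.
set (e := fun t => proj1_sig (constructive_indefinite_description _
  (exists_matching_exponent l t Hl))).
assert (He : forall t, matching_exponent l t (e t)).
{ intros t; unfold e. now destruct (constructive_indefinite_description _ _). }
assert (L2 := weight_sequence_ge_1 l Hl 2).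
destruct (Pow_x_infinity 2 ltac:(rewrite Rabs_pos_eq; lra) (l 2%nat)) as [t0 Ht0].
assert (Hlarge : forall t, (t0 <= t)%nat -> (t <= e t)%nat).
{ intros t Ht. specialize (Ht0 t ltac:(lia)). rewrite Rabs_pos_eq in Ht0 by (apply pow_le; lra).
  destruct (He t) as [H _]. specialize (H 2%nat). simpl in H.
  apply Nat.nlt_ge; intros Hlt.
  assert (2 ^ e t < 2 ^ t) by (apply Rlt_pow; [lra | exact Hlt]).
  assert (0 < 2 ^ e t) by (apply pow_lt; lra). nra. }
set (s := nat_rect (fun _ => nat) (S t0) (fun _ t => (t + e t)%nat)).
assert (Es : forall n, s (S n) = (s n + e (s n))%nat) by reflexivity.
assert (Hst : forall n, (S t0 <= s n)%nat).
{ induction n as [|n IH]; [apply le_n |]. rewrite Es; lia. }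
assert (Hse : forall n, (s n <= e (s n))%nat) by (intros n; apply Hlarge; specialize (Hst n); lia).
destruct (dyadic_limit s) as [beta [P HP]].
{ apply (Nat.le_trans _ (S t0)); [lia | apply Hst]. }
{ intros n; rewrite Es. specialize (Hst n); specialize (Hse n); lia. }
exists beta, s, P. split; [| split].
- intros n. rewrite Es. replace (s n + e (s n) - s n)%nat with (e (s n)) by lia. apply He.
- intros n. rewrite Es. specialize (Hst n); specialize (Hse n); lia.
- intros n. destruct (HP n) as [H1 [H2 H3]]. split; [exact H1 | split; [exact H2 |]].
  assert (P2 : forall k, 0 < 2 ^ k) by (intros; apply pow_lt; lra).
  assert (E : 2 ^ s (S n) = 2 ^ s n * 2 ^ (s (S n) - s n)).
  { rewrite <- pow_add. f_equal. rewrite Es; lia. }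
  assert (E1 : / 2 ^ (s (S n) - s n) = 2 ^ s n * / 2 ^ s (S n)).
  { rewrite E. field. split; apply Rgt_not_eq, P2. }
  assert (E2 : 2 ^ s n * beta - IZR (P n) = 2 ^ s n * (beta - IZR (P n) / 2 ^ s n)).
  { field. apply Rgt_not_eq, P2. }
  rewrite E1, E2. assert (Q := P2 (s n)). split.
  + apply Rmult_le_compat_l; lra.
  + replace (2 * (2 ^ s n * / 2 ^ s (S n))) with (2 ^ s n * (2 * / 2 ^ s (S n))) by ring.
    apply Rmult_le_compat_l; lra.
Qed.

(** Compare [p / q] with the first approximation [P n / 2 ^ s n] for which [q] is small
    against [2 ^ (s (S n) - s n)]. A different fraction lies at distance at least
    [1 / (q * 2 ^ s n)] from it, at least twice the error of the approximation, and
    minimality of [n] bounds [2 ^ s n] by a multiple of [q ^ 2]. An equal fraction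
    has a denominator of at least [2 ^ s n], so that the error of the approximation,
    which matches the weights at [2 ^ s n], is large enough. *)
Lemma approximation_lower_bound (l : nat -> R) (beta : R) (s : nat -> nat) (P : nat -> Z) :
  weight_sequence l -> approximation_sequence l beta s P ->
  exists c, 0 < c <= 1 /\ forall p q : Z, (0 < q)%Z ->
    exists k, c * (l k * INR (fact k)) <= Rabs (IZR p - beta * IZR q) * IZR q ^ k.
Proof.
intros Hl [Hmatch [Hs HP]].
assert (P2 : forall k, 0 < 2 ^ k) by (intros; apply pow_lt; lra).
assert (L2 := weight_sequence_ge_1 l Hl 2).
set (C := 64 * 2 ^ s 0%nat * l 2%nat).
assert (HQ0 : 1 <= 2 ^ s 0%nat) by (apply pow_R1_Rle; lra).
assert (HC : 32 <= C) by (unfold C; nra).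
exists (/ C). split.
{ split; [apply Rinv_0_lt_compat; lra |]. rewrite <- Rinv_1. apply Rinv_le_contravar; lra. }
intros p q Hq.
assert (Hq1 : 1 <= IZR q) by (apply IZR_le; lia).
set (a := fun n => 2 ^ (s (S n) - s n)).
destruct (exists_least (fun n => 4 * IZR q <= a n)) as [n [Hn Hmin]].
{ assert (Hsn : forall n, (n <= s n)%nat).
  { induction n as [|n IH]; [lia |]. destruct (Hs n); lia. }
  destruct (Pow_x_infinity 2 ltac:(rewrite Rabs_pos_eq; lra) (4 * IZR q)) as [n Hn].
  exists n. specialize (Hn (s (S n) - s n)%nat).
  rewrite Rabs_pos_eq in Hn by (apply pow_le; lra). apply Rge_le, Hn.
  destruct (Hs n). specialize (Hsn n). lia. }
destruct (HP n) as [Hodd [_ [Hlo Hup]]]. fold (a n) in Hlo, Hup.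
assert (Ha : 0 < a n) by apply P2.
assert (Hia : 0 < / a n) by now apply Rinv_0_lt_compat.
set (Q := 2 ^ s n) in *. assert (HQ : 0 < Q) by apply P2.
assert (EQ : Q = IZR (2 ^ Z.of_nat (s n))) by apply pow_IZR.
destruct (Z.eq_dec (q * P n) (p * 2 ^ Z.of_nat (s n))) as [Heq | Hne].
- (* [P n] is odd, so that the fraction [P n / 2 ^ s n] is reduced and its denominator
     divides [q] *)
  destruct (Hmatch n) as [_ [k Hk]]. fold (a n) in Hk. fold Q in Hk.
  assert (Hdiv : (2 ^ Z.of_nat (s n) | q)%Z).
  { apply Gauss with (P n).
    - exists p. rewrite Z.mul_comm. exact Heq.
    - apply rel_prime_sym, rel_prime_Zpower_r; [lia |]. apply rel_prime_sym.
      apply prime_rel_prime; [apply prime_2 |]. intros Hd. apply Zdivide_mod in Hd. lia. }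
  assert (HqQ : Q <= IZR q).
  { rewrite EQ. apply IZR_le, Z.divide_pos_le; assumption. }
  assert (Hval : / a n <= Rabs (IZR p - beta * IZR q)).
  { assert (E : Q * (beta * IZR q - IZR p) = IZR q * (Q * beta - IZR (P n))).
    { apply (f_equal IZR) in Heq. rewrite !mult_IZR, <- EQ in Heq. lra. }
    assert (D : / a n <= beta * IZR q - IZR p).
    { apply Rmult_le_reg_l with Q; [exact HQ |]. rewrite E.
      apply Rmult_le_compat; lra. }
    rewrite Rabs_minus_sym. eapply Rle_trans; [exact D | apply Rle_abs]. }
  exists k. assert (Pk : Q ^ k <= IZR q ^ k) by (apply pow_incr; lra).
  assert (Qk : 0 < Q ^ k) by now apply pow_lt.
  assert (W : 0 < l k * INR (fact k)) by (apply Rmult_lt_0_compat; [apply Hl | apply INR_fact_lt_0]).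
  apply Rle_trans with (/ a n * Q ^ k).
  + apply Rle_trans with (/ 4 * (l k * INR (fact k))).
    * apply Rmult_le_compat_r; [lra |]. apply Rinv_le_contravar; lra.
    * apply Rmult_le_reg_l with (4 * a n); [lra |].
      replace (4 * a n * (/ a n * Q ^ k)) with (4 * Q ^ k) by (field; lra). lra.
  + apply Rmult_le_compat; lra.
- (* the cross difference is a nonzero integer, of which the error of the approximation
     takes away at most one half *)
  assert (Hval : / (2 * Q) <= Rabs (IZR p - beta * IZR q)).
  { assert (D1 : 1 <= Rabs (IZR (q * P n - p * 2 ^ Z.of_nat (s n)))).
    { rewrite <- abs_IZR. apply IZR_le. lia. }
    rewrite minus_IZR, !mult_IZR, <- EQ in D1.
    assert (D2 : IZR q * Rabs (Q * beta - IZR (P n)) <= / 2).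
    { rewrite Rabs_pos_eq by lra.
      apply Rle_trans with (a n / 4 * (2 * / a n)).
      - apply Rmult_le_compat; lra.
      - right; field; lra. }
    apply Rmult_le_reg_l with Q; [exact HQ |].
    replace (Q * / (2 * Q)) with (/ 2) by (field; lra).
    replace (Q * Rabs (IZR p - beta * IZR q)) with
      (Rabs ((IZR q * IZR (P n) - IZR p * Q) + IZR q * (Q * beta - IZR (P n)))).
    - assert (T : forall u v, Rabs u - Rabs v <= Rabs (u + v)).
      { intros u v. generalize (Rabs_triang_inv u (- v)). rewrite Rabs_Ropp.
        now replace (u - - v) with (u + v) by ring. }
      eapply Rle_trans; [| apply T]. rewrite Rabs_mult, (Rabs_pos_eq (IZR q)) by lra. lra.
    - rewrite <- (Rabs_pos_eq Q) at 3 by lra. rewrite <- Rabs_mult, <- Rabs_Ropp. f_equal. ring. }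
  exists 2%nat.
  assert (HQq : Q <= 2 ^ s 0%nat * (16 * IZR q ^ 2)).
  { destruct n as [|n].
    - unfold Q. assert (1 <= IZR q ^ 2) by (simpl; nra). nra.
    - specialize (Hmin n ltac:(lia)). apply Rnot_le_lt in Hmin.
      assert (E : Q = 2 ^ s n * a n).
      { unfold Q, a. rewrite <- pow_add. f_equal. destruct (Hs n); lia. }
      assert (Hle : 2 ^ s n <= a n) by (apply Rle_pow; [lra | destruct (Hs n); lia]).
      assert (0 < 2 ^ s n) by apply P2.
      assert (Q <= 16 * IZR q ^ 2) by (rewrite E; simpl; nra).
      assert (0 <= 16 * IZR q ^ 2) by (simpl; nra). nra. }
  assert (Hq2 : 0 < IZR q ^ 2) by (apply pow_lt; lra).
  apply Rle_trans with (/ (2 * Q) * IZR q ^ 2); [| apply Rmult_le_compat_r; lra].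
  change (INR (fact 2)) with 2.
  apply Rmult_le_reg_l with (C * (2 * Q)); [nra |].
  replace (C * (2 * Q) * (/ C * (l 2%nat * 2))) with (2 * Q * (l 2%nat * 2)) by (field; lra).
  replace (C * (2 * Q) * (/ (2 * Q) * IZR q ^ 2)) with (C * IZR q ^ 2) by (field; lra).
  apply Rle_trans with (2 * (2 ^ s 0%nat * (16 * IZR q ^ 2)) * (l 2%nat * 2)).
  + apply Rmult_le_compat_r; lra.
  + unfold C. right; ring.
Qed.

(** * Conclusion *)

Lemma Cmod_symbol_real (beta : R) (k : Z * Z) :
  Cmod (symbol (RtoC beta) k) = Rabs (IZR (fst k) - beta * IZR (snd k)).
Proof. unfold symbol. now rewrite <- RtoC_mult, <- RtoC_minus, Cmod_R. Qed.

(** A rational number would annihilate the left factor of the lower bound. *)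
Lemma approximation_irrational (l : nat -> R) (beta : R) (s : nat -> nat) (P : nat -> Z) :
  weight_sequence l -> approximation_sequence l beta s P -> irrational beta.
Proof.
intros Hl HP [q Hq].
destruct (approximation_lower_bound l beta s P Hl HP) as [c [Hc Hlow]].
destruct (Hlow (Qnum q) (Zpos (Qden q)) (Pos2Z.is_pos _)) as [k Hk].
replace (IZR (Qnum q) - beta * IZR (Zpos (Qden q))) with 0 in Hk.
- rewrite Rabs_R0, Rmult_0_l in Hk.
  assert (W : 0 < l k * INR (fact k)) by (apply Rmult_lt_0_compat; [apply Hl | apply INR_fact_lt_0]).
  nra.
- rewrite Hq. unfold Q2R. field. apply IZR_neq. lia.
Qed.

Lemma approximation_symbol_lower_bound (l : nat -> R) (beta : R) (s : nat -> nat) (P : nat -> Z) :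
  weight_sequence l -> approximation_sequence l beta s P ->
  exists c, 0 < c <= 1 /\ forall xi, xi <> (0, 0)%Z ->
    exists k, c * (l k * INR (fact k)) <= Cmod (symbol (RtoC beta) xi) * freq_norm xi ^ k.
Proof.
intros Hl HP.
destruct (approximation_lower_bound l beta s P Hl HP) as [c [Hc Hlow]].
exists c. split; [exact Hc |]. intros [p q] Hxi. rewrite Cmod_symbol_real; simpl.
assert (Hpos : forall p q : Z, (0 < q)%Z -> exists k, c * (l k * INR (fact k)) <=
  Rabs (IZR p - beta * IZR q) * freq_norm (p, q) ^ k).
{ clear p q Hxi. intros p q Hq. destruct (Hlow p q Hq) as [k Hk]. exists k.
  eapply Rle_trans; [exact Hk |]. apply Rmult_le_compat_l; [apply Rabs_pos |].
  apply pow_incr. split; [apply IZR_le; lia |].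
  eapply Rle_trans; [apply Rle_abs | apply Rmax_r]. }
destruct (Z.lt_trichotomy q 0) as [Hq | [-> | Hq]].
- destruct (Hpos (- p)%Z (- q)%Z ltac:(lia)) as [k Hk]. exists k.
  eapply Rle_trans; [exact Hk |]. right. f_equal.
  + rewrite !opp_IZR, <- Rabs_Ropp. f_equal; ring.
  + f_equal. apply (freq_norm_opp (p, q)).
- exists 0%nat. destruct Hl as [_ [L0 _]]. rewrite L0, Rmult_0_r, Rminus_0_r. simpl.
  assert (1 <= Rabs (IZR p)).
  { rewrite <- abs_IZR. apply IZR_le. assert (p <> 0%Z) by congruence. lia. }
  lra.
- now apply Hpos.
Qed.

(** A large witness [k] of the lower bound contradicts smallness directly, since [m k]
    is negligible against [l k]. For the finitely many small [k] the symbol is bounded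
    below by a fixed power of the frequency, and the exponent [K] gives the
    contradiction at high frequencies. *)
Lemma frequency_condition_approximation (m l : nat -> R) (beta : R) (s : nat -> nat) (P : nat -> Z) :
  weight_sequence m -> weight_sequence l -> seq_prec m l ->
  approximation_sequence l beta s P -> frequency_condition m (RtoC beta).
Proof.
intros Hm Hl Hp HP h Hh.
destruct (approximation_symbol_lower_bound l beta s P Hl HP) as [c [Hc Hlow]].
destruct (seq_prec_eventually m l (/ (2 * h)) Hm Hl Hp) as [K1 HK1];
  [apply Rinv_0_lt_compat; lra |].
destruct (pow_lt_1_zero (/ 2) ltac:(rewrite Rabs_pos_eq; lra) c ltac:(lra)) as [K2 HK2].
set (K := Nat.max K1 K2).
destruct (freq_norm_large (Rmax 1 (weight m h K / c))) as [N HN].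
exists N. intros n Hn Hsmall. specialize (HN n Hn).
set (xi := freq n) in *.
assert (T1 := Rle_lt_trans _ _ _ (Rmax_l _ _) HN).
assert (T2 := Rle_lt_trans _ _ _ (Rmax_r _ _) HN).
assert (Hxi : xi <> (0, 0)%Z).
{ intros E. rewrite E in T1. unfold freq_norm in T1. simpl in T1.
  rewrite Rabs_R0, Rmax_left in T1; lra. }
destruct (Hlow xi Hxi) as [k Hk].
assert (Lk := weight_sequence_ge_1 l Hl k).
assert (Fk : 1 <= INR (fact k)) by (change 1 with (INR 1); apply le_INR, lt_O_fact).
assert (Wk : 1 <= l k * INR (fact k)) by nra.
destruct (Nat.le_gt_cases K k) as [Hle | Hgt].
- assert (Hmk := HK1 k ltac:(lia)). assert (Hck := HK2 k ltac:(lia)).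
  rewrite Rabs_pos_eq in Hck by (apply pow_le; lra).
  specialize (Hsmall k). unfold weight in Hsmall.
  assert (Hhk : h ^ k * m k <= (/ 2) ^ k * l k).
  { apply Rle_trans with (h ^ k * ((/ (2 * h)) ^ k * l k)).
    - apply Rmult_le_compat_l; [apply pow_le; lra | exact Hmk].
    - right. rewrite <- Rmult_assoc, <- Rpow_mult_distr. do 2 f_equal. field; lra. }
  assert (Hlt : (/ 2) ^ k * l k * INR (fact k) < c * (l k * INR (fact k))).
  { rewrite Rmult_assoc. apply Rmult_lt_compat_r; lra. }
  apply (Rmult_le_compat_r (INR (fact k))) in Hhk; [| lra].
  lra.
- specialize (Hsmall K).
  assert (E : freq_norm xi ^ K = freq_norm xi ^ k * freq_norm xi ^ (K - k)).
  { rewrite <- pow_add. f_equal; lia. }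
  assert (H1 : freq_norm xi <= freq_norm xi ^ (K - k)).
  { rewrite <- (pow_1 (freq_norm xi)) at 1. apply Rle_pow; [lra | lia]. }
  assert (H2 : c * freq_norm xi <= weight m h K).
  { eapply Rle_trans; [| exact Hsmall]. rewrite E, <- Rmult_assoc.
    apply Rmult_le_compat; try lra. nra. }
  apply (Rmult_lt_compat_l c) in T2; [| lra].
  replace (c * (weight m h K / c)) with (weight m h K) in T2 by (field; lra). lra.
Qed.

(** The frequencies [(P n, 2 ^ s n)] have a small symbol for [h = 1]. *)
Lemma not_frequency_condition_approximation (l : nat -> R) (beta : R) (s : nat -> nat) (P : nat -> Z) :
  weight_sequence l -> approximation_sequence l beta s P -> ~ frequency_condition l (RtoC beta).
Proof.
intros Hl [Hmatch [Hs HP]] Hcond.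
destruct (Hcond 1 ltac:(lra)) as [N HN].
destruct (freq_norm_bounded_below_index N) as [R0 HR0].
assert (Hsn : forall j, (j <= s j)%nat).
{ induction j as [|j IH]; [lia |]. destruct (Hs j); lia. }
destruct (Pow_x_infinity 2 ltac:(rewrite Rabs_pos_eq; lra) (R0 + 1)) as [j Hj].
specialize (Hj (s j) (Hsn j)). rewrite Rabs_pos_eq in Hj by (apply pow_le; lra).
destruct (HP j) as [_ [HPj [Hlo Hup]]].
set (Q := 2 ^ s j) in *. assert (HQ : 0 < Q) by (apply pow_lt; lra).
set (a := 2 ^ (s (S j) - s j)) in *. assert (Ha : 0 < a) by (apply pow_lt; lra).
assert (EQ : Q = IZR (2 ^ Z.of_nat (s j))) by apply pow_IZR.
set (xi := (P j, (2 ^ Z.of_nat (s j))%Z)).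
assert (Hnorm : freq_norm xi = Q).
{ unfold freq_norm, xi; simpl. rewrite <- EQ, (Rabs_pos_eq Q) by lra.
  apply Rmax_right. rewrite Rabs_pos_eq by (apply IZR_le; lia).
  rewrite EQ. apply IZR_le; lia. }
destruct enumerates_freq as [_ [Hsurj _]]. destruct (Hsurj xi) as [n Hn].
assert (Hle : (N <= n)%nat).
{ apply Nat.nlt_ge; intros Hlt. specialize (HR0 n Hlt). rewrite Hn, Hnorm in HR0. lra. }
apply (HN n Hle). rewrite Hn. intros k.
rewrite Cmod_symbol_real, Hnorm. unfold xi; cbn [fst snd]. rewrite <- EQ.
destruct (Hmatch j) as [Hk _]. specialize (Hk k). fold Q a in Hk.
unfold weight. rewrite pow1, Rmult_1_l.
assert (Hia : 0 < / a) by now apply Rinv_0_lt_compat.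
assert (Habs : Rabs (IZR (P j) - beta * Q) <= 2 * / a).
{ rewrite Rabs_minus_sym, Rabs_pos_eq by lra. lra. }
apply Rle_trans with (2 * / a * Q ^ k).
- apply Rmult_le_compat_r; [apply pow_le; lra | exact Habs].
- apply Rmult_le_reg_l with a; [exact Ha |].
  replace (a * (2 * / a * Q ^ k)) with (2 * Q ^ k) by (field; lra). exact Hk.
Qed.

Theorem theorem6p10 :
  forall L M : nat -> R,
    weight_sequence L -> weight_sequence M -> seq_prec M L ->
    (forall alpha : C,
       globally_hypoelliptic L (P_op alpha) -> globally_hypoelliptic M (P_op alpha)) /\
    (exists beta : R,
       irrational beta /\
       globally_hypoelliptic M (P_op (RtoC beta)) /\
       ~ globally_hypoelliptic L (P_op (RtoC beta))).
Proof.
intros L M HL HM Hprec. split.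
- intros alpha. rewrite !hypoelliptic_iff_frequency_condition by assumption.
  now apply frequency_condition_prec.
- destruct (exists_approximation_sequence L HL) as [beta [s [P HP]]].
  exists beta. rewrite !hypoelliptic_iff_frequency_condition by assumption.
  split; [| split].
  + now apply (approximation_irrational L beta s P).
  + now apply (frequency_condition_approximation M L beta s P).
  + now apply (not_frequency_condition_approximation L beta s P).
Qed.
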